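(* Let $\Bbbk$ be a field of characteristic $2$, let $E$ be a $\Bbbk$-vector space of dimension $n=2m+1\ge 3$, and let $(q_0,q_1)$ be a regular pair of quadratic forms on $E$ whose half-discriminant polynomial $\Delta=\sum_{i=0}^n a_it_0^{n-i}t_1^i$ has $a_n\ne0$. Let $\wp:A\to A$, $\wp(s)=s^2+s$, be the Artin–Schreier map. There is an isomorphism of groups between $A/(\wp(A)+\Bbbk)$ and the Galois cohomology group $H^1(\Bbbk,\underline{\mathrm{Aut}}(q_0,q_1))$ which takes the class of the $r$-invariant of (a normal form of) $(q_0,q_1)$ to the class of the $\underline{\mathrm{Aut}}(q_0,q_1)$-torsor of generators of $X=V(q_0,q_1)$.
   Context: A quadratic form on $E$ is an element $q\in S^2E^\vee$; its polar form $b(v,w)=q(v+w)-q(v)-q(w)$ is alternating. A pair $(q_0,q_1)$ is regular if $X=V(q_0,q_1)$ is smooth over $\Bbbk$ and of codimension $2$ in the projective space $|E|$ of lines in $E$. Half-discriminant: fix a volume form on $E$. For a quadratic form $q$ with polar form $b$ and a basis $e_1,\ldots,e_n$ of $E$ of volume $1$, put $\omega=\sum_i \mathrm{Pf}_i\,e_i$, where $\mathrm{Pf}_i$ is the Pfaffian of $(b(e_j,e_k))_{j,k}$ with $i$-th row and column deleted; set $\tfrac12\mathrm{disc}(q):=q(\omega)$ and $\Delta(t_0,t_1):=\tfrac12\mathrm{disc}(t_0q_0+t_1q_1)=\sum_{i=0}^n a_it_0^{n-i}t_1^i$. Normal form (every regular pair has one): a basis $(x_0,\ldots,x_m,y_0,\ldots,y_{m-1})$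 of $E^\vee$ and $r_0,\ldots,r_{n-2}\in\Bbbk$ such that $q_0=\sum_{i=0}^m a_{2i}x_i^2+\sum_{i=0}^{m-1}x_{i+1}y_i+\sum_{i=0}^{m-1}r_{2i+1}y_i^2$ and $q_1=\sum_{i=0}^m a_{2i+1}x_i^2+\sum_{i=0}^{m-1}x_iy_i+\sum_{i=0}^{m-1}r_{2i}y_i^2$, with $a_0,\dots,a_n$ the coefficients of $\Delta$. Let $f(T)=\Delta(1,T)$, $A=\Bbbk[T]/(f(T))$, $t$ the image of $T$ in $A$, and $d_i=a_{i+1}+a_{i+2}t+\cdots+a_nt^{n-1-i}$ for $0\le i\le n-1$ (a $\Bbbk$-basis of $A$). The $r$-invariant of the normal form is $r=r_0d_0+\cdots+r_{n-2}d_{n-2}\in A$; its class in $A/(\wp(A)+\Bbbk)$ does not depend on the normal form. Let $\Bbbk^s$ be a separable closure of $\Bbbk$. $\underline{\mathrm{Aut}}(q_0,q_1)$ is the finite étale group scheme over $\Bbbk$ corresponding to the (finite abelian) $\mathrm{Gal}(\Bbbk^s/\Bbbk)$-module of all $g\in\mathrm{GL}(E\otimes\Bbbk^s)$ with $q_0\circ g=q_0$ and $q_1\circ g=q_1$. A generator of $X$ is a linear subspace of projective dimension $m-1$ contained in $X$ (over an extension of $\Bbbk$). The set of generators of $X$ over $\Bbbk^s$, with its Galois action, is an $\underline{\mathrm{Aut}}(q_0,q_1)$-torsor (the group acts simply transitively). *)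

(* Defs.v *)
From HB Require Import structures.
From mathcomp Require Import all_boot all_order all_algebra all_field.
From mathcomp Require Import ring_quotient qpoly.
From mathcomp Require Import boolp functions.

Set Implicit Arguments.
Unset Strict Implicit.
Unset Printing Implicit Defensive.

Import GRing.Theory.
Local Open Scope ring_scope.
Local Open Scope quotient_scope.

Section Pfaffian.
Variable R : comNzRingType.

(* Expansion along the first row; only meant for alternating matrices. *)
Fixpoint pfaffian (n : nat) : 'M[R]_n -> R :=
  match n with
  | 0 => fun _ => 1
  | 1 => fun _ => 0
  | n'.+2 => fun B => \sum_(j < n'.+1) (-1) ^+ j * B ord0 (lift ord0 j) *
                        pfaffian (row' j (col' j (row' ord0 (col' ord0 B))))
  end.

End Pfaffian.

Definition polar (R : pzRingType) (V : zmodType) (q : V -> R) (v w : V) : R :=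
  q (v + w) - q v - q w.

(* Over a field, the natural map from S^2 E^vee to functions on E is injective
   (also over F_2), with the functions below as its image. *)
Definition quadratic_form (k : fieldType) (E : lmodType k) (q : E -> k) : Prop :=
  [/\ forall a v, q (a *: v) = a ^+ 2 * q v,
      forall a u v w, polar q (a *: u + v) w = a * polar q u w + polar q v w
    & forall a u v w, polar q w (a *: u + v) = a * polar q w u + polar q w v].

Section HalfDiscriminant.
Variables (R : comNzRingType) (n : nat).

Definition polar_mx (q : 'rV[R]_n.+1 -> R) : 'M[R]_n.+1 :=
  \matrix_(i, j) polar q (delta_mx 0 i) (delta_mx 0 j).

Definition omega (q : 'rV[R]_n.+1 -> R) : 'rV[R]_n.+1 :=
  \row_i pfaffian (row' i (col' i (polar_mx q))).

Definition half_disc (q : 'rV[R]_n.+1 -> R) : R := q (omega q).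

End HalfDiscriminant.

Section BaseChange.
Variables (k : fieldType) (R : comNzRingType) (iota : {rmorphism k -> R}).
Variables (n : nat) (E : vectType k) (e : n.-tuple E).

(* The quadratic form on E (x) R obtained from q, where E (x) R is identified
   with R^n through the basis e of E. *)
Definition base_change (q : E -> k) (v : 'rV[R]_n) : R :=
  \sum_(i < n) iota (q e`_i) * v 0 i ^+ 2
  + \sum_(i < n) \sum_(j < n | (i < j)%N)
      iota (polar q e`_i e`_j) * v 0 i * v 0 j.

(* The gradient at v: the i-th partial derivative of the equation of q is the
   value of the linear form b(v, _) at the i-th basis vector. *)
Definition gradient (q : E -> k) (v : 'rV[R]_n) : 'rV[R]_n :=
  \row_i polar (base_change q) v (delta_mx 0 i).

End BaseChange.

(* Jacobian criterion: V(q0, q1) is smooth of codimension 2 iff the Jacobian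
   matrix of (q0, q1) has rank 2 at every point of V(q0, q1), i.e. at every
   L-valued point for every field extension L of k. *)
Definition regular_pair (k : fieldType) (n : nat) (E : vectType k)
    (e : n.-tuple E) (q0 q1 : E -> k) : Prop :=
  forall (L : fieldType) (iota : {rmorphism k -> L}) (v : 'rV[L]_n),
    v != 0 -> base_change iota e q0 v = 0 -> base_change iota e q1 v = 0 ->
    \rank (col_mx (gradient iota e q0 v) (gradient iota e q1 v)) = 2.

Section Pencil.
Variables (k : fieldType) (m : nat) (E : vectType k).
Variables (e : (m.*2.+1).-tuple E) (q0 q1 : E -> k).

(* k[t0, t1] is {poly {poly k}}: t0 = 'X%:P is the inner variable and t1 = 'X
   the outer one. *)
Definition const2 : {rmorphism k -> {poly {poly k}}} :=
  (@polyC {poly k}) \o (@polyC k).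

(* The half-discriminant of t0 q0 + t1 q1, for the volume form on E for which
   the basis e has volume 1. *)
Definition Delta : {poly {poly k}} :=
  half_disc (fun v => 'X%:P * base_change const2 e q0 v
                      + 'X * base_change const2 e q1 v).

(* The coefficient of t0^(n-i) t1^i, where n = 2m+1. *)
Definition disc_coef (i : nat) : k := Delta`_i`_(m.*2.+1 - i).

(* Delta(1, T) *)
Definition disc_poly : {poly k} := map_poly (horner_eval (1 : k)) Delta.

(* {poly %/ h} is k[T]/(h) only for a monic h, hence the normalization. *)
Definition disc_monic : {poly k} := (lead_coef disc_poly)^-1 *: disc_poly.
Local Notation algA := {poly %/ disc_monic}.

Definition algT : algA := in_qpoly _ 'X.

Definition alg_scal (c : k) : algA := qpolyC _ c.

Definition alg_d (i : nat) : algA :=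
  \sum_(j < m.*2.+1 - i) alg_scal (disc_coef (i + j).+1) * algT ^+ j.

Definition r_invariant (r : (m.*2).-tuple k) : algA :=
  \sum_(i < m.*2) alg_scal r`_i * alg_d i.

(* (x, y) is a basis of the dual of E in which (q0, q1) is in normal form. *)
Definition normal_form (x : 'I_m.+1 -> 'Hom(E, k^o)) (y : 'I_m -> 'Hom(E, k^o))
    (r : (m.*2).-tuple k) : Prop :=
  [/\ basis_of fullv ([seq x i | i : 'I_m.+1] ++ [seq y i | i : 'I_m]),
      forall v : E, q0 v =
        \sum_(i < m.+1) disc_coef i.*2 * x i v ^+ 2
        + \sum_(i < m) x (lift ord0 i) v * y i v
        + \sum_(i < m) r`_(i.*2.+1) * y i v ^+ 2
    & forall v : E, q1 v =
        \sum_(i < m.+1) disc_coef i.*2.+1 * x i v ^+ 2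
        + \sum_(i < m) x (widen_ord (leqnSn m) i) v * y i v
        + \sum_(i < m) r`_(i.*2) * y i v ^+ 2].

(* The subgroup wp(A) + k of A, where wp(s) = s^2 + s.  It depends on char2 only
   so that the subgroup instance below can be inferred. *)
Definition wp_add_scal (char2 : 2%N \in [pchar k]) : {pred algA} :=
  fun a => `[< exists (s : algA) (c : k), a = s ^+ 2 + s + alg_scal c >].

Section WpClosed.
Hypothesis char2 : 2%N \in [pchar k].

Fact algA_opp (a : algA) : - a = a.
Proof.
have ch : 2%N \in [pchar algA] by rewrite pchar_qpoly.
exact: oppr_pchar2.
Qed.

Fact wp_add_scal_zmod_closed : zmod_closed (wp_add_scal char2).
Proof.
have ch : 2%N \in [pchar algA] by rewrite pchar_qpoly.
split=> [|a b].
  apply/asboolP; exists 0, 0.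
  by rewrite expr0n /= !add0r /alg_scal qpolyC0.
move=> /asboolP[s [c ->]] /asboolP[s' [c' ->]]; apply/asboolP.
exists (s + s'), (c + c').
have -> : alg_scal (c + c') = alg_scal c + alg_scal c'.
  by apply: val_inj; rewrite /= polyCD.
have -> : (s + s') ^+ 2 = s ^+ 2 + s' ^+ 2.
  by rewrite -!(pFrobenius_autE ch) pFrobenius_autD_comm //; apply: mulrC.
by rewrite algA_opp addrACA [X in X + _]addrACA.
Qed.

HB.instance Definition _ :=
  GRing.isZmodClosed.Build algA (wp_add_scal char2) wp_add_scal_zmod_closed.

(* A/(wp(A) + k) *)
Definition algA_quot : Type := {ideal_quot wp_add_scal char2}.
HB.instance Definition _ := GRing.Zmodule.on algA_quot.

Definition algA_class (a : algA) : algA_quot :=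
  \pi_{ideal_quot wp_add_scal char2} a.

End WpClosed.

End Pencil.

Definition separable_closure (k K : fieldType) (iota : {rmorphism k -> K}) : Prop :=
  (forall x : K, exists2 p : {poly k},
      separable_poly p & root (map_poly iota p) x) /\
  (forall p : {poly K}, (1 < size p)%N -> separable_poly p ->
      exists x, root p x).

Section Galois.
Variables (k K : fieldType) (iota : {rmorphism k -> K}).

Record gal := Gal {
  gal_fun :> {rmorphism K -> K};
  gal_bij : bijective gal_fun;
  gal_fix : forall a, gal_fun (iota a) = iota a }.

Fact gal_comp_fix (s t : gal) a : (s \o t) (iota a) = iota a.
Proof. by rewrite /= !gal_fix. Qed.

Definition gal_comp (s t : gal) : gal :=
  @Gal (s \o t) (bij_comp (gal_bij s) (gal_bij t)) (gal_comp_fix s t).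

(* First cohomology of Gal(K/k), with its Krull topology, with coefficients in
   the discrete module M. *)
Section Cohomology.
Variables (M : zmodType) (act : gal -> {additive M -> M}).

Definition is_cocycle : {pred gal -> M} := fun c =>
  `[< (forall s t, c (gal_comp s t) = c s + act s (c t)) /\
      (forall s : gal, exists S : seq K,
         forall t : gal, (forall x, x \in S -> t x = s x) -> c t = c s) >].

Fact is_cocycle_zmod_closed : zmod_closed is_cocycle.
Proof.
split=> [|c d].
  by apply/asboolP; split=> [s t|s]; [rewrite raddf0 addr0 | exists [::]].
move=> /asboolP[c1 c2] /asboolP[d1 d2]; apply/asboolP; split=> [s t|s].
  by rewrite !fctE c1 d1 raddfB /= opprD addrACA.
have [S hS] := c2 s; have [T hT] := d2 s.
exists (S ++ T) => t h; rewrite !fctE (hS t) ?(hT t) // => x xS;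
  by apply: h; rewrite mem_cat xS ?orbT.
Qed.

HB.instance Definition _ :=
  GRing.isZmodClosed.Build (gal -> M) is_cocycle is_cocycle_zmod_closed.

Record cocycle := Cocycle { cocycle_fun :> gal -> M; _ : cocycle_fun \in is_cocycle }.

HB.instance Definition _ := [isSub for cocycle_fun].
HB.instance Definition _ := [Choice of cocycle by <:].
HB.instance Definition _ := [SubChoice_isSubZmodule of cocycle by <:].

Definition is_coboundary : {pred cocycle} := fun c =>
  `[< exists a : M, forall s, c s = act s a - a >].

Fact is_coboundary_zmod_closed : zmod_closed is_coboundary.
Proof.
split=> [|c d].
  by apply/asboolP; exists 0 => s; rewrite raddf0 subr0.
move=> /asboolP[a ha] /asboolP[b hb]; apply/asboolP; exists (a - b) => s.
by rewrite -[LHS]/(c s - d s) ha hb (raddfB (act s)) !opprD !opprK addrACA.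
Qed.

HB.instance Definition _ :=
  GRing.isZmodClosed.Build cocycle is_coboundary is_coboundary_zmod_closed.

Definition H1 : Type := {ideal_quot is_coboundary}.
HB.instance Definition _ := GRing.Zmodule.on H1.

Definition H1class (c : cocycle) : H1 := \pi_{ideal_quot is_coboundary} c.

End Cohomology.

(* Aut(q0, q1)(K), and the set of generators.  Vectors of E (x) K are rows, so
   a matrix g stands for the linear map v |-> v *m g, and g acts on subspaces,
   given by matrices with independent rows, by W |-> W *m g. *)
Section Aut.
Variables (m : nat) (E : vectType k) (e : (m.*2.+1).-tuple E) (q0 q1 : E -> k).
Local Notation n := (m.*2.+1).
Local Notation Q0 := (base_change iota e q0).
Local Notation Q1 := (base_change iota e q1).

Definition preserves (g : 'M[K]_n) : bool :=
  (g \in unitmx) &&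
  `[< forall v : 'rV[K]_n, Q0 (v *m g) = Q0 v /\ Q1 (v *m g) = Q1 v >].

Record aut : predArgType := Aut { aut_mx :> 'M[K]_n; _ : preserves aut_mx }.

HB.instance Definition _ := [isSub for aut_mx].
HB.instance Definition _ := [Choice of aut by <:].

Fact preserves1 : preserves 1%:M.
Proof. by rewrite /preserves unitmx1; apply/asboolP => v; rewrite mulmx1. Qed.

Fact preservesM (g h : aut) : preserves (g *m h).
Proof.
case: g h => [g /andP[gu /asboolP gP]] [h /andP[hu /asboolP hP]] /=.
rewrite /preserves unitmx_mul gu hu; apply/asboolP => v.
by rewrite mulmxA !(hP _).1 !(hP _).2 !(gP _).1 !(gP _).2.
Qed.

Fact preservesV (g : aut) : preserves (invmx g).
Proof.
case: g => [g /andP[gu /asboolP gP]] /=.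
rewrite /preserves unitmx_inv gu; apply/asboolP => v.
by rewrite -(gP (v *m _)).1 -(gP (v *m _)).2 mulmxKV.
Qed.

Lemma base_change_gal (q : E -> k) (s : gal) v :
  base_change iota e q (map_mx s v) = s (base_change iota e q v).
Proof.
rewrite /base_change rmorphD !rmorph_sum; congr (_ + _); apply: eq_bigr => i _.
  by rewrite rmorphM rmorphXn gal_fix mxE.
by rewrite rmorph_sum; apply: eq_bigr => j _; rewrite !rmorphM gal_fix !mxE.
Qed.

Fact preserves_gal (s : gal) (g : aut) : preserves (map_mx s g).
Proof.
case: g => [g /andP[gu /asboolP gP]] /=.
rewrite /preserves map_unitmx gu; apply/asboolP => v.
have [s' _ sK] := gal_bij s.
have -> : v = map_mx s (map_mx s' v) by apply/matrixP => i j; rewrite !mxE sK.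
by rewrite -map_mxM !base_change_gal (gP _).1 (gP _).2.
Qed.

Definition aut1 : aut := Aut preserves1.
Definition autM (g h : aut) : aut := Aut (preservesM g h).
Definition autV (g : aut) : aut := Aut (preservesV g).
Definition aut_gal (s : gal) (g : aut) : aut := Aut (preserves_gal s g).

Definition aut_commutative : Prop := commutative autM.

(* Once commutative, Aut(q0, q1)(K) is a Galois module; the addition of this
   zmodType is the product of matrices. *)
Section Module.
Hypothesis autC : aut_commutative.

Definition autZ (_ : aut_commutative) := aut.
Local Notation AutZ := (autZ autC).
HB.instance Definition _ := Choice.on AutZ.

Fact autA : associative autM.
Proof. by move=> f g h; apply: val_inj; rewrite /= mulmxA. Qed.
Fact aut1M : left_id aut1 autM.
Proof. by move=> g; apply: val_inj; rewrite /= mul1mx. Qed.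
Fact autVM : left_inverse aut1 autV autM.
Proof.
by move=> g; apply: val_inj; case: g => g gP /=; rewrite mulVmx //; case/andP: gP.
Qed.

HB.instance Definition _ := GRing.isZmodule.Build AutZ autA autC aut1M autVM.

Definition autZ_gal (s : gal) (g : AutZ) : AutZ := aut_gal s g.

Fact autZ_gal_is_nmod (s : gal) : nmod_morphism (autZ_gal s).
Proof.
split=> [|g h]; apply: val_inj; first by rewrite /= map_mx1.
by rewrite /= map_mxM.
Qed.

HB.instance Definition _ s :=
  GRing.isNmodMorphism.Build AutZ AutZ (autZ_gal s) (autZ_gal_is_nmod s).

Definition H1Aut := H1 (fun s => autZ_gal s : {additive AutZ -> AutZ}).
HB.instance Definition _ := GRing.Zmodule.on H1Aut.

(* The row space of W is a linear subspace of projective dimension m - 1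
   contained in X. *)
Definition generator (W : 'M[K]_(m, n)) : Prop :=
  row_free W /\ forall v : 'rV[K]_n, (v <= W)%MS -> Q0 v = 0 /\ Q1 v = 0.

(* x is the class of the torsor of generators: the cocycles in x are those given
   by s(W) = W . c(s) for some generator W. *)
Definition generators_torsor_class (x : H1Aut) : Prop :=
  forall c, H1class c = x <->
    exists2 W, generator W & forall s : gal, (map_mx s W == W *m aut_mx (c s))%MS.

End Module.

End Aut.

End Galois.

(* Main.v *)
From HB Require Import structures.
From mathcomp Require Import all_boot all_order all_algebra all_field.
From mathcomp Require Import ring_quotient qpoly boolp functions classical_sets.
From mathcomp Require Import zify ring.
Require Import Defs.

(** Write n = 2m+1, b_0 and b_1 for the polar forms, q_t = q_0 + t q_1 and
    B_t = b_0 + t b_1.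

    In characteristic 2 the B_t are alternating forms on a space of odd
    dimension.  The Pfaffian vector omega(t) = sum_i t^i omega_i, of degree m in t,
    lies in their kernel, and f(t) = q_t(omega(t)).  Comparing coefficients shows
    that the omega_i are pairwise orthogonal for b_0 and b_1, so that q_0(omega_i)
    = a_2i, q_1(omega_i) = a_(2i+1) and f' = q_1(omega(t)).  Regularity means that
    no point of X, over any extension, is singular on a member of the pencil
    ([regular_gradients]).  Hence omega(t) never vanishes
    ([pfaffian_row_pencil_neq0]), f is separable ([disc_separable]), and every
    polynomial kernel vector is a polynomial multiple of omega; in particular
    there is none of degree less than m ([kernel_poly_min]).  It follows that
    omega_0, ..., omega_m are independent, and so are the m linear forms
    y_j = b_1(omega_j, _) ([kernel_coef_free1]).

    An isometry of (q_0, q_1) fixes the omega_i and the y_j, so it is of the form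
    v |-> v + sum_(i, j) M_ji y_j(v) omega_i ([aut_shear]).  It preserves q_0 and
    q_1 exactly when M is a Hankel matrix (h_(i+j)) whose 2m parameters satisfy
    [wp] h = 0 ([hankelP]).  Because d_l^2 = sum_p a_(2l+1-p) d_p in A
    ([dual_seq_sqr]), [wp] is the map s |-> s^2 + s of A/k in the coordinates given
    by d_0, ..., d_(2m-1).  Thus Aut(q_0, q_1) is the kernel of the Artin-Schreier
    map of A_K/K.  This map is surjective, since f splits with simple roots over K
    ([wp_onto]).  In the cohomology sequence of

      0 -> Aut(q_0, q_1) -> A_K/K -> A_K/K -> 0

    the invariants of A_K/K are A/k ([gal_fixed_field]) and its first cohomology is
    zero ([cocycle_coboundary]).  So the connecting map, which sends r to the class
    of s |-> s(h) - h where wp(h) = r, is an isomorphism from A/(wp(A) + k).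

    Given a normal form, let (eps_i, eta_j) be the basis dual to (x_i, y_j).  Then
    eps_i = omega_i, and the y_j are those above ([nf_eta]).  The generators are the
    spans of the vectors eta_j + sum_i h_(i+j) omega_i for the h with wp(h) = r, the
    r-invariant ([hankel_generator], [generator_hankel]).  The Galois group acts on
    them through h, and the isometry with parameters g translates h by g, so the
    torsor of generators has the class of s |-> s(h) - h. *)

Set Implicit Arguments.
Unset Strict Implicit.
Unset Printing Implicit Defensive.

Import GRing.Theory.
Local Open Scope ring_scope.
Local Open Scope quotient_scope.

(** * Hafnians and Pfaffians in characteristic 2 *)

Section Hafnian.
Variables (R : comNzRingType) (char2 : 2%N \in [pchar R]).
Variables (I : eqType) (b : I -> I -> R).

(** In characteristic 2 the Pfaffian carries no signs: it is the hafnian, a sum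
    over perfect matchings.  Letting it depend on a sequence of indices, with
    repetitions allowed, turns the Laplace expansions along a wrong row into
    hafnians of sequences with a repeated index. *)
Fixpoint haf (r : nat) (s : seq I) : R :=
  match r, s with
  | 0, _ => (s == [::])%:R
  | _, [::] => 0
  | r'.+1, x :: s' => \sum_(y <- s') b x y * haf r' (rem y s')
  end.

(** The terms off the diagonal come in equal pairs. *)
Lemma sum_sym2 (u : seq I) (G : I -> I -> R) : (forall y z, G y z = G z y) ->
  \sum_(y <- u) \sum_(z <- u) G y z = \sum_(y <- u) G y y.
Proof.
move=> Gsym; elim: u => [|x u IH]; first by rewrite !big_nil.
rewrite !big_cons.
rewrite [X in _ + X = _](eq_bigr (fun y => G x y + \sum_(z <- u) G y z)); last first.
  by move=> y _; rewrite big_cons Gsym.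
by rewrite big_split /= IH -!addrA [X in _ + X]addrA (addrr_pchar2 char2) add0r.
Qed.

Lemma sum_rem (u : seq I) y (G : I -> R) : y \in u ->
  \sum_(z <- rem y u) G z = \sum_(z <- u) G z - G y.
Proof.
move=> yu; rewrite [in RHS](perm_big _ (perm_to_rem yu)) big_cons /=.
by rewrite [G y + _]addrC addrK.
Qed.

Lemma perm_rem_rem (y z : I) u : rem z (rem y u) = rem y (rem z u).
Proof.
elim: u => //= x u IH.
case e1: (x == y); case e2: (x == z); rewrite /= ?e1 ?e2 /= ?IH //.
by rewrite -(eqP e1) -(eqP e2).
Qed.

Lemma sum_rem2 (u : seq I) (G : I -> I -> R) :
  \sum_(y <- u) \sum_(z <- rem y u) G y z =
  \sum_(y <- u) \sum_(z <- u) G y z - \sum_(y <- u) G y y.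
Proof.
rewrite -sumrB big_seq [RHS]big_seq; apply: eq_bigr => y yu.
exact: sum_rem.
Qed.

Lemma perm_rem (y : I) s s' : perm_eq s s' -> perm_eq (rem y s) (rem y s').
Proof.
move=> ps; have [ys|yns] := boolP (y \in s); last first.
  by rewrite !rem_id // -(perm_mem ps).
have ys' : y \in s' by rewrite -(perm_mem ps).
rewrite -(perm_cons y) -(permPl (perm_to_rem ys)).
by rewrite -(permPr (perm_to_rem ys')).
Qed.

Hypothesis b_sym : forall x y, b x y = b y x.

(** It suffices to exchange the first two indices.  Expanding along both gives a
    sum over the ordered pairs of the indices matched with them, which is symmetric. *)
Lemma haf_perm r s s' : perm_eq s s' -> haf r s = haf r s'.
Proof.
elim: r s s' => [|r IH] s s' ps.
  rewrite /=; congr (nat_of_bool _)%:R.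
  by rewrite -!size_eq0 (perm_size ps).
have hd x s1 s2 : perm_eq s1 s2 -> haf r.+1 (x :: s1) = haf r.+1 (x :: s2).
  move=> p12 /=; rewrite (perm_big _ p12); apply: eq_bigr => y _ /=.
  by congr (_ * _); apply/IH/perm_rem.
have sw x x' u : haf r.+1 (x :: x' :: u) = haf r.+1 (x' :: x :: u).
  have ex y y' : haf r.+1 (y :: y' :: u) =
      b y y' * haf r u + \sum_(z <- u) b y z * haf r (y' :: rem z u).
    rewrite /= big_cons /= eqxx; congr (_ + _).
    rewrite big_seq [RHS]big_seq; apply: eq_bigr => z zu; congr (_ * _).
    apply: IH; case: eqP => [->|//]; exact: perm_to_rem.
  rewrite !ex b_sym; congr (_ + _).
  case: r IH {hd ex} => [|r] IH; first by rewrite !big1 // => z _; rewrite /= mulr0.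
  under eq_bigr => y _ do rewrite /= mulr_sumr.
  under [RHS]eq_bigr => y _ do rewrite /= mulr_sumr.
  rewrite !sum_rem2 exchange_big /=; congr (_ - _); last first.
    by apply: eq_bigr => y _; rewrite !mulrA [b x y * _]mulrC.
  apply: eq_bigr => y _; apply: eq_bigr => z _.
  by rewrite !mulrA [b x z * _]mulrC perm_rem_rem.
case: s s' ps => [|x s] [|x' s'] ps //.
- by move/perm_size: ps.
- by move/perm_size: ps.
have [xx'|nxx'] := eqVneq x x'.
  by rewrite xx'; apply: hd; move: ps; rewrite xx' perm_cons.
have x's : x' \in s.
  have := perm_mem ps x'; rewrite !inE eqxx /= eq_sym (negPf nxx') /= => ->.
  by [].
have p1 := perm_to_rem x's.
rewrite (hd _ _ _ p1) sw; apply: hd.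
rewrite -(perm_cons x'); apply: perm_trans ps.
apply: (@perm_trans _ (x :: x' :: rem x' s)); last first.
  by rewrite perm_cons perm_sym.
by rewrite -[X in perm_eq X]/([:: x'] ++ [:: x] ++ _) perm_catCA.
Qed.

Hypothesis b_alt : forall x, b x x = 0.

(** With the repeated index x moved to the front, the double expansion is a sum
    over ordered pairs (y, z) of b x y * b x z times a factor symmetric in y and z. *)
Lemma haf_dup r s : ~~ uniq s -> haf r s = 0.
Proof.
have dd r' x u : haf r' (x :: x :: u) = 0.
  case: r' => [|r'] //=; rewrite big_cons /= b_alt mul0r add0r.
  have -> : \sum_(y <- u) b x y * haf r' (if x == y then u else x :: rem y u) =
     \sum_(y <- u) b x y * haf r' (x :: rem y u).
    rewrite big_seq [RHS]big_seq; apply: eq_bigr => z zu; congr (_ * _).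
    apply: haf_perm; case: eqP => [->|//]; exact: perm_to_rem.
  case: r' => [|r']; first by rewrite big1 // => z _; rewrite /= mulr0.
  under eq_bigr => y _ do rewrite /= mulr_sumr.
  rewrite sum_rem2 sum_sym2 ?subrr // => y z.
  by rewrite !mulrA [b x z * _]mulrC perm_rem_rem.
move=> nu; have [x [u pu]] : exists x u, perm_eq s (x :: x :: u).
  elim: s nu => //= x s IH; rewrite negb_and negbK => /orP[xs|/IH[y [u pu]]].
    by exists x, (rem x s); rewrite perm_cons perm_to_rem.
  exists y, (x :: u); rewrite -(perm_cons x) in pu; apply: perm_trans pu _.
  by rewrite -[X in perm_eq X]/([:: x] ++ [:: y; y] ++ u) perm_catCA.
by rewrite (haf_perm _ pu) dd.
Qed.

Lemma pfaffian_haf N (f : 'I_N -> I) (B : 'M[R]_N) :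
  (forall i j, B i j = b (f i) (f j)) -> pfaffian B = haf N./2 [seq f i | i <- enum 'I_N].
Proof.
have [M] := ubnP N; elim: M N f B => // M IH [|[|N]] f B lN BE /=.
- by rewrite (size0nil (size_enum_ord 0)).
- by rewrite (enum_ordSl) /=.
rewrite enum_ordSl /= -map_comp big_map big_enum /=.
apply: eq_bigr => j _.
rewrite (oppr_pchar2 char2) expr1n mul1r BE; congr (_ * _).
rewrite (IH N (fun i => f (lift ord0 (lift j i)))); last first.
- by move=> i i'; rewrite !mxE BE.
- exact: ltnW.
apply: haf_perm.
rewrite -(perm_cons (f (lift ord0 j))) perm_sym.
have inj : f (lift ord0 j) \in [seq f (lift ord0 i) | i <- enum 'I_N.+1].
  by apply: map_f; rewrite mem_enum.
have := perm_to_rem inj; rewrite perm_sym => /perm_trans; apply.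
have pj : perm_eq (enum 'I_N.+1) (j :: [seq lift j i | i <- enum 'I_N]).
  apply: uniq_perm; rewrite ?enum_uniq //=.
    rewrite map_inj_uniq ?enum_uniq ?andbT; last exact: lift_inj.
    by apply/mapP => -[i _ /eqP]; rewrite (negPf (neq_lift _ _)).
  move=> i; rewrite mem_enum inE; case: (unliftP j i) => [i' ->|->]; last by rewrite !inE eqxx.
  by rewrite !inE map_f ?orbT // mem_enum.
by have := perm_map (f \o lift ord0) pj; rewrite /= -map_comp.
Qed.

End Hafnian.

Section PfaffianVector.
Variables (R : comNzRingType) (m : nat).
Local Notation n := m.*2.+1.

Definition pfaffian_row (B : 'M[R]_n) : 'rV[R]_n :=
  \row_i pfaffian (row' i (col' i B)).

Hypothesis char2 : 2%N \in [pchar R].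
Variable B : 'M[R]_n.
Hypotheses (B_sym : B^T = B) (B_alt : forall i, B i i = 0).

Let b (i j : 'I_n) := B i j.
Let b_sym x y : b x y = b y x. Proof. by rewrite /b -{1}B_sym mxE. Qed.

Lemma pfaffian_row_haf i : pfaffian_row B 0 i = haf b m (rem i (enum 'I_n)).
Proof.
rewrite mxE (@pfaffian_haf _ char2 _ b b_sym _ (lift i)); last first.
  by move=> j j'; rewrite !mxE.
rewrite doubleK; apply: haf_perm => //.
apply: uniq_perm; rewrite ?rem_uniq ?enum_uniq //.
  by rewrite map_inj_uniq ?enum_uniq //; exact: lift_inj.
move=> j; rewrite mem_rem_uniq ?enum_uniq // !inE mem_enum andbT.
case: (unliftP i j) => [j' ->|->].
  by rewrite map_f ?mem_enum // eq_sym neq_lift.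
by rewrite eqxx; apply/mapP => -[j' _ /eqP]; rewrite (negPf (neq_lift _ _)).
Qed.

Lemma haf_expand r s k :
  \sum_(j <- s) b k j * haf b r (rem j s) = haf b r.+1 (k :: s).
Proof. by []. Qed.

(** Entry k of the product is the expansion of a hafnian along k, where k occurs
    twice. *)
Lemma pfaffian_row_ker : pfaffian_row B *m B = 0.
Proof.
apply/rowP => k; rewrite !mxE.
transitivity (haf b m.+1 (k :: enum 'I_n)); last first.
  by apply: haf_dup => //; rewrite /= mem_enum.
rewrite -haf_expand big_enum /=; apply: eq_bigr => j _.
by rewrite pfaffian_row_haf mulrC b_sym.
Qed.

(** The hafnians of the index set with i, p and j removed are, as j varies, the
    coefficients of a combination of the equations v B = 0 in which the coordinate p
    is multiplied by the Pfaffian of B without i, and every other coordinate but the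
    i-th by the hafnian of a sequence with a repeated index. *)
Lemma ker_pfaffian_row (v : 'rV[R]_n) i p : v *m B = 0 -> v 0 i = 0 ->
  v 0 p * pfaffian_row B 0 i = 0.
Proof.
move=> vB vi0; have [->|npi] := eqVneq p i; first by rewrite vi0 mul0r.
rewrite pfaffian_row_haf; set S := rem i _.
have uS : uniq S by rewrite rem_uniq ?enum_uniq.
have pS : p \in S by rewrite mem_rem_uniq ?enum_uniq // !inE npi mem_enum.
have sS : size S = m.*2 by rewrite size_rem ?mem_enum // size_enum_ord.
have Em : m = m.-1.+1.
  rewrite prednK // lt0n; apply: contraTneq pS => m0.
  by rewrite (size0nil (etrans sS (congr1 double m0))).
have vBk j : \sum_k v 0 k * b j k = 0.
  move/rowP: vB => /(_ j); rewrite !mxE => vBj; rewrite -[RHS]vBj.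
  by apply: eq_bigr => k _; rewrite b_sym.
have : \sum_(j <- rem p S) \sum_k v 0 k * (b k j * haf b m.-1 (rem j (rem p S))) = 0.
  rewrite big1 // => j _.
  transitivity ((\sum_k v 0 k * b j k) * haf b m.-1 (rem j (rem p S))).
    by rewrite mulr_suml; apply: eq_bigr => k _; rewrite [b j k]b_sym mulrA.
  by rewrite vBk mul0r.
have hE q : haf b m q = haf b m.-1.+1 q by congr (haf b _ q).
rewrite exchange_big /=; under eq_bigr => k _ do rewrite -mulr_sumr haf_expand -hE.
rewrite (bigD1 p) //= [X in _ + X]big1 ?addr0 => [<-|k npk].
  by rewrite (haf_perm b_sym _ (perm_to_rem pS)).
have [->|nki] := eqVneq k i; first by rewrite vi0 mul0r.
rewrite haf_dup ?mulr0 //= mem_rem_uniq // !inE npk mem_rem_uniq ?enum_uniq //.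
by rewrite !inE nki mem_enum.
Qed.

End PfaffianVector.

Section PfaffianVectorDomain.
Variables (R : idomainType) (m : nat).
Local Notation n := m.*2.+1.
Hypothesis char2 : 2%N \in [pchar R].
Variable B : 'M[R]_n.
Hypotheses (B_sym : B^T = B) (B_alt : forall i, B i i = 0).

(** Apply [ker_pfaffian_row] to the combination of v and of the Pfaffian vector
    that vanishes at i: where the Pfaffian vector is not zero, it spans the kernel. *)
Lemma ker_parallel (v : 'rV[R]_n) i j : v *m B = 0 ->
  v 0 j * pfaffian_row B 0 i = v 0 i * pfaffian_row B 0 j.
Proof.
move=> vB; have wB := pfaffian_row_ker char2 B_sym B_alt.
have kw (u : 'rV_n) i' p : u *m B = 0 -> u 0 i' = 0 -> u 0 p * pfaffian_row B 0 i' = 0.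
  exact: ker_pfaffian_row.
move: (pfaffian_row B) wB kw => w wB kw.
have uB (a c : R) : (a *: v - c *: w) *m B = 0.
  by rewrite mulmxBl -!scalemxAl vB wB !scaler0 subr0.
have := kw _ i j (uB (w 0 i) (v 0 i)); rewrite !mxE mulrC subrr => /(_ erefl)/eqP.
have := kw _ j i (uB (w 0 j) (v 0 j)); rewrite !mxE mulrC subrr => /(_ erefl)/eqP.
rewrite !mulf_eq0 !subr_eq0 => /orP[/eqP <- _|/eqP wj0]; first by rewrite mulrC.
by case/orP=> [/eqP <-|/eqP wi0]; rewrite ?wi0 ?wj0 ?mulr0 // mulrC.
Qed.

(** Let t be a maximal set of indices with nonzero hafnian.  If the Pfaffian
    vector vanishes then t misses at least three indices x.  The hafnians of x :: t
    with one index removed form a kernel vector, because the hafnian of k :: x :: t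
    is zero for every k, by repetition or by maximality; among the missing indices
    its support is x alone. *)
Lemma pfaffian_row0_ker : pfaffian_row B = 0 ->
  exists (x : 'I_3 -> 'I_n) (v : 'I_3 -> 'rV[R]_n),
    [/\ forall i, v i *m B = 0, forall i, v i 0 (x i) != 0
       & forall i j, i != j -> v i 0 (x j) = 0].
Proof.
move=> w0; pose b (i j : 'I_n) := B i j.
have b_sym x y : b x y = b y x by rewrite /b -{1}B_sym mxE.
pose P r := [exists t : r.*2.-tuple 'I_n, uniq t && (haf b r t != 0)].
have P0 : exists r, P r.
  by exists 0%N; apply/existsP; exists [tuple]; rewrite /= oner_eq0.
have Pm r : P r -> (r <= m)%N.
  case/existsP => t /andP[ut _].
  have := uniq_leq_size ut (fun i _ => mem_enum 'I_n i).
  by rewrite size_tuple size_enum_ord -ltnS -[r]doubleK -[m]doubleK; lia.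
case: (ex_maxnP P0 Pm) => r /existsP[t /andP[ut ht]] rmax.
have rm : (r < m)%N.
  rewrite ltn_neqAle Pm ?andbT; last by apply/existsP; exists t; rewrite ut.
  apply: contraNneq ht => rm; subst r.
  have [i ti] : exists i, i \notin t.
    apply/existsP; rewrite -negb_forall; apply/negP => /forallP tt.
    have := uniq_leq_size (enum_uniq 'I_n) (fun i _ => tt i).
    by rewrite size_tuple size_enum_ord ltnn.
  rewrite (@haf_perm _ _ b b_sym m _ (rem i (enum 'I_n))).
    by rewrite -pfaffian_row_haf // w0 mxE.
  apply: uniq_perm; rewrite ?rem_uniq ?enum_uniq //.
  have [] := @uniq_min_size _ t (rem i (enum 'I_n)) => //.
    move=> j tj; rewrite mem_rem_uniq ?enum_uniq // !inE mem_enum andbT.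
    by apply: contraNneq ti => <-.
  by rewrite size_rem ?mem_enum // size_enum_ord size_tuple.
pose c := [seq i <- enum 'I_n | i \notin t].
have c3 : (3 <= size c)%N.
  have : (size (enum 'I_n) <= size (t ++ c))%N.
    apply: uniq_leq_size; rewrite ?enum_uniq // => i _.
    by rewrite mem_cat mem_filter mem_enum andbT orbN.
  rewrite size_enum_ord size_cat size_tuple => h.
  rewrite -(leq_add2l r.*2) (leq_trans _ h) //.
  by rewrite addn3 !ltnS -doubleS leq_double.
have uc : uniq c by rewrite filter_uniq ?enum_uniq.
pose x (i : 'I_3) := nth ord0 c i.
have xt i : x i \notin t.
  by have := mem_nth ord0 (leq_trans (ltn_ord i) c3); rewrite mem_filter => /andP[].
have xinj i j : i != j -> x i != x j.
  by move=> nij; rewrite nth_uniq // (leq_trans (ltn_ord _) c3).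
pose v (i : 'I_3) : 'rV[R]_n :=
  \row_j if j \in x i :: t then haf b r (rem j (x i :: t)) else 0.
exists x, v; split=> [i|i|i j nij]; last 2 first.
- by rewrite mxE mem_head /= eqxx.
- by rewrite mxE inE (negPf (xt j)) orbF eq_sym (negPf (xinj _ _ nij)).
apply/rowP => k; rewrite !mxE.
have uxt : uniq (x i :: t) by rewrite /= xt.
transitivity (haf b r.+1 (k :: x i :: t)).
  rewrite -haf_expand (big_uniq _ uxt) [in RHS]big_mkcond.
  apply: eq_bigr => j _; rewrite !mxE; case: ifP => _; last by rewrite mul0r.
  by rewrite mulrC /b -{1}B_sym mxE.
have [ux|] := boolP (uniq (k :: x i :: t)); last exact: haf_dup.
apply/eqP/negPn/negP => h0.
have sk : size (k :: x i :: t) == r.+1.*2 by rewrite /= size_tuple doubleS.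
have : P r.+1 by apply/existsP; exists (Tuple sk); rewrite ux.
by move/rmax; rewrite ltnn.
Qed.
End PfaffianVectorDomain.

(** * Field extensions and extension of scalars for quadratic forms *)

Lemma irreducible_factor (F : fieldType) (p : {poly F}) : (1 < size p)%N ->
  exists2 g : {poly F}, irreducible_poly g & g %| p.
Proof.
have [N] := ubnP (size p); elim: N p => // N IH p lpN p1.
have [irr|] := boolp.pselect (irreducible_poly p); first by exists p.
rewrite /irreducible_poly => nirr.
have [g [sg gp ngp]] : exists g : {poly F}, [/\ size g != 1, g %| p & ~~ (g %= p)].
  apply: boolp.contrapT => h; apply: nirr; split=> // g sg gp.
  by apply/negP => /negP ngp; apply: h; exists g; split.
have p0 : p != 0 by rewrite -size_poly_gt0 ltnW.
have g0 : g != 0 by apply: contraNneq p0 => g0; rewrite g0 dvd0p in gp.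
have lgp : (size g < size p)%N.
  by rewrite ltn_neqAle dvdp_leq // andbT dvdp_size_eqp.
have [||h irr hg] := IH g.
- exact: leq_trans lgp _.
- by rewrite ltn_neqAle eq_sym sg size_poly_gt0.
by exists h => //; apply: dvdp_trans hg gp.
Qed.

Lemma ext_root (F : fieldType) (p : {poly F}) : size p != 1 ->
  exists (L : fieldType) (j : {rmorphism F -> L}) (x : L), root (map_poly j p) x.
Proof.
have [->|p0] := eqVneq p 0.
  by exists F, idfun, 0; rewrite rmorph0 root0.
move=> p1; have {}p1 : (1 < size p)%N by rewrite ltn_neqAle eq_sym p1 size_poly_gt0.
have [g irr gp] := irreducible_factor p1.
have [L _ [x gx _]] := irredp_FAdjoin irr.
exists L, (in_alg L), x; apply: root_dvdp gx; by rewrite dvdp_map.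
Qed.

Lemma bezout_family (F : fieldType) n (w : 'I_n -> {poly F}) :
  exists u : 'I_n -> {poly F}, forall i, \sum_j u j * w j %| w i.
Proof.
elim: n w => [|n IH] w; first by exists (fun=> 0) => -[].
have [u' hu'] := IH (w \o lift ord0).
set g := \sum_j _ in hu'.
have [[a b] /= ab] := Bezoutp (w ord0) g.
exists (fun i => oapp (fun i' => b * u' i') a (unlift ord0 i)) => i.
rewrite big_ord_recl unlift_none /=.
under eq_bigr => j _ do rewrite liftK /= -mulrA.
rewrite -mulr_sumr -/g (eqp_dvdl _ ab).
case: (unliftP ord0 i) => [i' ->|->]; last exact: dvdp_gcdl.
exact: dvdp_trans (dvdp_gcdr _ _) (hu' i').
Qed.

Lemma row_mul_tr (R : pzRingType) (a c b : nat) (A : 'M[R]_(a, b)) (B : 'M[R]_(c, b)) i j :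
  (row i A *m (row j B)^T) 0 0 = (A *m B^T) i j.
Proof. by rewrite !mxE; apply: eq_bigr => l _; rewrite !mxE. Qed.

Section BaseChangeTheory.
Variables (k : fieldType) (char2 : 2%N \in [pchar k]).
Variables (n : nat) (E : vectType k) (e : n.-tuple E).

Definition gram (q : E -> k) : 'M[k]_n := \matrix_(i, j) polar q e`_i e`_j.

Section OneForm.
Variable (q : E -> k).
Hypothesis (q_quad : quadratic_form q).
Variables (R : comNzRingType) (iota : {rmorphism k -> R}).

Lemma rmorph_char2 : 2%N \in [pchar R].
Proof. exact: (rmorph_pchar iota char2). Qed.

Local Notation bc := (base_change iota e q).
Local Notation P := (map_mx iota (gram q)).

Lemma gram_sym : (gram q)^T = gram q.
Proof. by apply/matrixP => i j; rewrite !mxE /polar [e`_i + _]addrC addrAC. Qed.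

Lemma quadratic0 : q 0 = 0.
Proof. by case: q_quad => qZ _ _; rewrite -(scale0r 0) qZ expr0n mul0r. Qed.

Lemma polar_diag v : polar q v v = 0.
Proof.
case: q_quad => qZ _ _; rewrite /polar -mulr2n -scaler_nat qZ.
by rewrite (pcharf0 char2) expr0n mul0r add0r -opprD (addrr_pchar2 char2) oppr0.
Qed.

Lemma gram_alt i : gram q i i = 0.
Proof. by rewrite mxE polar_diag. Qed.

Lemma base_changeZ a v : bc (a *: v) = a ^+ 2 * bc v.
Proof.
rewrite /base_change mulrDr !mulr_sumr; congr (_ + _); apply: eq_bigr => i _.
  by rewrite mxE; ring.
by rewrite mulr_sumr; apply: eq_bigr => j _; rewrite !mxE; ring.
Qed.

Lemma base_changeD v w : bc (v + w) = bc v + bc w + (v *m P *m w^T) 0 0.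
Proof.
have addRR (x : R) : x + x = 0 := addrr_pchar2 rmorph_char2 x.
rewrite /base_change addrACA -[RHS]addrA; congr (_ + _).
  rewrite -big_split; apply: eq_bigr => i _; rewrite mxE /= -mulrDr.
  by rewrite sqrrD mulr2n addRR addr0.
have -> : (v *m P *m w^T) 0 0 = \sum_i \sum_j P i j * v 0 i * w 0 j.
  rewrite mxE exchange_big; apply: eq_bigr => j _; rewrite !mxE mulr_suml.
  by apply: eq_bigr => i _; rewrite [P i j * _]mulrC.
have -> : \sum_i \sum_j P i j * v 0 i * w 0 j =
    \sum_(i < n) \sum_(j < n | (i < j)%N) P i j * (v 0 i * w 0 j + v 0 j * w 0 i).
  transitivity (\sum_(i < n) (\sum_(j < n | (i < j)%N) P i j * v 0 i * w 0 j +
                \sum_(j < n | (j < i)%N) P i j * v 0 i * w 0 j)).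
    apply: eq_bigr => i _; rewrite (bigD1 i) //= !mxE polar_diag rmorph0 !mul0r add0r.
    rewrite (bigID (fun j : 'I_n => (i < j)%N)) /=; congr (_ + _).
      by apply: eq_bigl => j; rewrite -val_eqE /=; case: ltngtP.
    by apply: eq_bigl => j; rewrite -val_eqE /=; case: ltngtP.
  rewrite big_split /= [X in _ + X](exchange_big_dep xpredT) //= -big_split /=.
  apply: eq_bigr => i _; rewrite -big_split /=; apply: eq_bigr => j _.
  have -> : P j i = P i j by rewrite -{1}gram_sym !mxE.
  by rewrite mulrDr !mulrA.
rewrite -!big_split /=; apply: eq_bigr => i _; rewrite -!big_split /=.
by apply: eq_bigr => j _; rewrite !mxE; ring.
Qed.

Lemma base_change_polar v w : polar bc v w = (v *m P *m w^T) 0 0.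
Proof. by rewrite /polar base_changeD; ring. Qed.

Lemma base_change0 : bc 0 = 0.
Proof. by rewrite -(scale0r 0) base_changeZ expr0n mul0r. Qed.

Lemma gradientE v : gradient iota e q v = v *m P.
Proof.
apply/rowP => i; rewrite mxE base_change_polar trmx_delta.
by rewrite -colE mxE.
Qed.

Lemma base_change_isotropic p (U : 'M[R]_(p, n)) (c : 'rV[R]_p) :
  U *m P *m U^T = 0 -> bc (c *m U) = \sum_i c 0 i ^+ 2 * bc (row i U).
Proof.
move=> U0; rewrite mulmx_sum_row.
have hUU i j : (row i U *m P *m (row j U)^T) 0 0 = 0.
  by rewrite -row_mul row_mul_tr U0 mxE.
suff [-> _] : bc (\sum_i c 0 i *: row i U) = \sum_i c 0 i ^+ 2 * bc (row i U) /\
    (forall j, ((\sum_i c 0 i *: row i U) *m P *m (row j U)^T) 0 0 = 0) by [].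
elim/big_rec2: _ => [|i x y _ [IH IH']].
  by split=> [|j]; rewrite ?base_change0 // !mul0mx mxE.
split=> [|j]; last first.
  by rewrite !mulmxDl -!scalemxAl mxE IH' mxE hUU mulr0 addr0.
rewrite base_changeD base_changeZ IH -!scalemxAl mxE.
have -> : (row i U *m P *m y^T) 0 0 = (y *m P *m (row i U)^T) 0 0.
  have {1}<- : P^T = P by rewrite map_trmx gram_sym.
  have tr (M : 'M[R]_1) : M 0 0 = M^T 0 0 by rewrite mxE.
  by rewrite [RHS]tr !trmx_mul trmxK mulmxA.
by rewrite IH' mulr0 addr0.
Qed.

End OneForm.

Lemma base_change_map (q : E -> k) (R S : comNzRingType) (i1 : {rmorphism k -> R})
    (i2 : {rmorphism k -> S}) (j : {rmorphism R -> S}) v :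
  (forall a, i2 a = j (i1 a)) ->
  base_change i2 e q (map_mx j v) = j (base_change i1 e q v).
Proof.
move=> ij; rewrite /base_change rmorphD !rmorph_sum; congr (_ + _); apply: eq_bigr => i _.
  by rewrite rmorphM rmorphXn mxE ij.
by rewrite rmorph_sum; apply: eq_bigr => l _; rewrite !rmorphM !mxE ij.
Qed.

End BaseChangeTheory.

(** * The pencil of polar forms and its Pfaffian vector *)

Lemma pfaffian_map (R S : comNzRingType) (f : {rmorphism R -> S}) N (B : 'M[R]_N) :
  pfaffian (map_mx f B) = f (pfaffian B).
Proof.
have [M] := ubnP N; elim: M N B => // M IH [|[|N]] B lN /=; rewrite ?rmorph1 ?rmorph0 //.
rewrite rmorph_sum; apply: eq_bigr => j _.
rewrite !rmorphM rmorph_sign mxE -map_col' -map_row' -map_col' -map_row' IH //.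
exact: ltnW.
Qed.

Lemma pfaffian_row_map (R S : comNzRingType) (f : {rmorphism R -> S}) m (B : 'M[R]_m.*2.+1) :
  pfaffian_row (map_mx f B) = map_mx f (pfaffian_row B).
Proof. by apply/rowP => i; rewrite !mxE -map_col' -map_row' pfaffian_map. Qed.

Section Bihomogeneous.
Variable k : fieldType.

(** Homogeneity of degree d in the two variables t0 (inner) and t1 (outer). *)
Definition bihom d (P : {poly {poly k}}) := forall i j, (i + j != d)%N -> P`_i`_j = 0.

Lemma bihomD d P Q : bihom d P -> bihom d Q -> bihom d (P + Q).
Proof. by move=> hP hQ i j ij; rewrite !coefD hP ?hQ ?addr0. Qed.

Lemma bihom0 d : bihom d 0.
Proof. by move=> i j _; rewrite !coef0. Qed.

Lemma bihom_sum d (I : finType) (P : pred I) (F : I -> {poly {poly k}}) :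
  (forall i, P i -> bihom d (F i)) -> bihom d (\sum_(i | P i) F i).
Proof. by move=> h; apply: (big_ind (bihom d)) => //; [exact: bihom0 | exact: bihomD]. Qed.

Lemma bihomM d d' P Q : bihom d P -> bihom d' Q -> bihom (d + d') (P * Q).
Proof.
move=> hP hQ i j ij; rewrite coefM coef_sum big1 // => a _.
rewrite coefM big1 // => c _.
have [|h1] := eqVneq (a + c)%N d; last by rewrite hP ?mul0r.
have [|h2] := eqVneq (i - a + (j - c))%N d'; last by rewrite hQ ?mulr0.
move=> h1 h2; case/eqP: ij; have := ltn_ord a; have := ltn_ord c; lia.
Qed.

Lemma bihom_const c : bihom 0 (const2 k c).
Proof.
move=> [|i] [|j] //= _; rewrite coefC //= ?coefC //= ?coef0 //.
Qed.

Lemma bihom_t0 : bihom 1 'X%:P.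
Proof.
move=> [|i] j h; rewrite coefC ?coef0 //= coefX.
by rewrite add0n in h; rewrite (negPf h).
Qed.

Lemma bihom_t1 : bihom 1 'X.
Proof.
move=> i j; rewrite coefX; have [->|_ _] := eqVneq i 1%N; last by rewrite coef0.
by case: j => // j _; rewrite coef1.
Qed.

Lemma bihom_pfaffian N (B : 'M[{poly {poly k}}]_N) :
  (forall i j, bihom 1 (B i j)) -> bihom N./2 (pfaffian B).
Proof.
have [M] := ubnP N; elim: M N B => // M IH [|[|N]] B lN hB /=.
- by have := bihom_const 1; rewrite rmorph1.
- exact: bihom0.
apply: bihom_sum => j _; rewrite -add1n; apply: bihomM; last first.
  by apply: IH; [exact: ltnW | move=> i i'; rewrite !mxE; exact: hB].
rewrite -signr_odd; case: (odd _); rewrite ?expr0 ?mul1r // expr1 mulN1r.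
by move=> i i' h; rewrite !coefN hB ?oppr0.
Qed.

Lemma bihom_eval d (P : {poly {poly k}}) i : bihom d P ->
  (map_poly (horner_eval (1 : k)) P)`_i = if (i <= d)%N then P`_i`_(d - i) else 0.
Proof.
move=> hP; rewrite coef_map /= /horner_eval.
have [id|di] := leqP i d; last first.
  have -> : P`_i = 0 by apply/polyP => j; rewrite hP ?coef0 //; lia.
  by rewrite horner0.
have -> : P`_i = P`_i`_(d - i) *: 'X^(d - i).
  apply/polyP => j; rewrite coefZ coefXn; case: eqP => [->|nj]; rewrite ?mulr1 //.
  by rewrite hP ?mulr0 //; lia.
by rewrite hornerZ hornerXn expr1n mulr1 coefZ coefXn eqxx mulr1.
Qed.

Lemma bihom_base_change d n (E : vectType k) (e : n.-tuple E) q (v : 'rV_n) :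
  (forall i, bihom d (v 0 i)) -> bihom d.*2 (base_change (const2 k) e q v).
Proof.
move=> hv; rewrite -[d.*2]add0n -addnn; apply: bihomD; apply: bihom_sum => i _.
  by apply: (@bihomM 0 (d + d)); [exact: bihom_const | rewrite expr2; apply: bihomM].
apply: bihom_sum => j _; rewrite -mulrA; apply: (@bihomM 0 (d + d)); first exact: bihom_const.
exact: bihomM.
Qed.

End Bihomogeneous.

Lemma size_pfaffian (k : fieldType) N (B : 'M[{poly k}]_N) :
  (forall i j, (size (B i j) <= 2)%N) -> (size (pfaffian B) <= N./2.+1)%N.
Proof.
have [M] := ubnP N; elim: M N B => // M IH [|[|N]] B lN hB /=.
- by rewrite size_poly1.
- by rewrite size_poly0.
apply: (leq_trans (size_sum _ _ _)); apply/bigmax_leqP => j _.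
rewrite -mulrA -signr_odd mulr_sign; set P := B _ _ * _.
have : (size P <= N./2.+2)%N.
  apply: (leq_trans (size_polyMleq _ _)).
  have h1 := hB ord0 (lift ord0 j).
  have h2 : (size (pfaffian (row' j (col' j (row' ord0 (col' ord0 B))))) <= N./2.+1)%N.
    by apply: IH; [exact: ltnW | move=> i i'; rewrite !mxE].
  by rewrite -subn1 (leq_trans (leq_sub2r 1 (leq_add h1 h2))) // add2n subn1.
by case: ifP; rewrite ?size_polyN.
Qed.

Section PencilTheory.
Variables (k : fieldType) (char2 : 2%N \in [pchar k]) (m : nat).
Local Notation n := m.*2.+1.
Variables (E : vectType k) (e : n.-tuple E) (q0 q1 : E -> k).
Hypotheses (q0_quad : quadratic_form q0) (q1_quad : quadratic_form q1).

Local Notation B0 := (gram e q0).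
Local Notation B1 := (gram e q1).
Local Notation disc := (disc_poly e q0 q1).

Definition pencil_mx (R : comNzRingType) (iota : {rmorphism k -> R}) (t : R) : 'M[R]_n :=
  map_mx iota B0 + t *: map_mx iota B1.

Lemma pencil_map (R S : comNzRingType) (i1 : {rmorphism k -> R}) (i2 : {rmorphism k -> S})
    (j : {rmorphism R -> S}) t : (forall a, i2 a = j (i1 a)) ->
  pencil_mx i2 (j t) = map_mx j (pencil_mx i1 t).
Proof.
move=> ij; apply/matrixP => a b.
by rewrite !mxE !ij [RHS]rmorphD [j (t * _)]rmorphM.
Qed.

Lemma pencil_sym (R : comNzRingType) (iota : {rmorphism k -> R}) t :
  (pencil_mx iota t)^T = pencil_mx iota t.
Proof. by rewrite linearD linearZ /= !map_trmx !gram_sym. Qed.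

Lemma pencil_alt (R : comNzRingType) (iota : {rmorphism k -> R}) t i :
  pencil_mx iota t i i = 0.
Proof.
have := gram_alt char2 e q0_quad i; have := gram_alt char2 e q1_quad i.
by rewrite !mxE => -> ->; rewrite rmorph0 mulr0 addr0.
Qed.

(** The vector omega(t) of the pencil q_0 + t q_1.  It is locked because mxE would
    otherwise expand its entries into Pfaffians. *)
Definition kernel_poly : 'rV[{poly k}]_n := locked (pfaffian_row (pencil_mx polyC 'X)).

Lemma kernel_polyE : kernel_poly = pfaffian_row (pencil_mx polyC 'X).
Proof. by rewrite /kernel_poly -lock. Qed.

Lemma kernel_poly_map (R : comNzRingType) (iota : {rmorphism k -> R})
    (j : {rmorphism {poly k} -> R}) : (forall a, iota a = j a%:P) ->
  pfaffian_row (pencil_mx iota (j 'X)) = map_mx j kernel_poly.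
Proof. by move=> ij; rewrite (pencil_map _ ij) pfaffian_row_map kernel_polyE. Qed.

Lemma polar_mx_pencil (R : comNzRingType) (iota : {rmorphism k -> R}) s t :
  polar_mx (fun v => s * base_change iota e q0 v + t * base_change iota e q1 v) =
  s *: map_mx iota B0 + t *: map_mx iota B1.
Proof.
apply/matrixP => i j; rewrite mxE.
have := base_change_polar char2 e q0_quad iota (delta_mx 0 i) (delta_mx 0 j).
have := base_change_polar char2 e q1_quad iota (delta_mx 0 i) (delta_mx 0 j).
rewrite /polar -!rowE trmx_delta -!colE !mxE => <- <-; ring.
Qed.

Lemma disc_polyE : disc = base_change polyC e q0 kernel_poly
                        + 'X * base_change polyC e q1 kernel_poly.
Proof.
rewrite /disc_poly /Delta /half_disc /=.
set h : {rmorphism _ -> _} := map_poly (horner_eval (1 : k)).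
have hc a : polyC a = h (const2 k a).
  by rewrite /h /= map_polyC /= /horner_eval hornerC.
set w := omega _.
have hw : map_mx h w = kernel_poly.
  rewrite kernel_polyE /w /omega polar_mx_pencil -pfaffian_row_map; congr pfaffian_row.
  apply/matrixP => i j; rewrite !mxE rmorphD !rmorphM -!hc /h /= map_polyC /= map_polyX.
  by rewrite /horner_eval hornerX mul1r.
by rewrite rmorphD !rmorphM -!(base_change_map _ _ _ hc) hw /h /= map_polyC map_polyX
   /= /horner_eval hornerX mul1r.
Qed.

(** Delta is homogeneous, so setting t0 = 1 does not merge coefficients. *)
Lemma disc_coefE i : (i <= n)%N -> disc_coef e q0 q1 i = disc`_i.
Proof.
suff hD : bihom n (Delta e q0 q1) by move=> ln; rewrite (bihom_eval _ hD) ln.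
have hw i' : bihom m (omega (fun v => 'X%:P * base_change (const2 k) e q0 v
                      + 'X * base_change (const2 k) e q1 v) 0 i').
  rewrite mxE polar_mx_pencil -[X in bihom X]doubleK; apply: bihom_pfaffian => a b.
  rewrite !mxE; apply: bihomD; apply: (@bihomM _ 1 0);
  by [exact: bihom_t0 | exact: bihom_t1 | exact: bihom_const].
by apply: bihomD; apply: (@bihomM _ 1 m.*2);
  [exact: bihom_t0|exact: bihom_base_change|exact: bihom_t1|exact: bihom_base_change].
Qed.

Lemma size_kernel_poly j : (size (kernel_poly 0%R j) <= m.+1)%N.
Proof.
rewrite kernel_polyE mxE -[X in (_ <= X.+1)%N]doubleK; apply: size_pfaffian => a b.
rewrite !mxE.
apply: (leq_trans (size_polyD _ _)); rewrite geq_max (leq_trans (size_polyC_leq1 _)) //=.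
apply: (leq_trans (size_polyMleq _ _)); rewrite size_polyX.
by have := size_polyC_leq1 (polar q1 e`_(lift j a) e`_(lift j b)); case: (size _).
Qed.

Lemma kernel_poly_ker : kernel_poly *m pencil_mx polyC 'X = 0.
Proof.
rewrite kernel_polyE.
apply: pfaffian_row_ker; [exact: (rmorph_char2 char2 polyC)| exact: pencil_sym|].
exact: pencil_alt.
Qed.

Definition kernel_coef (i : nat) : 'rV[k]_n := \row_j (kernel_poly 0 j)`_i.

Definition kernel_mx : 'M[k]_(m.+1, n) := \matrix_(i < m.+1) kernel_coef i.

Local Notation om := kernel_coef.
Local Notation Om := kernel_mx.

Lemma kernel_coef_ge i : (m < i)%N -> om i = 0.
Proof.
by move=> mi; apply/rowP => j; rewrite !mxE nth_default // (leq_trans (size_kernel_poly j)).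
Qed.

(** This is the coefficient of t ^ (i + 1) in omega(t) B_t = 0. *)
Lemma kernel_coef_rel i : om i *m B1 = om i.+1 *m B0.
Proof.
apply/rowP => j; have /rowP/(_ j)/polyP/(_ i.+1) := kernel_poly_ker.
rewrite mulmxDr -scalemxAr !mxE coef0 coefD coefXM /= !coef_sum => /eqP.
rewrite addr_eq0 (oppr_pchar2 char2) => /eqP h.
transitivity (\sum_l (kernel_poly 0 l * map_mx polyC B1 l j)`_i).
  by apply: eq_bigr => l _; rewrite !mxE coefMC.
by rewrite -h; apply: eq_bigr => l _; rewrite !mxE coefMC.
Qed.

Lemma kernel_coef0 : om 0 *m B0 = 0.
Proof.
apply/rowP => j; have /rowP/(_ j)/polyP/(_ 0%N) := kernel_poly_ker.
rewrite mulmxDr -scalemxAr !mxE coef0 coefD coefXM /= addr0 coef_sum => h.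
by apply: etrans h; apply: eq_bigr => l _; rewrite !mxE coefMC.
Qed.

End PencilTheory.

(** * Regular pencils *)

Lemma ext_sqrt (F : fieldType) n (c : 'I_n -> F) :
  exists (L : fieldType) (j : {rmorphism F -> L}) (d : 'I_n -> L), forall i, d i ^+ 2 = j (c i).
Proof.
elim: n F c => [|n IH] F c; first by exists F, idfun, (fun=> 0) => -[].
have [L [j [d hd]]] := IH F (c \o lift ord0).
have [|L' [j' [x /rootP hx]]] := @ext_root L ('X^2 - (j (c ord0))%:P).
  by rewrite size_XnsubC.
exists L', (j' \o j), (fun i => oapp (fun i' => j' (d i')) x (unlift ord0 i)) => i.
case: (unliftP ord0 i) => [i' ->|->] /=; first by rewrite -rmorphXn hd.
move/eqP: hx; rewrite rmorphB /= map_polyXn map_polyC hornerD hornerN hornerXn hornerC.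
by rewrite subr_eq0 => /eqP.
Qed.

Lemma ext_binary_quadratic (F : fieldType) (A C D : F) :
  exists (L : fieldType) (j : {rmorphism F -> L}) (a b : L),
    (a != 0) || (b != 0) /\ a ^+ 2 * j A + a * b * j C + b ^+ 2 * j D = 0.
Proof.
have [D0|D0] := eqVneq D 0.
  exists F, idfun, 0, 1; rewrite oner_eq0 orbT /= D0; split=> //.
  by rewrite expr0n /= !mul0r mulr0 !addr0.
have [|L [j [x /rootP hx]]] := @ext_root F (D *: 'X^2 + (C *: 'X + A%:P)).
  rewrite size_polyDl size_scale ?size_polyXn // ltnS.
  apply: leq_trans (size_polyD _ _) _; rewrite geq_max.
  rewrite (leq_trans (size_scale_leq _ _)) ?size_polyX //=.
  exact: leq_trans (size_polyC_leq1 _) _.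
exists L, j, 1, x; rewrite oner_eq0; split => //.
move: hx; rewrite !rmorphD /= !map_polyZ /= map_polyXn map_polyX map_polyC /=.
rewrite !hornerD !hornerZ hornerXn hornerX hornerC => hx; apply: etrans hx; ring.
Qed.

Section RegularPencil.
Variables (k : fieldType) (char2 : 2%N \in [pchar k]) (m : nat).
Local Notation n := m.*2.+1.
Variables (E : vectType k) (e : n.-tuple E) (q0 q1 : E -> k).
Hypotheses (q0_quad : quadratic_form q0) (q1_quad : quadratic_form q1).
Hypothesis q_reg : regular_pair e q0 q1.

Local Notation B0 := (gram e q0).
Local Notation B1 := (gram e q1).
Local Notation disc := (disc_poly e q0 q1).
Local Notation pencil := (pencil_mx e q0 q1).
Local Notation kpoly := (kernel_poly e q0 q1).
Local Notation om := (kernel_coef e q0 q1).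
Local Notation Om := (kernel_mx e q0 q1).

(** A point of X that is singular on a member of the pencil is a singular point
    of X: there the two gradients are proportional. *)
Lemma regular_gradients (L : fieldType) (iota : {rmorphism k -> L}) (v : 'rV[L]_n) s t :
  v != 0 -> base_change iota e q0 v = 0 -> base_change iota e q1 v = 0 ->
  v *m (s *: map_mx iota B0 + t *: map_mx iota B1) = 0 -> s = 0 /\ t = 0.
Proof.
move=> v0 h0 h1 hv; have := q_reg v0 h0 h1.
rewrite !gradientE // => rk.
have free : row_free (col_mx (v *m map_mx iota B0) (v *m map_mx iota B1)).
  by rewrite /row_free rk.
have : row_mx s%:M t%:M *m col_mx (v *m map_mx iota B0) (v *m map_mx iota B1) = 0.
  by rewrite mul_row_col !mul_scalar_mx -hv mulmxDr -!scalemxAr.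
move/eqP; rewrite (mulmx_free_eq0 _ free) => /eqP st.
have /rowP/(_ 0) : s%:M = 0 :> 'M_1 by rewrite -(row_mxKl s%:M (t%:M : 'M_1)) st linear0.
have /rowP/(_ 0) : t%:M = 0 :> 'M_1 by rewrite -(row_mxKr (s%:M : 'M_1) t%:M) st linear0.
by rewrite !mxE.
Qed.

(** On the plane spanned by p and p' the form q_t is zero, as it is additive on
    the kernel of its polar form.  The restriction of q_1 is a binary form, which has
    a zero after a quadratic extension; this zero is a point of X that is singular on
    the member t of the pencil. *)
Lemma ker_pencil_plane (L : fieldType) (iota : {rmorphism k -> L}) t (p p' : 'rV[L]_n) y y' :
  p *m pencil iota t = 0 -> p' *m pencil iota t = 0 ->
  base_change iota e q0 p + t * base_change iota e q1 p = 0 ->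
  base_change iota e q0 p' + t * base_change iota e q1 p' = 0 ->
  p 0 y != 0 -> p' 0 y = 0 -> p 0 y' = 0 -> p' 0 y' != 0 -> False.
Proof.
move=> pB p'B pq p'q py p'y py' p'y'.
pose P1 := map_mx iota B1.
pose A := base_change iota e q1 p; pose D := base_change iota e q1 p'.
pose C := (p *m P1 *m p'^T) 0 0.
have [L' [j [a [b [ab0 hab]]]]] := ext_binary_quadratic A C D.
pose v := a *: map_mx j p + b *: map_mx j p'.
have ji : forall c, (j \o iota) c = j (iota c) by [].
have pencilE : pencil (j \o iota) (j t) = map_mx j (pencil iota t) by apply: pencil_map.
have vB : v *m pencil (j \o iota) (j t) = 0.
  by rewrite pencilE mulmxDl -!scalemxAl -!map_mxM pB p'B map_mx0 !scaler0 addr0.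
have bcj q u : base_change (j \o iota) e q (map_mx j u) = j (base_change iota e q u).
  exact: base_change_map.
have polE q : (map_mx j p *m map_mx (j \o iota) (gram e q) *m (map_mx j p')^T) 0 0 =
    j ((p *m map_mx iota (gram e q) *m p'^T) 0 0).
  have -> : map_mx (j \o iota) (gram e q) = map_mx j (map_mx iota (gram e q)).
    by apply/matrixP => i i'; rewrite !mxE.
  by rewrite map_trmx -!map_mxM mxE.
have bcv q : quadratic_form q -> base_change (j \o iota) e q v =
    a ^+ 2 * j (base_change iota e q p) + b ^+ 2 * j (base_change iota e q p')
    + a * b * j ((p *m map_mx iota (gram e q) *m p'^T) 0 0).
  move=> qq; rewrite base_changeD // !base_changeZ !bcj; congr (_ + _).
  by rewrite linearZ /= -!scalemxAl -scalemxAr scalerA mxE polE.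
have v1 : base_change (j \o iota) e q1 v = 0.
  by rewrite bcv // -hab -/A -/C -/D; ring.
have v0 : base_change (j \o iota) e q0 v = 0.
  suff : base_change (j \o iota) e q0 v + j t * base_change (j \o iota) e q1 v = 0.
    by rewrite v1 mulr0 addr0.
  rewrite !bcv //.
  have h1 : j (base_change iota e q0 p) = - (j t * j (base_change iota e q1 p)).
    by apply/eqP; rewrite -addr_eq0 -rmorphM -rmorphD pq rmorph0.
  have h2 : j (base_change iota e q0 p') = - (j t * j (base_change iota e q1 p')).
    by apply/eqP; rewrite -addr_eq0 -rmorphM -rmorphD p'q rmorph0.
  have h3 : j ((p *m map_mx iota B0 *m p'^T) 0 0) =
      - (j t * j ((p *m map_mx iota B1 *m p'^T) 0 0)).
    apply/eqP; rewrite -addr_eq0 -rmorphM -rmorphD.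
    suff -> : (p *m map_mx iota B0 *m p'^T) 0 0 + t * (p *m map_mx iota B1 *m p'^T) 0 0 = 0.
      by rewrite rmorph0.
    have /matrixP/(_ 0 0) : p *m pencil iota t *m p'^T = 0 by rewrite pB mul0mx.
    by rewrite mulmxDr mulmxDl -scalemxAr -scalemxAl !mxE.
  by rewrite h1 h2 h3; ring.
have vn0 : v != 0.
  apply/eqP => /rowP v_0; have := v_0 y; have := v_0 y'.
  rewrite !mxE py' p'y !rmorph0 !mulr0 addr0 add0r => /eqP.
  rewrite mulf_eq0 fmorph_eq0 (negPf p'y') orbF.
  move=> /eqP b0 /eqP; rewrite mulf_eq0 fmorph_eq0 (negPf py) orbF => /eqP a0.
  by move: ab0; rewrite a0 b0 eqxx.
have [|/eqP] := @regular_gradients _ (j \o iota) v 1 (j t) vn0 v0 v1.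
  by rewrite scale1r.
by rewrite oner_eq0.
Qed.

(** Otherwise the kernel of B_t contains three independent vectors, on which q_t
    is additive.  Over an extension containing the square roots of its values it is
    there the square of a linear form, hence vanishes on a plane. *)
Lemma pfaffian_row_pencil_neq0 (L : fieldType) (iota : {rmorphism k -> L}) t :
  pfaffian_row (pencil iota t) != 0.
Proof.
apply/eqP => w0.
have [||x [v [vB vx vx0]]] := pfaffian_row0_ker (rmorph_char2 char2 iota) _ _ w0.
- exact: pencil_sym.
- exact: pencil_alt.
have [L' [j [d hd]]] :=
  ext_sqrt (fun i => base_change iota e q0 (v i) + t * base_change iota e q1 (v i)).
have [i0 hi0] : exists i0, (d i0 == 0) ==> [forall i, d i == 0].
  have [/existsP[i0 di0]|] := boolP [exists i, d i != 0].
    by exists i0; rewrite (negPf di0).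
  rewrite negb_exists => /forallP h; exists ord0; apply/implyP => _.
  by apply/forallP => i; rewrite -[_ == _]negbK h.
have [i1 [i2 [n01 n02 n12]]] : exists i1 i2 : 'I_3, [/\ i1 != i0, i2 != i0 & i1 != i2].
  by case: i0 {hi0} => -[|[|[|]]] // lt;
   [exists (inord 1), (inord 2) | exists (inord 0), (inord 2) | exists (inord 0), (inord 1)];
   split; rewrite -val_eqE /= ?inordK.
(* q_t (sum_i x_i v_i) is the square of sum_i x_i d_i, and c v_i + d_i v_i0 is
   in the kernel of this linear form. *)
pose c := if d i0 == 0 then 1 else d i0.
have c0 : c != 0 by rewrite /c; case: ifP => [_|/negbT//]; exact: oner_neq0.
pose p i := c *: map_mx j (v i) + d i *: map_mx j (v i0).
have ji : forall c, (j \o iota) c = j (iota c) by [].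
have pB i : p i *m pencil (j \o iota) (j t) = 0.
  rewrite (pencil_map _ _ _ _ ji) mulmxDl -!scalemxAl -!map_mxM !vB.
  by rewrite map_mx0 !scaler0 addr0.
have addRR (z : L') : z + z = 0 := addrr_pchar2 (rmorph_char2 char2 (j \o iota)) z.
have pq i : base_change (j \o iota) e q0 (p i) + j t * base_change (j \o iota) e q1 (p i) = 0.
  rewrite !base_changeD // !base_changeZ.
  have h (u u' : 'rV_n) : u *m pencil (j \o iota) (j t) = 0 ->
     (u *m map_mx (j \o iota) B0 *m u'^T) 0 0
     + j t * (u *m map_mx (j \o iota) B1 *m u'^T) 0 0 = 0.
    move=> uB; have /matrixP/(_ 0 0) : u *m pencil (j \o iota) (j t) *m u'^T = 0.
      by rewrite uB mul0mx.
    by rewrite mulmxDr mulmxDl -scalemxAr -scalemxAl !mxE.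
  have alg a b r A0 A1 D0 D1 P0 P1 : P0 + r * P1 = 0 ->
      a * A0 + b * D0 + P0 + r * (a * A1 + b * D1 + P1) =
      a * (A0 + r * A1) + b * (D0 + r * D1) :> L'.
    by move=> hP; rewrite -[RHS]addr0 -hP; ring.
  rewrite alg; last first.
    by apply: h; rewrite -!scalemxAl (pencil_map _ _ _ _ ji) -map_mxM vB map_mx0 scaler0.
  rewrite !(base_change_map _ _ _ ji) -!rmorphM -!rmorphD -!hd.
  rewrite /c; case: eqP => [di0|_]; last by rewrite mulrC addRR.
  by move: hi0; rewrite di0 eqxx => /forallP/(_ i)/eqP ->; rewrite expr0n mulr0 mul0r addr0.
have px i i' : i != i0 -> i' != i0 ->
    p i 0 (x i') = if i == i' then c * j (v i 0 (x i)) else 0.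
  move=> ni ni'; have vi0 : v i0 0 (x i') = 0 by apply: vx0; rewrite eq_sym.
  rewrite !mxE vi0 rmorph0 mulr0 addr0.
  by case: eqP => [->//|/eqP nii']; rewrite vx0 // rmorph0 mulr0.
apply: (@ker_pencil_plane _ (j \o iota) (j t) (p i1) (p i2) (x i1) (x i2)) => //.
- by rewrite px // eqxx mulf_neq0 // fmorph_eq0.
- by rewrite px // eq_sym (negPf n12).
- by rewrite px // (negPf n12).
- by rewrite px // eqxx mulf_neq0 // fmorph_eq0.
Qed.

Lemma kernel_poly_eval (L : fieldType) (iota : {rmorphism k -> L}) t :
  map_mx (fun p : {poly k} => (map_poly iota p).[t]) kpoly = pfaffian_row (pencil iota t).
Proof.
pose h : {rmorphism {poly k} -> L} := horner_eval t \o map_poly iota.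
have hX : h 'X = t by rewrite /h /= map_polyX /horner_eval hornerX.
rewrite -{2}hX (@kernel_poly_map _ _ _ e q0 q1 _ iota h) // => a.
by rewrite /h /= map_polyC /horner_eval hornerC.
Qed.

(** A common factor of the coordinates would have a root t in some extension, and
    omega(t) would be zero. *)
Lemma kernel_poly_primitive : exists u : 'I_n -> {poly k}, \sum_j u j * kpoly 0 j = 1.
Proof.
have [u hu] := bezout_family (fun j => kpoly 0 j).
set g := \sum_j _ in hu.
have [sg|sg] := eqVneq (size g) 1%N.
  have /size_poly1P[c c0 gc] : size g == 1%N by rewrite sg.
  exists (fun j => c^-1%:P * u j); under eq_bigr => j _ do rewrite -mulrA.
  by rewrite -mulr_sumr -/g gc -polyCM mulVf.
have [L [j [x gx]]] := ext_root sg.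
have /eqP[] := pfaffian_row_pencil_neq0 j x.
rewrite -kernel_poly_eval; apply/rowP => i; rewrite !mxE.
by apply/rootP; apply: root_dvdp gx; rewrite dvdp_map.
Qed.

End RegularPencil.

(** * Separability and minimal degree *)

Section PencilIsotropy.
Variables (k : fieldType) (char2 : 2%N \in [pchar k]) (m : nat).
Local Notation n := m.*2.+1.
Variables (E : vectType k) (e : n.-tuple E) (q0 q1 : E -> k).
Hypotheses (q0_quad : quadratic_form q0) (q1_quad : quadratic_form q1).

Local Notation B0 := (gram e q0).
Local Notation B1 := (gram e q1).
Local Notation disc := (disc_poly e q0 q1).
Local Notation pencil := (pencil_mx e q0 q1).
Local Notation kpoly := (kernel_poly e q0 q1).
Local Notation om := (kernel_coef e q0 q1).
Local Notation Om := (kernel_mx e q0 q1).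
Local Notation bc q := (base_change (idfun : {rmorphism k -> k}) e q).

(** b_0(omega_(i+1), omega_j) = b_1(omega_i, omega_j) = b_0(omega_i, omega_(j+1)),
    and omega_0 is in the kernel of b_0. *)
Lemma kernel_coef_isotropic0 i j : om i *m B0 *m (om j)^T = 0.
Proof.
elim: i j => [|i IH] j; first by rewrite kernel_coef0 // mul0mx.
have sw q a b : om a *m gram e q *m (om b)^T = (om b *m gram e q *m (om a)^T)^T.
  by rewrite !trmx_mul trmxK gram_sym mulmxA.
by rewrite -kernel_coef_rel // sw kernel_coef_rel // -sw IH.
Qed.

Lemma kernel_coef_isotropic1 i j : om i *m B1 *m (om j)^T = 0.
Proof. by rewrite kernel_coef_rel // kernel_coef_isotropic0. Qed.

Lemma row_kernel_mx i : row i Om = om i.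
Proof. by apply/rowP => j; rewrite !mxE. Qed.

Lemma kernel_mx_isotropic0 : Om *m B0 *m Om^T = 0.
Proof.
apply/matrixP => i j; rewrite -row_mul_tr row_mul !row_kernel_mx.
by rewrite kernel_coef_isotropic0 !mxE.
Qed.

Lemma kernel_mx_isotropic1 : Om *m B1 *m Om^T = 0.
Proof.
apply/matrixP => i j; rewrite -row_mul_tr row_mul !row_kernel_mx.
by rewrite kernel_coef_isotropic1 !mxE.
Qed.

Lemma base_change_kernel (R : comNzRingType) (iota : {rmorphism k -> R}) q (z : 'rV_m.+1) :
  quadratic_form q -> Om *m gram e q *m Om^T = 0 ->
  base_change iota e q (z *m map_mx iota Om) = \sum_i z 0 i ^+ 2 * iota (bc q (om i)).
Proof.
move=> qq h; rewrite base_change_isotropic //; last first.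
  by rewrite map_trmx -!map_mxM h map_mx0.
apply: eq_bigr => i _; congr (_ * _).
by rewrite -map_row row_kernel_mx (base_change_map (i1 := idfun) _ _ _ (fun=> erefl)).
Qed.

Lemma kernel_polyM : kpoly = (\row_(i < m.+1) 'X^i) *m map_mx polyC Om.
Proof.
apply/rowP => j; rewrite !mxE [LHS](_ : _ = \poly_(i < m.+1) (om i 0 j)).
  by rewrite poly_def; apply: eq_bigr => i _; rewrite !mxE -mul_polyC mulrC.
apply/polyP => i; rewrite coef_poly !mxE; case: ltnP => // mi.
by rewrite nth_default // (leq_trans (size_kernel_poly e q0 q1 j)).
Qed.

Lemma base_change_kernel_poly q : quadratic_form q -> Om *m gram e q *m Om^T = 0 ->
  base_change polyC e q kpoly = \sum_(i < m.+1) bc q (om i) *: 'X^(i.*2).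
Proof.
move=> qq h; rewrite kernel_polyM base_change_kernel //; apply: eq_bigr => i _.
by rewrite mxE -exprM muln2 mulrC mul_polyC.
Qed.

(** As the omega_i are pairwise orthogonal for b_0 and b_1, both q_0 and q_1 are
    additive on them. *)
Lemma disc_sum : disc = \sum_(i < m.+1) bc q0 (om i) *: 'X^(i.*2)
                      + 'X * \sum_(i < m.+1) bc q1 (om i) *: 'X^(i.*2).
Proof.
rewrite disc_polyE // !base_change_kernel_poly //.
- exact: kernel_mx_isotropic1.
- exact: kernel_mx_isotropic0.
Qed.

Lemma coef_even_sum (c : nat -> k) j : (\sum_(i < m.+1) c i *: 'X^(i.*2))`_j =
  if (j < n.+1)%N && ~~ odd j then c j./2 else 0.
Proof.
rewrite coef_sum; case: ifP => [/andP[jn jo]|h].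
  have jm : (j./2 < m.+1)%N by lia.
  rewrite (bigD1 (Ordinal jm)) //= coefZ coefXn even_halfK // eqxx mulr1 big1 ?addr0 // => i ni.
  rewrite coefZ coefXn; case: eqP => [ji|]; rewrite ?mulr0 //.
  by case/eqP: ni; apply: val_inj; rewrite /= ji doubleK.
rewrite big1 // => i _; rewrite coefZ coefXn; case: eqP => [ji|]; rewrite ?mulr0 //.
by move: h; rewrite ji odd_double andbT ltnS => /negbT; have := ltn_ord i; lia.
Qed.

Lemma disc_even i : (i <= m)%N -> disc`_(i.*2) = bc q0 (om i).
Proof.
move=> im; rewrite disc_sum coefD coefXM !(coef_even_sum (fun i => bc _ (om i))).
rewrite odd_double doubleK andbT ltnS ltnW ?ltnS ?leq_double // double_eq0.
case: i im => [|i] im /=; first by rewrite addr0.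
by rewrite odd_double /= andbF addr0.
Qed.

Lemma disc_odd i : (i <= m)%N -> disc`_(i.*2.+1) = bc q1 (om i).
Proof.
move=> im; rewrite disc_sum coefD coefXM !(coef_even_sum (fun i => bc _ (om i))) /=.
by rewrite odd_double /= andbF add0r doubleK andbT ltnS leqW ?leqW ?leq_double.
Qed.

Lemma disc_gt i : (n < i)%N -> disc`_i = 0.
Proof.
move=> im; rewrite disc_sum coefD coefXM !(coef_even_sum (fun i => bc _ (om i))).
rewrite ltnNge im /= add0r; case: i im => //= i im.
case: ifP => // /andP[h1 h2]; lia.
Qed.

(** In characteristic 2 the even powers of t have derivative zero. *)
Lemma disc_deriv : disc^`() = base_change polyC e q1 kpoly.
Proof.
have even_deriv (c : nat -> k) : (\sum_(i < m.+1) c i *: 'X^(i.*2))^`() = 0.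
  rewrite linear_sum big1 // => i _; rewrite linearZ /= derivXn -muln2 mulnC mulrnA.
  by rewrite -[X in X *+ i]mulr_natr -polyC_natr (pcharf0 char2) mulr0 mul0rn scaler0.
rewrite disc_sum derivD derivM derivX mul1r !(even_deriv (fun i => bc _ (om i))).
rewrite mulr0 addr0 add0r.
by rewrite base_change_kernel_poly //; exact: kernel_mx_isotropic1.
Qed.

End PencilIsotropy.

Section MinimalDegree.
Variables (k : fieldType) (char2 : 2%N \in [pchar k]) (m : nat).
Local Notation n := m.*2.+1.
Variables (E : vectType k) (e : n.-tuple E) (q0 q1 : E -> k).
Hypotheses (q0_quad : quadratic_form q0) (q1_quad : quadratic_form q1).
Hypothesis q_reg : regular_pair e q0 q1.
Hypothesis an_neq0 : (disc_poly e q0 q1)`_n != 0.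

Local Notation B0 := (gram e q0).
Local Notation B1 := (gram e q1).
Local Notation disc := (disc_poly e q0 q1).
Local Notation pencil := (pencil_mx e q0 q1).
Local Notation kpoly := (kernel_poly e q0 q1).
Local Notation om := (kernel_coef e q0 q1).
Local Notation Om := (kernel_mx e q0 q1).

Lemma disc_size : size disc = n.+1.
Proof.
apply/eqP; rewrite eqn_leq; apply/andP; split.
  by apply/leq_sizeP => j nj; rewrite disc_gt.
by rewrite ltnNge; apply: contra an_neq0 => h; rewrite nth_default.
Qed.

(** At a double root t of f both f = q_0 + t q_1 and f' = q_1 vanish on omega(t),
    so that omega(t) is a point of X, singular on the member t of the pencil. *)
Lemma disc_separable : separable_poly disc.
Proof.
rewrite unlock; apply: contraT => /ext_root[L [j [t gt]]].
have ft : root (map_poly j disc) t.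
  by apply: root_dvdp gt; rewrite dvdp_map dvdp_gcdl.
have f't : root (map_poly j disc^`()) t.
  by apply: root_dvdp gt; rewrite dvdp_map dvdp_gcdr.
pose h : {rmorphism {poly k} -> L} := horner_eval t \o map_poly j.
have hj a : j a = h a%:P by rewrite /h /= map_polyC /horner_eval hornerC.
have hX : h 'X = t by rewrite /h /= map_polyX /horner_eval hornerX.
pose w := map_mx h kpoly.
have wE : w = pfaffian_row (pencil j t) by rewrite -kernel_poly_eval.
have w0 : w != 0 by rewrite wE pfaffian_row_pencil_neq0.
have w1 : base_change j e q1 w = 0.
  rewrite /w (base_change_map _ _ _ hj) -disc_deriv //; exact/rootP.
have w2 : base_change j e q0 w = 0.
  have : h disc = 0 by exact/rootP.
  rewrite disc_polyE // rmorphD rmorphM hX -!(base_change_map _ _ _ hj) -/w w1.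
  by rewrite mulr0 addr0.
have [|/eqP] := @regular_gradients _ char2 _ _ _ _ _ q0_quad q1_quad q_reg _ j w 1 t w0 w2 w1.
- rewrite scale1r wE; apply: pfaffian_row_ker.
  + exact: (rmorph_char2 char2 j).
  + exact: pencil_sym.
  + exact: pencil_alt.
- by rewrite oner_eq0.
Qed.

Lemma kernel_coef_last : exists i0, (kpoly 0 i0)`_m != 0.
Proof.
apply: boolp.contrapT => h; case/eqP: an_neq0.
rewrite disc_odd // (_ : om m = 0) ?base_change0 //.
apply/rowP => j; rewrite !mxE; apply/eqP/negPn/negP => hj; apply: h; by exists j.
Qed.

(** A kernel vector is parallel to omega over the fractions, and a polynomial
    multiple of it because omega is primitive; but coordinate i0 of omega has
    degree m. *)
Lemma kernel_poly_min (F : fieldType) (iota : {rmorphism k -> F}) (v : 'rV[{poly F}]_n) i0 :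
  (kpoly 0 i0)`_m != 0 -> v *m pencil (polyC \o iota) 'X = 0 ->
  (size (v 0%R i0) <= m)%N -> v = 0.
Proof.
move=> hi0 vB sv.
pose h : {rmorphism {poly k} -> {poly F}} := map_poly iota.
have hc a : (polyC \o iota) a = h a%:P by rewrite /h /= map_polyC.
have hX : h 'X = 'X by rewrite /h /= map_polyX.
have chF := rmorph_char2 char2 (polyC \o iota).
have wE : pfaffian_row (pencil (polyC \o iota) 'X) = map_mx h kpoly.
  by rewrite -(kernel_poly_map e q0 q1 hc) hX.
have par i j : v 0 j * h (kpoly 0 i) = v 0 i * h (kpoly 0 j).
  have := ker_parallel chF (pencil_sym e q0 q1 _ _) _ i j vB.
  rewrite wE ![map_mx h _ _ _]mxE; apply; exact: pencil_alt.
have [u hu] := kernel_poly_primitive char2 q0_quad q1_quad q_reg.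
have v0 : v 0 i0 = 0.
  have : v 0 i0 = h (kpoly 0 i0) * \sum_j h (u j) * v 0 j.
    rewrite -[LHS]mulr1 -[1](rmorph1 h) -hu rmorph_sum !mulr_sumr; apply: eq_bigr => j _.
    by rewrite rmorphM mulrCA -par; ring.
  set s := \sum_j _; have [->|s0] := eqVneq s 0; first by rewrite mulr0.
  move=> vE; have k0 : kpoly 0 i0 != 0.
    by apply: contraNneq hi0 => ->; rewrite coef0.
  have : (size (h (kpoly 0%R i0)) <= size (v 0%R i0))%N.
    have s1 : (0 < size s)%N by rewrite size_poly_gt0.
    by rewrite vE size_mul ?map_poly_eq0 // -(prednK s1) addnS leq_addr.
  rewrite size_map_poly => /leq_trans/(_ sv) /leq_sizeP/(_ m (leqnn _)) h0.
  by rewrite h0 eqxx in hi0.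
apply/rowP => j; rewrite mxE; apply/eqP; have /eqP := par i0 j.
rewrite v0 mul0r mulf_eq0 /h /= map_poly_eq0 => /orP[//|/eqP k0].
by move: hi0; rewrite k0 coef0 eqxx.
Qed.

(** Apply to the variable t of (omega(t) - omega(s)) / (t - s) the functional
    that sends t ^ i to c i.  Since B_s omega(t) = (s - t) b_1(omega(t)), the
    assumption makes the result a kernel vector at s.  Its degree in s is less
    than m, so it is zero.  Its coefficients N b give a triangular system for c,
    with omega_m on the diagonal. *)
Lemma kernel_coef_free1 (c : nat -> k) : (\sum_(i < m.+1) c i *: om i) *m B1 = 0 ->
  forall i, (i < m)%N -> c i = 0.
Proof.
move=> hc; (* The coefficient of s ^ b; the terms with i + b + 1 > m are zero. *)
pose N b := \sum_(i < m.+1) c i *: om (i + b.+1)%N.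
have Nge b : (m <= b)%N -> N b = 0.
  move=> mb; rewrite /N big1 // => i _; rewrite kernel_coef_ge ?scaler0 //; lia.
pose v : 'rV[{poly k}]_n := \row_j \poly_(b < m) N b 0 j.
have cv b j : (v 0 j)`_b = N b 0 j.
  by rewrite mxE coef_poly; case: ltnP => // /Nge->; rewrite mxE.
have [i0 hi0] := kernel_coef_last.
have addRR (x : k) : x + x = 0 := addrr_pchar2 char2 x.
have NB b : N b *m B0 = (if b is b'.+1 then N b' else 0) *m B1.
  case: b => [|b].
    rewrite mul0mx -hc !mulmx_suml; apply: eq_bigr => i _.
    by rewrite -!scalemxAl addn1 -kernel_coef_rel.
  rewrite !mulmx_suml; apply: eq_bigr => i _.
  by rewrite -!scalemxAl addnS -kernel_coef_rel.
have v0 : v = 0.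
  apply: (@kernel_poly_min _ idfun _ i0) => //; last by rewrite mxE size_poly.
  apply/rowP => j; apply/polyP => b; rewrite mulmxDr -scalemxAr !mxE coef0 coefD coefXM.
  have h q :
      (\sum_l v 0 l * map_mx (polyC \o idfun) (gram e q) l j)`_b = (N b *m gram e q) 0 j.
    by rewrite coef_sum mxE; apply: eq_bigr => l _; rewrite [map_mx _ _ _ _]mxE coefMC cv.
  rewrite h NB; case: b h => [|b] h /=; first by rewrite mul0mx mxE addr0.
  rewrite mxE coef_sum [X in _ + X](_ : _ = (N b *m B1) 0 j); first by rewrite mxE addRR.
  by rewrite mxE; apply: eq_bigr => l _; rewrite [map_mx _ _ _ _]mxE coefMC cv.
have N0 b : N b = 0 by apply/rowP => j; rewrite -cv v0 !mxE coef0.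
move=> i; have [M] := ubnP i; elim: M i => // M IH i iM im.
have iE : (inord i : 'I_m.+1) = i :> nat by rewrite inordK // ltnW.
have := N0 (m - i.+1)%N; rewrite /N (bigD1 (inord i)) //= iE.
rewrite big1 => [|l nl]; last first.
  have [li|il|li] := ltngtP l i.
  - by rewrite (IH l) ?scale0r //; lia.
  - by rewrite kernel_coef_ge ?scaler0 //; lia.
  - by case/eqP: nl; apply: val_inj; rewrite /= iE.
rewrite addr0 subnSK // subnKC ?(ltnW im) // => /rowP/(_ i0); rewrite !mxE => /eqP.
by rewrite mulf_eq0 (negPf hi0) orbF => /eqP.
Qed.

End MinimalDegree.

(** * Hankel matrices and the Artin-Schreier map in coordinates *)

Lemma sqr_sum_char2 (R : comNzRingType) (char2 : 2%N \in [pchar R]) (I : finType) (x : I -> R) :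
  (\sum_i x i) ^+ 2 = \sum_i x i ^+ 2.
Proof.
rewrite expr2 mulr_suml; under eq_bigr => i _ do rewrite mulr_sumr.
by rewrite (sum_sym2 char2) // => i j; rewrite mulrC.
Qed.

Section Hankel.
Variables (F : fieldType) (char2 : 2%N \in [pchar F]) (m : nat).
Variable (a : nat -> F).
Hypothesis a_gt : forall i, (m.*2.+1 < i)%N -> a i = 0.

Definition hankel (h : nat -> F) : 'M[F]_(m, m.+1) := \matrix_(j, i) h (i + j)%N.

(** What q_0 and q_1 (for [form1]) gain at v when M is used to add multiples of
    the omega_i to v, as a function of the values c of the y_j at v. *)
Definition form0 (M : 'M[F]_(m, m.+1)) (c : 'rV[F]_m) : F :=
  \sum_(i < m.+1) (c *m M) 0 i ^+ 2 * a i.*2 + \sum_(i < m) (c *m M) 0 (lift ord0 i) * c 0 i.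

Definition form1 (M : 'M[F]_(m, m.+1)) (c : 'rV[F]_m) : F :=
  \sum_(i < m.+1) (c *m M) 0 i ^+ 2 * a i.*2.+1
  + \sum_(i < m) (c *m M) 0 (widen_ord (leqnSn m) i) * c 0 i.

(** The map s |-> s ^ 2 + s of A modulo constants, in the coordinates h of
    s = sum_l h_l d_l; this is [dual_seq_wp]. *)
Definition wp (h : nat -> F) (p : nat) : F :=
  h p + \sum_(l < m.*2) (if (p <= l.*2.+1)%N then a (l.*2.+1 - p) else 0) * h l ^+ 2.

Lemma wpD h h' p : wp (fun i => h i + h' i) p = wp h p + wp h' p.
Proof.
rewrite /wp addrACA -big_split; congr (_ + _); apply: eq_bigr => l _ /=.
by rewrite -mulrDr sqrrD mulr2n (addrr_pchar2 char2) addr0.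
Qed.

Lemma eq_wp h h' p : (p < m.*2)%N -> (forall i, (i < m.*2)%N -> h i = h' i) -> wp h p = wp h' p.
Proof. by move=> pm hh; rewrite /wp hh //; congr (_ + _); apply: eq_bigr => l _; rewrite hh. Qed.

Lemma mul_hankel (c : 'rV[F]_m) h i : (c *m hankel h) 0 i = \sum_(j < m) c 0 j * h (i + j)%N.
Proof. by rewrite mxE; apply: eq_bigr => j _; rewrite mxE. Qed.

Lemma sum_hankel (c : 'rV[F]_m) h b : \sum_(i < m.+1) (c *m hankel h) 0 i ^+ 2 * b i =
  \sum_(j < m) c 0 j ^+ 2 * \sum_(i < m.+1) b i * h (i + j)%N ^+ 2.
Proof.
under eq_bigr => i _ do rewrite mul_hankel sqr_sum_char2 // mulr_suml.
rewrite exchange_big; apply: eq_bigr => j _; rewrite mulr_sumr.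
by apply: eq_bigr => i _; ring.
Qed.

Lemma sum_shift (j : nat) (b : nat -> F) (g : nat -> F) : (j < m)%N ->
  (forall i, (m < i)%N -> b i = 0) ->
  \sum_(i < m.+1) b i * g (i + j)%N =
  \sum_(l < m.*2) (if (j <= l)%N then b (l - j)%N else 0) * g l.
Proof.
move=> jm hb.
rewrite -(big_mkord xpredT (fun i => b i * g (i + j)%N)).
rewrite -(big_mkord xpredT (fun l => (if (j <= l)%N then b (l - j)%N else 0) * g l)).
rewrite (@big_cat_nat _ _ _ j 0 m.*2) //=; last by lia.
rewrite [X in _ = X + _]big_nat [X in _ = X + _]big1 ?add0r => [|l /andP[_ lj]]; last first.
  by rewrite leqNgt lj mul0r.
rewrite (@big_cat_nat _ _ _ (j + m.+1) j m.*2) /=; try by lia.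
rewrite [X in _ = _ + X]big_nat [X in _ = _ + X]big1 ?addr0 => [|l /andP[jl _]]; last first.
  by rewrite hb ?if_same ?mul0r //; lia.
rewrite -{2}[j]add0n big_addn addKn; apply: eq_big_nat => i _.
by rewrite leq_addl addnK.
Qed.

(** The matrix (h (i + j + 1)) is symmetric, so only its diagonal contributes to
    the second sum; the first is additive in c. *)
Lemma form0_hankel h c : form0 (hankel h) c = \sum_(j < m) c 0 j ^+ 2 * wp h (j.*2.+1).
Proof.
rewrite /form0 (sum_hankel _ _ (fun i => a i.*2)).
have -> : \sum_(i < m) (c *m hankel h) 0 (lift ord0 i) * c 0 i =
    \sum_(j < m) c 0 j ^+ 2 * h j.*2.+1.
  under eq_bigr => i _ do rewrite mul_hankel mulr_suml.
  rewrite (sum_sym2 char2) => [|i j].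
    by apply: eq_bigr => i _; rewrite lift0 addSn addnn; ring.
  by rewrite !lift0 !addSn [(i + j)%N]addnC; ring.
rewrite -big_split; apply: eq_bigr => j _ /=; rewrite -mulrDr addrC; congr (_ * (_ + _)).
rewrite (sum_shift (b := fun i => a i.*2) (fun l => h l ^+ 2)) //; last first.
  by move=> i im; rewrite a_gt //; lia.
by apply: eq_bigr => l _; rewrite ltnS leq_double subSS -doubleB.
Qed.

Lemma form1_hankel h c : form1 (hankel h) c = \sum_(j < m) c 0 j ^+ 2 * wp h j.*2.
Proof.
rewrite /form1 (sum_hankel _ _ (fun i => a i.*2.+1)).
have -> : \sum_(i < m) (c *m hankel h) 0 (widen_ord (leqnSn m) i) * c 0 i =
    \sum_(j < m) c 0 j ^+ 2 * h j.*2.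
  under eq_bigr => i _ do rewrite mul_hankel mulr_suml.
  rewrite (sum_sym2 char2) => [|i j].
    by apply: eq_bigr => i _; rewrite /= addnn; ring.
  by rewrite /= [(i + j)%N]addnC; ring.
rewrite -big_split; apply: eq_bigr => j _ /=; rewrite -mulrDr addrC; congr (_ * (_ + _)).
rewrite (sum_shift (b := fun i => a i.*2.+1) (fun l => h l ^+ 2)) //; last first.
  by move=> i im; rewrite a_gt //; lia.
apply: eq_bigr => l _; have -> : (j.*2 <= l.*2.+1)%N = (j <= l)%N by lia.
by case: ifP => // jl; congr (a _ * _); lia.
Qed.

Lemma polar_form0 M c c' : form0 M (c + c') = form0 M c + form0 M c' +
  \sum_(i < m) ((c *m M) 0 (lift ord0 i) * c' 0 i + (c' *m M) 0 (lift ord0 i) * c 0 i).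
Proof.
rewrite /form0 mulmxDl [X in _ = X + _]addrACA -[RHS]addrA -!big_split /=.
congr (_ + _); apply: eq_bigr => i _; rewrite !mxE; last by ring.
by rewrite sqrrD mulr2n (addrr_pchar2 char2) addr0 mulrDl.
Qed.

Lemma polar_form1 M c c' : form1 M (c + c') = form1 M c + form1 M c' +
  \sum_(i < m) ((c *m M) 0 (widen_ord (leqnSn m) i) * c' 0 i
              + (c' *m M) 0 (widen_ord (leqnSn m) i) * c 0 i).
Proof.
rewrite /form1 mulmxDl [X in _ = X + _]addrACA -[RHS]addrA -!big_split /=.
congr (_ + _); apply: eq_bigr => i _; rewrite !mxE; last by ring.
by rewrite sqrrD mulr2n (addrr_pchar2 char2) addr0 mulrDl.
Qed.

Lemma diag_form_add (r : nat -> F) (c c' : 'rV[F]_m) :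
  \sum_(j < m) (c + c') 0 j ^+ 2 * r j =
  \sum_(j < m) c 0 j ^+ 2 * r j + \sum_(j < m) c' 0 j ^+ 2 * r j.
Proof.
rewrite -big_split; apply: eq_bigr => j _ /=.
by rewrite mxE sqrrD mulr2n (addrr_pchar2 char2) addr0 mulrDl.
Qed.

Lemma sum_delta (x : 'I_m) (G : 'I_m -> F) : \sum_i G i * (delta_mx 0 x : 'rV[F]_m) 0 i = G x.
Proof.
rewrite (bigD1 x) //= mxE !eqxx mulr1 big1 ?addr0 // => i ni.
by rewrite mxE eqxx (negPf ni) mulr0.
Qed.

Lemma sum_sqr_delta (x : 'I_m) (g : 'I_m -> F) :
  \sum_(j < m) (delta_mx 0 x : 'rV[F]_m) 0 j ^+ 2 * g j = g x.
Proof.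
rewrite -[RHS](sum_delta x g); apply: eq_bigr => j _; rewrite mxE mulrC eqxx /=.
by case: eqP; rewrite ?expr1n ?expr0n.
Qed.

(** Polarizing, the cross terms give M_(a, b+1) = M_(b, a+1) and M_(a, b) =
    M_(b, a), hence M_(a, b+1) = M_(a+1, b).  The squares then give the values of
    [wp] by [form0_hankel] and [form1_hankel]. *)
Lemma hankelP M (r : nat -> F) :
  (forall c, form0 M c = \sum_(j < m) c 0 j ^+ 2 * r j.*2.+1) ->
  (forall c, form1 M c = \sum_(j < m) c 0 j ^+ 2 * r j.*2) ->
  exists2 h, M = hankel h & forall p, (p < m.*2)%N -> wp h p = r p.
Proof.
move=> h0 h1.
have eqF (x y : F) : x + y = 0 -> x = y.
  by move/eqP; rewrite addr_eq0 (oppr_pchar2 char2) => /eqP.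
have dM (x : 'I_m) i : ((delta_mx 0 x : 'rV[F]_m) *m M) 0 i = M x i by rewrite -rowE mxE.
have s0 (x y : 'I_m) : M x (lift ord0 y) = M y (lift ord0 x).
  apply: eqF; have := polar_form0 M (delta_mx 0 x) (delta_mx 0 y).
  rewrite !h0 (diag_form_add (fun j => r j.*2.+1)) -[LHS]addr0 => /addrI.
  by rewrite big_split /= !sum_delta !dM => <-.
have s1 (x y : 'I_m) : M x (widen_ord (leqnSn m) y) = M y (widen_ord (leqnSn m) x).
  apply: eqF; have := polar_form1 M (delta_mx 0 x) (delta_mx 0 y).
  rewrite !h1 (diag_form_add (fun j => r j.*2)) -[LHS]addr0 => /addrI.
  by rewrite big_split /= !sum_delta !dM => <-.
suff [h Mh] : exists h, M = hankel h.
  exists h => // p pm; have jm : (p./2 < m)%N by lia.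
  have [po|pe] := boolP (odd p).
    have := h0 (delta_mx 0 (Ordinal jm)); rewrite Mh form0_hankel.
    rewrite (sum_sqr_delta _ (fun j => wp h j.*2.+1)) (sum_sqr_delta _ (fun j => r j.*2.+1)) /=.
    by have -> : (p./2).*2.+1 = p by lia.
  have := h1 (delta_mx 0 (Ordinal jm)); rewrite Mh form1_hankel.
  rewrite (sum_sqr_delta _ (fun j => wp h j.*2)) (sum_sqr_delta _ (fun j => r j.*2)) /=.
  by have -> : (p./2).*2 = p by lia.
have [m0|m_gt0] := posnP m.
  by exists (fun=> 0); apply/matrixP => i; have := ltn_ord i; rewrite {2}m0.
(* The entries of M with natural numbers as indices. *)
pose N x y := M (insubd (Ordinal m_gt0) x) (inord y).
have NE x y : M x y = N x y.
  by rewrite /N inord_val; congr (M _ _); apply: val_inj; rewrite val_insubd ltn_ord.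
have step x y : (x.+1 < m)%N -> (y < m)%N -> N x y.+1 = N x.+1 y.
  move=> xm ym.
  have := s0 (Ordinal (ltnW xm)) (Ordinal ym); rewrite !NE ?lift0 /= => ->.
  by have := s1 (Ordinal ym) (Ordinal xm); rewrite !NE /=.
exists (fun s => if (s <= m)%N then N 0%N s else N (s - m)%N m).
apply/matrixP => x y; rewrite mxE NE.
have lo u v : (u < m)%N -> (u + v <= m)%N -> N u v = N 0%N (u + v)%N.
  elim: u v => // u IH v um uv; rewrite -step //; first by rewrite IH ?addnS //; lia.
  by lia.
have hi d u v : (u < m)%N -> (v + d = m)%N -> (m <= u + v)%N -> N u v = N (u + v - m)%N m.
  elim: d u v => [|d IH] u v um vd uv.
    have -> : v = m by lia.
    by rewrite addnK.
  case: u um uv => [|u] um uv; first by lia.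
  rewrite -step //; last by lia.
  by rewrite IH ?addnS //; lia.
rewrite addnC; case: leqP => hm; first by rewrite lo.
by rewrite (hi (m - y)%N) //; have := ltn_ord y; lia.
Qed.

End Hankel.

Lemma hankel_inj (F : fieldType) (m : nat) (m_gt0 : (0 < m)%N) (h h' : nat -> F) p :
  (p < m.*2)%N ->
  hankel m h = hankel m h' -> h p = h' p.
Proof.
move=> pm hh; have im : (p - minn p m.-1 < m.+1)%N by lia.
have jm : (minn p m.-1 < m)%N by lia.
have /matrixP/(_ (Ordinal jm) (Ordinal im)) := hh; rewrite !mxE /=.
by rewrite subnK // geq_minl.
Qed.

(** * Isometries of a regular pair *)

Section KernelMatrices.
Variables (k : fieldType) (char2 : 2%N \in [pchar k]) (m : nat).
Local Notation n := m.*2.+1.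
Variables (E : vectType k) (e : n.-tuple E) (q0 q1 : E -> k).
Hypotheses (q0_quad : quadratic_form q0) (q1_quad : quadratic_form q1).
Hypothesis q_reg : regular_pair e q0 q1.
Hypothesis an_neq0 : (disc_poly e q0 q1)`_n != 0.

Local Notation B0 := (gram e q0).
Local Notation B1 := (gram e q1).
Local Notation disc := (disc_poly e q0 q1).
Local Notation pencil := (pencil_mx e q0 q1).
Local Notation kpoly := (kernel_poly e q0 q1).
Local Notation om := (kernel_coef e q0 q1).
Local Notation Om := (kernel_mx e q0 q1).

(** Its columns are the linear forms b_1(omega_j, _), which are the coordinates
    y_j of every normal form. *)
Definition dual_mx : 'M[k]_(n, m) := (\matrix_(j < m) (om j *m B1))^T.
Local Notation Y := dual_mx.

Lemma kernel_mx_mul_sum (v : 'rV[k]_m.+1) : v *m Om = \sum_(i < m.+1) v 0 (inord i) *: om i.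
Proof.
rewrite mulmx_sum_row; apply: eq_bigr => i _.
by rewrite row_kernel_mx inord_val.
Qed.

Lemma kernel_mx_free : row_free Om.
Proof.
apply: inj_row_free => v hv.
pose c i := v 0 (inord i).
have cE : \sum_(i < m.+1) c i *: om i = 0 by rewrite -kernel_mx_mul_sum.
have c0 := kernel_coef_free1 char2 q0_quad q1_quad q_reg an_neq0.
have {}c0 i : (i < m)%N -> c i = 0 by apply: c0; rewrite cE mul0mx.
have [i0 hi0] := kernel_coef_last char2 q0_quad q1_quad an_neq0.
have cm : c m = 0.
  move: cE; rewrite big_ord_recr big1 /= ?add0r => [/rowP/(_ i0)|i _].
    by rewrite !mxE => /eqP; rewrite mulf_eq0 (negPf hi0) orbF => /eqP.
  by rewrite c0 ?scale0r.
apply/rowP => i; rewrite mxE -[i]inord_val -/(c i).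
have := ltn_ord i; rewrite ltnS leq_eqVlt => /orP[/eqP->//|]; exact: c0.
Qed.

Lemma dual_mx_free : row_free Y^T.
Proof.
apply: inj_row_free => v; rewrite trmxK => hv.
pose c i := if insub i is Some j then v 0 j else 0.
have cE : (\sum_(i < m.+1) c i *: om i) *m B1 = 0.
  rewrite big_ord_recr /= /c [insub m]insubF ?ltnn // scale0r addr0 mulmx_suml.
  rewrite -[RHS]hv mulmx_sum_row.
  apply: eq_bigr => i _; rewrite rowK -scalemxAl insubT //= => im.
  by congr (v 0 _ *: _); apply: val_inj.
apply/rowP => i; rewrite mxE.
have := kernel_coef_free1 char2 q0_quad q1_quad q_reg an_neq0 cE (ltn_ord i).
by rewrite /c insubT //= => im <-; congr (v 0 _); apply: val_inj.
Qed.

Lemma kernel_dual : Om *m Y = 0.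
Proof.
apply/matrixP => i j; rewrite -[Y]trmxK -row_mul_tr trmxK row_kernel_mx rowK.
rewrite trmx_mul gram_sym mulmxA kernel_coef_isotropic1 //.
by rewrite !mxE.
Qed.

Section Extension.
Variables (F : fieldType) (iota : {rmorphism k -> F}).
Local Notation OmF := (map_mx iota Om).
Local Notation YF := (map_mx iota Y).
Local Notation B0F := (map_mx iota B0).
Local Notation B1F := (map_mx iota B1).
Local Notation a i := (iota disc`_i).

Let charF : 2%N \in [pchar F] := rmorph_char2 char2 iota.
Let addRR (x : F) : x + x = 0 := addrr_pchar2 charF x.

Lemma kernel_mx_freeF : row_free OmF.
Proof. by rewrite /row_free mxrank_map; exact: kernel_mx_free. Qed.

Lemma dual_mx_freeF : row_free YF^T.
Proof. by rewrite map_trmx /row_free mxrank_map; exact: dual_mx_free. Qed.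

Lemma kernel_dualF : OmF *m YF = 0.
Proof. by rewrite -map_mxM kernel_dual map_mx0. Qed.

(** The common kernel of the m independent forms y_j has dimension m + 1, and
    contains the m + 1 independent vectors omega_i. *)
Lemma dual_kernelP p (v : 'M[F]_(p, n)) : v *m YF = 0 -> exists z, v = z *m OmF.
Proof.
move=> hv; have : (v <= OmF)%MS.
  have h1 : (v <= kermx YF)%MS by apply/sub_kermxP.
  have h2 : (OmF <= kermx YF)%MS by apply/sub_kermxP; exact: kernel_dualF.
  apply: (submx_trans h1); rewrite -(geq_leqif (mxrank_leqif_sup h2)).
  rewrite mxrank_ker -[\rank YF]mxrank_tr (eqP dual_mx_freeF) (eqP kernel_mx_freeF); lia.
by case/submxP => z ->; exists z.
Qed.

Lemma kernel_dualP p (N : 'M[F]_(n, p)) : OmF *m N = 0 -> exists M, N = YF *m M.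
Proof.
move=> hN; have : (N^T <= YF^T)%MS.
  have h1 : (N^T <= kermx OmF^T)%MS by apply/sub_kermxP; rewrite -trmx_mul hN trmx0.
  have h2 : (YF^T <= kermx OmF^T)%MS.
    by apply/sub_kermxP; rewrite -trmx_mul kernel_dualF trmx0.
  apply: (submx_trans h1); rewrite -(geq_leqif (mxrank_leqif_sup h2)).
  rewrite mxrank_ker mxrank_tr (eqP dual_mx_freeF) (eqP kernel_mx_freeF); lia.
by case/submxP => z /(congr1 trmx); rewrite !trmxK trmx_mul trmxK => ->; exists z^T.
Qed.

Lemma dual_mx_onto : exists S : 'M[F]_(m, n), S *m YF = 1%:M.
Proof.
have /row_freeP[S hS] := dual_mx_freeF.
by exists S^T; apply: trmx_inj; rewrite trmx_mul trmxK hS trmx1.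
Qed.

Lemma pair1_kernel (v : 'rV[F]_n) (i : 'I_m.+1) :
  (v *m B1F *m (row i OmF)^T) 0 0 = if insub (i : nat) is Some j then (v *m YF) 0 j else 0.
Proof.
rewrite -map_row row_kernel_mx -mulmxA map_trmx -map_mxM.
have EB : B1 *m (om i)^T = (om i *m B1)^T by rewrite trmx_mul gram_sym.
rewrite EB; case: insubP => [j _ ji|mi].
  rewrite !mxE; apply: eq_bigr => l _; rewrite mxE [in RHS]mxE; congr (_ * iota _).
  by rewrite !mxE ji; apply: eq_bigr => l' _; rewrite !mxE.
rewrite kernel_coef_rel // kernel_coef_ge ?mul0mx ?trmx0 ?map_mx0 ?mulmx0 ?mxE //.
by rewrite ltnS leqNgt.
Qed.

Lemma pair0_kernel (v : 'rV[F]_n) (i : 'I_m.+1) :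
  (v *m B0F *m (row i OmF)^T) 0 0 = if unlift ord0 i is Some j then (v *m YF) 0 j else 0.
Proof.
rewrite -map_row row_kernel_mx -mulmxA map_trmx -map_mxM.
have EB : B0 *m (om i)^T = (om i *m B0)^T by rewrite trmx_mul gram_sym.
rewrite EB; case: (unliftP ord0 i) => [j ->|->].
  rewrite lift0 -kernel_coef_rel // !mxE; apply: eq_bigr => l _; rewrite mxE [in RHS]mxE.
  by congr (_ * iota _); rewrite !mxE; apply: eq_bigr => l' _; rewrite !mxE.
by rewrite kernel_coef0 // trmx0 map_mx0 mulmx0 mxE.
Qed.

(** The map v |-> v + sum_(i, j) M_(j, i) y_j(v) omega_i. *)
Definition shear (M : 'M[F]_(m, m.+1)) : 'M[F]_n := 1%:M + YF *m M *m OmF.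

Lemma shearD M N : shear M *m shear N = shear (M + N).
Proof.
rewrite /shear mulmxDl mul1mx mulmxDr mulmx1 !mulmxA -[_ *m OmF *m YF]mulmxA kernel_dualF.
by rewrite mulmx0 !mul0mx addr0 mulmxDr mulmxDl -addrA [X in _ + X]addrC.
Qed.

Lemma shear0 : shear 0 = 1%:M.
Proof. by rewrite /shear mulmx0 mul0mx addr0. Qed.

Lemma shear_unit M : shear M \in unitmx.
Proof.
have EB : shear M *m shear M = 1%:M.
  rewrite shearD -[RHS]shear0; congr shear.
  by apply/matrixP => i j; rewrite !mxE addRR.
by case: (mulmx1_unit EB).
Qed.

Lemma shear_inj M N : shear M = shear N -> M = N.
Proof.
move/addrI; have [S hS] := dual_mx_onto; have /row_freeP[T hT] := kernel_mx_freeF.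
by move/(congr1 (fun X => S *m X *m T)); rewrite !mulmxA hS !mul1mx -!mulmxA hT !mulmx1.
Qed.

Lemma shear_dual M : shear M *m YF = YF.
Proof. by rewrite /shear mulmxDl mul1mx -mulmxA kernel_dualF mulmx0 addr0. Qed.

Lemma base_change_shear0 (v : 'rV[F]_n) M : base_change iota e q0 (v *m shear M) =
  base_change iota e q0 v + form0 (fun i => a i) M (v *m YF).
Proof.
rewrite /shear mulmxDr mulmx1 base_changeD // !mulmxA -addrA; congr (_ + _).
rewrite base_change_kernel //; last exact: kernel_mx_isotropic0.
rewrite /form0 /form1; set c := v *m YF; set z := c *m M; congr (_ + _).
  by apply: eq_bigr => i _; rewrite disc_even // -ltnS.
rewrite trmx_mul mulmxA mxE.
rewrite (eq_bigr (fun i => (v *m B0F *m (row i OmF)^T) 0 0 * z 0 i)); last first.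
  move=> i _; rewrite [z^T _ _]mxE; congr (_ * _).
  by rewrite -row_mul_tr row_id.
rewrite big_ord_recl pair0_kernel unlift_none mul0r add0r.
by apply: eq_bigr => i _; rewrite pair0_kernel liftK mulrC.
Qed.

Lemma base_change_shear1 (v : 'rV[F]_n) M : base_change iota e q1 (v *m shear M) =
  base_change iota e q1 v + form1 (fun i => a i) M (v *m YF).
Proof.
rewrite /shear mulmxDr mulmx1 base_changeD // !mulmxA -addrA; congr (_ + _).
rewrite base_change_kernel //; last exact: kernel_mx_isotropic1.
rewrite /form0 /form1; set c := v *m YF; set z := c *m M; congr (_ + _).
  by apply: eq_bigr => i _; rewrite disc_odd // -ltnS.
rewrite trmx_mul mulmxA mxE.
rewrite (eq_bigr (fun i => (v *m B1F *m (row i OmF)^T) 0 0 * z 0 i)); last first.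
  move=> i _; rewrite [z^T _ _]mxE; congr (_ * _).
  by rewrite -row_mul_tr row_id.
rewrite big_ord_recr pair1_kernel /= insubF ?ltnn // mul0r addr0.
apply: eq_bigr => i _; rewrite pair1_kernel /= (insubT (fun i => (i < m)%N) (ltn_ord i)) /=.
by rewrite mulrC; congr (_ * c 0 _); apply: val_inj.
Qed.

(** Subtract the multiple of omega that has the same coefficient of degree m at a
    coordinate where omega has degree m: the degree of what remains is too small
    for [kernel_poly_min]. *)
Lemma kernel_seq_unique (u : nat -> 'rV[F]_n) :
  u 0%N *m B0F = 0 -> (forall i, u i.+1 *m B0F = u i *m B1F) ->
  (forall i, (m < i)%N -> u i = 0) ->
  exists lam : F, forall i, u i = lam *: map_mx iota (om i).
Proof.
move=> hu0 hu um; have [i0 hi0] := kernel_coef_last char2 q0_quad q1_quad an_neq0.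
pose lam := u m 0 i0 / iota (kpoly 0 i0)`_m; exists lam.
pose u' i := u i - lam *: map_mx iota (om i).
have u'0 : u' 0%N *m B0F = 0.
  by rewrite mulmxBl hu0 -scalemxAl -map_mxM kernel_coef0 // map_mx0 scaler0 subr0.
have u'S i : u' i.+1 *m B0F = u' i *m B1F.
  by rewrite !mulmxBl hu -!scalemxAl -!map_mxM kernel_coef_rel.
have u'm i : (m < i)%N -> u' i = 0.
  by move=> mi; rewrite /u' um // kernel_coef_ge // map_mx0 scaler0 subr0.
have u'i0 : u' m 0 i0 = 0.
  rewrite /u' !mxE /lam divfK ?subrr // fmorph_eq0 //.
pose v : 'rV[{poly F}]_n := \row_j \poly_(b < m.+1) u' b 0 j.
have cv b j : (v 0 j)`_b = u' b 0 j.
  by rewrite mxE coef_poly; case: ltnP => // /u'm->; rewrite mxE.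
suff v0 : v = 0.
  move=> i; apply/eqP; rewrite -subr_eq0 -/(u' i); apply/eqP/rowP => j.
  by rewrite -cv v0 !mxE coef0.
apply: (kernel_poly_min (iota := iota) char2 q0_quad q1_quad q_reg hi0); last first.
  apply/leq_sizeP => b mb; rewrite cv; move: mb; rewrite leq_eqVlt => /orP[/eqP<-//|/u'm->].
  by rewrite mxE.
apply/rowP => j; apply/polyP => b; rewrite mulmxDr -scalemxAr !mxE coef0 coefD coefXM.
have h q b' : (\sum_l v 0 l * map_mx (polyC \o iota) (gram e q) l j)`_b' =
    (u' b' *m map_mx iota (gram e q)) 0 j.
  rewrite coef_sum [RHS]mxE; apply: eq_bigr => l _.
  by rewrite [map_mx (polyC \o _) _ _ _]mxE coefMC cv [map_mx iota _ _ _]mxE.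
case: b => [|b] /=; first by rewrite addr0 h u'0 mxE.
by rewrite !h u'S addRR.
Qed.

(** An isometry g maps omega to a kernel vector of the same degree, that is to
    lam omega, and lam = 1 as q_1(omega_m) = a_n is preserved.  So g fixes every
    omega_i and, preserving b_1, every y_j; then g - 1 vanishes on the omega_i and
    has its image in the common kernel of the y_j. *)
Lemma aut_shear (g : 'M[F]_n) : preserves iota e q0 q1 g -> exists M, g = shear M.
Proof.
case/andP => gU /boolp.asboolP gP.
have gB q : quadratic_form q ->
    (forall v, base_change iota e q (v *m g) = base_change iota e q v) ->
    g *m map_mx iota (gram e q) *m g^T = map_mx iota (gram e q).
  move=> qq hq; apply/matrixP => i j.
  have form (A : 'M[F]_n) : A i j = ((delta_mx 0 i : 'rV_n) *m A *m (delta_mx 0 j : 'rV_n)^T) 0 0.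
    by rewrite trmx_delta -rowE -colE !mxE.
  rewrite [LHS]form [RHS]form; set d := delta_mx 0 i; set d' := delta_mx 0 j.
  transitivity ((d *m g *m map_mx iota (gram e q) *m (d' *m g)^T) 0 0).
    by rewrite trmx_mul !mulmxA.
  by rewrite -!base_change_polar // /polar -mulmxDl !hq.
have gB0 := gB _ q0_quad (fun v => (gP v).1).
have gB1 := gB _ q1_quad (fun v => (gP v).2).
have gTU : g^T \in unitmx by rewrite unitmx_tr.
have gBV q : g *m map_mx iota (gram e q) *m g^T = map_mx iota (gram e q) ->
    g *m map_mx iota (gram e q) = map_mx iota (gram e q) *m invmx g^T.
  by move=> {2}<-; rewrite mulmxK.
have [lam hlam] : exists lam, forall i, map_mx iota (om i) *m g = lam *: map_mx iota (om i).
  apply: kernel_seq_unique => [|i|i mi].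
  - by rewrite -mulmxA (gBV q0) // mulmxA -map_mxM kernel_coef0 // map_mx0 mul0mx.
  - by rewrite -!mulmxA (gBV q0) // (gBV q1) // !mulmxA -!map_mxM kernel_coef_rel.
  - by rewrite kernel_coef_ge // map_mx0 mul0mx.
have lam1 : lam = 1.
  have := (gP (map_mx iota (om m))).2; rewrite hlam base_changeZ.
  rewrite (base_change_map (i1 := idfun) _ _ _ (fun=> erefl)) -disc_odd //.
  move/eqP; rewrite -subr_eq0 -[X in _ - X]mul1r -mulrBl mulf_eq0 fmorph_eq0 (negPf an_neq0) orbF.
  rewrite (oppr_pchar2 charF) -[X in _ + X](expr1n _ 2).
  have -> : lam ^+ 2 + 1 ^+ 2 = (lam + 1) ^+ 2 by rewrite sqrrD mulr2n addRR addr0.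
  by rewrite sqrf_eq0 addr_eq0 (oppr_pchar2 charF) => /eqP.
have Omg : OmF *m g = OmF.
  by apply/row_matrixP => i; rewrite row_mul -map_row row_kernel_mx hlam lam1 scale1r.
have gY : g *m YF = YF.
  apply: trmx_inj; apply/row_matrixP => i; rewrite trmx_mul row_mul.
  have -> : row i YF^T = map_mx iota (om i) *m B1F.
    by rewrite map_trmx -map_row trmxK rowK map_mxM.
  have omg : map_mx iota (om i) *m g = map_mx iota (om i) by rewrite hlam lam1 scale1r.
  by rewrite -{1}omg -2!mulmxA (mulmxA g) gB1.
have : (g - 1%:M) *m YF = 0 by rewrite mulmxBl gY mul1mx subrr.
case/dual_kernelP => z hz.
have : OmF *m z = 0.
  apply/eqP; rewrite -(mulmx_free_eq0 _ kernel_mx_freeF) -mulmxA -hz mulmxBr Omg mulmx1 subrr.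
  by [].
case/kernel_dualP => M hM; exists M.
by rewrite /shear -hM -hz addrC subrK.
Qed.

Let a_gt i : (n < i)%N -> a i = 0.
Proof. by move=> ni; rewrite disc_gt // rmorph0. Qed.

Lemma aut_hankel (m_gt0 : (0 < m)%N) (g : 'M[F]_n) : preserves iota e q0 q1 g ->
  exists2 h, g = shear (hankel m h) & forall p, (p < m.*2)%N -> wp m (fun i => a i) h p = 0.
Proof.
move=> gP; have [M gM] := aut_shear gP; have [S hS] := dual_mx_onto.
case/andP: gP => gU /boolp.asboolP gP.
have [||h Mh hh] := @hankelP _ charF m _ a_gt M (fun=> 0).
- move=> c; rewrite big1 => [|j _]; last by rewrite mulr0.
  have := base_change_shear0 (c *m S) M; rewrite -gM (gP _).1 -[LHS]addr0 => /addrI.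
  by rewrite -mulmxA hS mulmx1.
- move=> c; rewrite big1 => [|j _]; last by rewrite mulr0.
  have := base_change_shear1 (c *m S) M; rewrite -gM (gP _).2 -[LHS]addr0 => /addrI.
  by rewrite -mulmxA hS mulmx1.
by exists h; rewrite ?gM ?Mh.
Qed.

Lemma hankel_preserves h : (forall p, (p < m.*2)%N -> wp m (fun i => a i) h p = 0) ->
  preserves iota e q0 q1 (shear (hankel m h)).
Proof.
move=> hh; rewrite /preserves shear_unit; apply/boolp.asboolP => v.
rewrite base_change_shear0 base_change_shear1 form0_hankel // form1_hankel //.
rewrite !big1 ?addr0 // => j _; rewrite hh ?mulr0 //; have := ltn_ord j; lia.
Qed.

End Extension.
End KernelMatrices.

(** * The dual basis at a root of the half-discriminant *)

Lemma convolution_char2 (k : comNzRingType) (char2 : 2%N \in [pchar k]) (a : nat -> k) N :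
  \sum_(i < N.+1) a i * a (N - i)%N = if odd N then 0 else a N./2 ^+ 2.
Proof.
pose p := \poly_(i < N.+1) a i.
have -> : \sum_(i < N.+1) a i * a (N - i)%N = (p ^+ 2)`_N.
  rewrite expr2 coefM; apply: eq_bigr => i _; rewrite !coef_poly ltn_ord.
  by rewrite ltnS leq_subr.
have cp : 2%N \in [pchar {poly k}] by exact: (rmorph_pchar polyC char2).
rewrite /p poly_def (sqr_sum_char2 cp) coef_sum.
have E i : ((a i *: 'X^i) ^+ 2)`_N = if (N == i.*2)%N then a i ^+ 2 else 0.
  by rewrite exprZn -exprM muln2 coefZ coefXn; case: eqP; rewrite ?mulr1 ?mulr0.
under eq_bigr => i _ do rewrite E.
case: ifP => oN.
  by rewrite big1 // => i _; case: eqP => // Ni; rewrite Ni odd_double in oN.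
have jm : (N./2 < N.+1)%N by lia.
rewrite (bigD1 (Ordinal jm)) //= even_halfK ?oN // eqxx big1 ?addr0 // => i ni.
by case: eqP => // Ni; case/eqP: ni; apply: val_inj => /=; lia.
Qed.

Section DualSequence.
Variables (k R : comNzRingType) (char2 : 2%N \in [pchar k]) (iota : {rmorphism k -> R}).
Variables (a : nat -> k) (N : nat) (theta : R).
Hypothesis a_gt : forall i, (N < i)%N -> a i = 0.
Hypothesis theta_root : \sum_(i < N.+1) iota (a i) * theta ^+ i = 0.

(** The elements d_l, at a root theta of f in any ring. *)
Definition dual_seq (l : nat) : R := \sum_(j < N - l) iota (a (l + j).+1) * theta ^+ j.
Local Notation d := dual_seq.

Let charR : 2%N \in [pchar R] := rmorph_pchar iota char2.
Let addRR (x : R) : x + x = 0 := addrr_pchar2 charR x.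

Lemma dual_seq_ge l : (N <= l)%N -> d l = 0.
Proof. by rewrite -subn_eq0 /d => /eqP->; rewrite big_ord0. Qed.

Lemma dual_seq_rec l : d l = theta * d l.+1 + iota (a l.+1).
Proof.
have [Nl|lN] := leqP N l.
  by rewrite !dual_seq_ge // ?(leqW Nl) // a_gt // rmorph0 mulr0 addr0.
rewrite /d -(subnSK lN) big_ord_recl addn0 mulr1 addrC; congr (_ + _).
by rewrite mulr_sumr; apply: eq_bigr => i _; rewrite lift0 exprS addSnnS; ring.
Qed.

Lemma dual_seq0 : theta * d 0 = iota (a 0).
Proof.
apply/eqP; rewrite -subr_eq0 (oppr_pchar2 charR) addrC -theta_root big_ord_recl mulr1.
rewrite /d subn0 mulr_sumr; apply/eqP; congr (_ + _); apply: eq_bigr => i _.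
by rewrite lift0 exprS add0n; ring.
Qed.

(** Descending induction on l.  Multiply the identity for l + 1 by theta ^ 2 and
    use theta d_(p+1) = d_p + a_(p+1): besides the identity for l there remain two
    convolutions of the sequence a with itself, of index 2l+2, which is the square of
    a_(l+1), and of index 2l+3, which is zero. *)
Lemma dual_seq_sqr l : d l ^+ 2 = \sum_(p < l.*2.+2) iota (a (l.*2.+1 - p)%N) * d p.
Proof.
have [M] := ubnP (N - l); elim: M l => // M IH l.
have [Nl _|lN lM] := leqP N l.
  rewrite dual_seq_ge // expr0n big1 // => p _.
  have [Np|pN] := leqP N p; first by rewrite dual_seq_ge ?mulr0.
  by rewrite a_gt ?rmorph0 ?mul0r //; lia.
have /IH {IH} IH : (N - l.+1 < M)%N by lia.
have mul_d p : theta * d p.+1 = d p + iota (a p.+1).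
  by rewrite [d p]dual_seq_rec -addrA addRR addr0.
rewrite dual_seq_rec sqrrD mulr2n addRR addr0 exprMn IH.
have C1 := convolution_char2 char2 a l.+1.*2.
have C2 := convolution_char2 char2 a l.+1.*2.+1.
move: C1 C2; rewrite /= odd_double /= doubleK doubleS.
rewrite big_ord_recl /= [X in _ -> X = _ -> _]big_ord_recl big_ord_recl /=.
rewrite /bump /= !add1n !subSS !subn0.
set S1 := \sum_(i < _) _; set S2 := \sum_(i < _) _ => C1 C2.
have -> : \sum_(p < l.*2.+4) iota (a (l.*2.+3 - p)%N) * d p =
  iota (a l.*2.+3) * d 0 + (iota (a l.*2.+2) * d 1 +
    \sum_(p < l.*2.+2) iota (a (l.*2.+1 - p)%N) * d p.+2).
  rewrite !big_ord_recl /= /bump /= !add1n !subSS !subn0.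
  by congr (_ + (_ + _)); apply: eq_bigr => p _; rewrite !add1n !subSS.
have E : theta ^+ 2 * \sum_(p < l.*2.+2) iota (a (l.*2.+1 - p)%N) * d p.+2 =
    \sum_(p < l.*2.+2) iota (a (l.*2.+1 - p)%N) * d p + iota S1 + theta * iota S2.
  rewrite /S1 /S2 !rmorph_sum !mulr_sumr -!big_split; apply: eq_bigr => p _ /=.
  rewrite !add1n !rmorphM subSS.
  transitivity (iota (a (l.*2.+1 - p)%N) * (theta * (theta * d p.+2))); first by ring.
  by rewrite mul_d mulrDr mul_d; ring.
rewrite !mulrDr E -rmorphXn -C1.
transitivity (\sum_(p < l.*2.+2) iota (a (l.*2.+1 - p)%N) * d p +
   theta * iota (a 0%N * a l.*2.+3 + (a 1%N * a l.*2.+2 + S2))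
   + (iota (a 0%N * a l.*2.+2 + S1) + iota (a 0%N * a l.*2.+2 + S1))); last first.
  by rewrite addRR addr0 C2 rmorph0 mulr0 addr0.
have h0 : theta ^+ 2 * (iota (a l.*2.+3) * d 0) = theta * (iota (a 0) * iota (a l.*2.+3)).
  by rewrite -dual_seq0; ring.
have h1 : theta ^+ 2 * (iota (a l.*2.+2) * d 1) =
    iota (a 0) * iota (a l.*2.+2) + theta * (iota (a 1) * iota (a l.*2.+2)).
  transitivity (theta * iota (a l.*2.+2) * (theta * d 1)); first by ring.
  by rewrite mul_d mulrDr -dual_seq0; ring.
by rewrite h0 h1 !rmorphD !rmorphM; ring.
Qed.

End DualSequence.

Lemma sum_ord_trunc (R : nmodType) (F : nat -> R) M M' :
  (forall p, (M <= p)%N -> F p = 0) -> (forall p, (M' <= p)%N -> F p = 0) ->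
  \sum_(p < M) F p = \sum_(p < M') F p.
Proof.
wlog lMM : M M' / (M <= M')%N => [hw hM hM'|hM _].
  by case/orP: (leq_total M M') => l; [|symmetry]; apply: hw.
rewrite -(big_mkord xpredT F) -[RHS](big_mkord xpredT F) (@big_cat_nat _ _ _ M 0 M') //=.
by rewrite [X in _ = _ + X]big_nat [X in _ = _ + X]big1 ?addr0 // => p /andP[/hM].
Qed.

(** The constant term of s ^ 2 + s: the coordinate on d_2m = a_n. *)
Definition wp_const (k : fieldType) (m : nat) (a h : nat -> k) : k :=
  (h m.*2 + \sum_(l < m.*2.+1)
     (if (m.*2 <= l.*2.+1)%N then a (l.*2.+1 - m.*2)%N else 0) * h l ^+ 2) * a m.*2.+1.

Lemma dual_seq_wp (k : fieldType) (R : comNzRingType) (char2 : 2%N \in [pchar k])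
    (iota : {rmorphism k -> R}) (m : nat) (a : nat -> k) (theta : R) (h : nat -> k) :
  (forall i, (m.*2.+1 < i)%N -> a i = 0) ->
  \sum_(i < m.*2.+2) iota (a i) * theta ^+ i = 0 ->
  let d := dual_seq iota a m.*2.+1 theta in
  let s := \sum_(l < m.*2.+1) iota (h l) * d l in
  s ^+ 2 + s = \sum_(p < m.*2) iota (wp m a h p) * d p + iota (wp_const m a h).
Proof.
move=> a_gt root /=; set d := dual_seq _ _ _ _; set n := m.*2.+1.
have charR : 2%N \in [pchar R] := rmorph_pchar iota char2.
pose b p l := if (p <= l.*2.+1)%N then a (l.*2.+1 - p)%N else 0.
have dE l : d l ^+ 2 = \sum_(p < n) iota (b p l) * d p.
  rewrite dual_seq_sqr //.
  transitivity (\sum_(p < l.*2.+2) iota (b p l) * d p).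
    by apply: eq_bigr => p _; rewrite /b -ltnS ltn_ord.
  apply: (@sum_ord_trunc _ (fun p => iota (b p l) * d p)) => p hp.
    by rewrite /b leqNgt hp rmorph0 mul0r.
  by rewrite /d dual_seq_ge ?mulr0.
pose g p := h p + \sum_(l < n) b p l * h l ^+ 2.
have -> : (\sum_(l < n) iota (h l) * d l) ^+ 2 + \sum_(l < n) iota (h l) * d l =
    \sum_(p < n) iota (g p) * d p.
  rewrite (sqr_sum_char2 charR).
  under eq_bigr => l _ do rewrite exprMn dE mulr_sumr.
  rewrite exchange_big -big_split; apply: eq_bigr => p _ /=.
  rewrite /g rmorphD mulrDl addrC; congr (_ + _).
  rewrite rmorph_sum mulr_suml; apply: eq_bigr => l _.
  by rewrite rmorphM rmorphXn; ring.
rewrite /wp_const -/n /n big_ord_recr /=; congr (_ + _).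
  apply: eq_bigr => p _; congr (iota (_ + _) * _).
  by rewrite big_ord_recr /= /b a_gt ?if_same ?mul0r ?addr0 //; have := ltn_ord p; lia.
rewrite rmorphM; congr (_ * _).
by rewrite /d /dual_seq subSnn big_ord_recl big_ord0 addr0 mulr1 addn0.
Qed.

Section DualPoly.
Variables (F : fieldType) (a : nat -> F) (N : nat).
Hypothesis aN : a N != 0.

Definition dual_poly (l : nat) : {poly F} := \poly_(j < N - l) a (l + j).+1.

Let H : 'M[F]_N := \matrix_(l, j) (dual_poly l)`_j.

Lemma size_dual_poly l : (size (dual_poly l) <= N)%N.
Proof. by apply: leq_trans (size_poly _ _) _; rewrite leq_subr. Qed.

(** The top degrees N - 1 - l of these polynomials are distinct, with the same
    leading coefficient a N. *)
Lemma dual_poly_free (c : nat -> F) : \sum_(l < N) c l *: dual_poly l = 0 ->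
  forall l, (l < N)%N -> c l = 0.
Proof.
move=> hc l; have [M] := ubnP l; elim: M l => // M IH l lM lN.
have /polyP/(_ (N - l.+1)%N) := hc; rewrite coef0 coef_sum (bigD1 (Ordinal lN)) //=.
rewrite big1 => [|i nil]; last first.
  rewrite coefZ; have [il|li|il] := ltngtP i l; last by case/eqP: nil; apply: val_inj.
    by rewrite IH ?mul0r //; lia.
  rewrite coef_poly ltnNge leq_sub2l ?mulr0 //.
rewrite addr0 coefZ coef_poly ltn_sub2l //; have -> : (l + (N - l.+1)).+1 = N by lia.
by move/eqP; rewrite mulf_eq0 (negPf aN) orbF => /eqP.
Qed.

Lemma dual_poly_span (p : {poly F}) : (size p <= N)%N ->
  exists c : nat -> F, p = \sum_(l < N) c l *: dual_poly l.
Proof.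
move=> sp.
have Hfree : row_free H.
  apply: inj_row_free => v hv; apply/rowP => l; rewrite mxE.
  pose c i := if insub i is Some j then v 0 j else 0.
  have cE (i : 'I_N) : c i = v 0 i by rewrite /c valK.
  rewrite -cE; apply: dual_poly_free => //.
  apply/polyP => j; rewrite coef0 coef_sum.
  have [jN|Nj] := ltnP j N; last first.
    rewrite big1 // => i _; rewrite coefZ nth_default ?mulr0 //.
    exact: leq_trans (size_dual_poly i) Nj.
  move/rowP: hv => /(_ (Ordinal jN)); rewrite !mxE => hv; apply: etrans hv.
  by apply: eq_bigr => i _; rewrite coefZ mxE cE.
have Hu : H \in unitmx by rewrite -row_free_unit.
pose v := (\row_(j < N) p`_j) *m invmx H.
pose c i := if insub i is Some j then v 0 j else 0.
have cE (i : 'I_N) : c i = v 0 i by rewrite /c valK.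
exists c; apply/polyP => j; rewrite coef_sum.
have [jN|Nj] := ltnP j N; last first.
  rewrite nth_default ?(leq_trans sp) // big1 // => i _; rewrite coefZ nth_default ?mulr0 //.
  exact: leq_trans (size_dual_poly i) Nj.
have : (v *m H) 0 (Ordinal jN) = p`_j by rewrite mulmxKV // mxE.
rewrite mxE => <-; apply: eq_bigr => i _; by rewrite coefZ cE [H _ _]mxE.
Qed.

Lemma horner_dual_poly l x : (dual_poly l).[x] = dual_seq idfun a N x l.
Proof. by rewrite horner_poly. Qed.

End DualPoly.

Lemma interpolation (F : fieldType) (rs : seq F) (s : F -> F) : uniq rs ->
  exists2 p : {poly F}, (size p <= size rs)%N & {in rs, forall x, p.[x] = s x}.
Proof.
elim: rs => [|r rs IH] /=; first by exists 0; rewrite ?size_poly0.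
case/andP=> rrs /IH[p sp hp]; pose w := \prod_(x <- rs) ('X - x%:P).
have wr : w.[r] != 0 by rewrite -[_ == 0]/(root w r) root_prod_XsubC.
exists (p + ((s r - p.[r]) / w.[r]) *: w).
  apply: leq_trans (size_polyD _ _) _; rewrite geq_max (leq_trans sp) //=.
  by apply: leq_trans (size_scale_leq _ _) _; rewrite size_prod_XsubC.
move=> x; rewrite inE hornerD hornerZ => /orP[/eqP->|xrs].
  by rewrite divfK // addrC subrK.
have /rootP-> : root w x by rewrite root_prod_XsubC.
by rewrite mulr0 addr0 hp.
Qed.

Definition separably_closed (K : fieldType) :=
  forall p : {poly K}, (1 < size p)%N -> separable_poly p -> exists x, root p x.

Lemma separable_split (K : fieldType) (p : {poly K}) : separably_closed K -> separable_poly p ->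
  exists rs : seq K, [/\ uniq rs, size rs = (size p).-1 & all (root p) rs].
Proof.
move=> Kc; have [N] := ubnP (size p); elim: N p => // N IH p pN sp.
have [p1|p1] := leqP (size p) 1.
  by exists [::]; split => //; case: (size p) p1 => [|[]].
have [x px] := Kc p p1 sp; have [q pE] := factor_theorem _ _ px.
move: sp; rewrite pE separable_root => /andP[sq nqx].
have q0 : q != 0 by apply: contraNneq nqx => ->; rewrite root0.
have spq : size p = (size q).+1 by rewrite pE size_mul ?polyXsubC_eq0 // size_XsubC addn2.
have [|rs [urs srs ars]] := IH q _ sq; first by rewrite -ltnS -spq.
exists (x :: rs); split => /=.
- by rewrite urs andbT; apply: contraNN nqx => /(allP ars).
- by rewrite srs size_mul ?polyXsubC_eq0 // size_XsubC addn2 /= prednK // size_poly_gt0.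
rewrite rootM root_XsubC eqxx orbT; apply: sub_all ars => y.
by rewrite rootM => ->.
Qed.

Lemma artin_schreier_root (K : fieldType) (char2 : 2%N \in [pchar K]) (c : K) :
  separably_closed K -> exists x, x ^+ 2 + x = c.
Proof.
move=> Kc; pose p : {poly K} := 'X^2 + ('X + c%:P).
have cp : 2%N \in [pchar {poly K}] := rmorph_pchar polyC char2.
have sp : size p = 3.
  by rewrite size_polyDl size_polyXn // size_XaddC.
have dp : p^`() = 1.
  by rewrite !derivD derivXn derivX derivC addr0 expr1 mulr2n (addrr_pchar2 cp) add0r.
have [||x] := Kc p; first by rewrite sp.
  by rewrite unlock dp coprimep1.
rewrite /root !hornerD hornerXn hornerX hornerC addrA addr_eq0 (oppr_pchar2 char2) => /eqP.
by exists x.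
Qed.

(** At each root of f the equation s ^ 2 + s = r is an Artin-Schreier equation,
    which has a solution.  As f is separable, the solutions at its n roots are the
    values of one polynomial s of degree less than n. *)
Lemma wp_onto (K : fieldType) (char2 : 2%N \in [pchar K]) (Kc : separably_closed K)
    (m : nat) (f : {poly K}) (r : nat -> K) : size f = m.*2.+2 -> separable_poly f ->
  exists h, forall p, (p < m.*2)%N -> wp m (fun i => f`_i) h p = r p.
Proof.
move=> sf sepf; set n := m.*2.+1; pose a i := f`_i.
have a_gt i : (n < i)%N -> a i = 0 by move=> ni; rewrite /a nth_default // sf.
have aN : a n != 0.
  by rewrite /a -[n]/(n.+1.-1) -sf -/(lead_coef f) lead_coef_eq0 -size_poly_gt0 sf.
have [rs [urs srs ars]] := separable_split Kc sepf.
rewrite sf /= in srs.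
pose d := dual_seq idfun a n.
have [s hs] : exists s : K -> K, forall x, s x ^+ 2 + s x = \sum_(l < m.*2) r l * d x l.
  have [s hs] := choice (fun c => artin_schreier_root char2 c Kc).
  by exists (fun x => s (\sum_(l < m.*2) r l * d x l)).
have [p sp hp] := interpolation s urs; rewrite srs in sp.
have [h ph] := dual_poly_span aN sp.
pose g l := if (l < m.*2)%N then wp m a h l + r l else wp_const m a h / a n.
suff g0 : \sum_(l < n) g l *: dual_poly a n l = 0.
  exists h => l lm; have := dual_poly_free aN g0 (leqW lm).
  by rewrite /g lm => /eqP; rewrite addr_eq0 (oppr_pchar2 char2) => /eqP.
apply: (@roots_geq_poly_eq0 _ _ rs) => //; last first.
  rewrite srs; apply: leq_trans (size_sum _ _ _) _; apply/bigmax_leqP => i _.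
  exact: leq_trans (size_scale_leq _ _) (size_dual_poly _ _ _).
apply/allP => x xrs; apply/rootP; rewrite horner_sum.
have ft : \sum_(i < n.+1) idfun (a i) * x ^+ i = 0.
  by have /rootP := allP ars x xrs; rewrite horner_coef sf.
have sx : s x = \sum_(l < n) idfun (h l) * d x l.
  rewrite -hp // ph horner_sum; apply: eq_bigr => l _.
  by rewrite hornerZ horner_dual_poly.
have := dual_seq_wp char2 h a_gt ft; rewrite -/n -/(d x) /= -sx hs => E.
rewrite big_ord_recr /= hornerZ horner_dual_poly /g ltnn.
have -> : dual_seq idfun a n x m.*2 = a n.
  by rewrite /dual_seq subSnn big_ord_recl big_ord0 addr0 mulr1 addn0.
rewrite divfK //.
have -> : \sum_(i < m.*2) (g i *: dual_poly a n i).[x] =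
   \sum_(i < m.*2) wp m a h i * d x i + \sum_(i < m.*2) r i * d x i.
  rewrite -big_split; apply: eq_bigr => i _ /=.
  by rewrite hornerZ horner_dual_poly /g ltn_ord mulrDl.
by rewrite E addrA (addrr_pchar2 char2) add0r (addrr_pchar2 char2).
Qed.

(** * The algebra A *)

Lemma in_qpolyM (R : comNzRingType) (h p q : {poly R}) :
  in_qpoly h (p * q) = in_qpoly h p * in_qpoly h q.
Proof.
have hM := monic_mk_monic h; apply: val_inj; rewrite /=.
by rewrite Pdiv.RingMonic.rmodp_mulml // Pdiv.RingMonic.rmodp_mulmr.
Qed.

Lemma in_qpolyXn (R : comNzRingType) (h : {poly R}) i :
  in_qpoly h 'X^i = in_qpoly h 'X ^+ i.
Proof.
elim: i => [|i IH]; last by rewrite !exprS in_qpolyM IH.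
apply: val_inj; rewrite /= expr0 Pdiv.CommonRing.rmodp_small //.
by rewrite size_poly1 size_mk_monic_gt1.
Qed.

Lemma qpolyC_mul (R : comNzRingType) (h : {poly R}) c (x : {poly %/ h}) :
  qpolyC h c * x = c *: x.
Proof.
apply: val_inj; rewrite /= mul_polyC.
rewrite Pdiv.CommonRing.rmodp_small //.
exact: leq_ltn_trans (size_scale_leq _ _) (size_mk_monic x).
Qed.

Section Algebra.
Variables (k : fieldType) (char2 : 2%N \in [pchar k]) (m : nat).
Local Notation n := m.*2.+1.
Variables (E : vectType k) (e : n.-tuple E) (q0 q1 : E -> k).
Hypotheses (q0_quad : quadratic_form q0) (q1_quad : quadratic_form q1).
Hypothesis an_neq0 : (disc_poly e q0 q1)`_n != 0.

Local Notation disc := (disc_poly e q0 q1).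
Local Notation discM := (disc_monic e q0 q1).
Local Notation algA := {poly %/ discM}.
Local Notation a := (fun i => disc`_i).
Local Notation scal := (alg_scal e q0 q1).
Local Notation d := (alg_d e q0 q1).

Let size_disc : size disc = n.+1 := disc_size char2 q0_quad q1_quad an_neq0.
Let a_gt i : (n < i)%N -> disc`_i = 0.
Proof. by move=> ni; rewrite nth_default // size_disc. Qed.

Lemma lead_disc : lead_coef disc != 0.
Proof. by rewrite lead_coef_eq0 -size_poly_gt0 size_disc. Qed.

Lemma mk_monic_disc : mk_monic discM = discM.
Proof.
have sM : size discM = n.+1 by rewrite size_scale ?invr_eq0 ?lead_disc.
by rewrite /mk_monic sM /= monicE lead_coefZ mulVf ?eqxx // lead_disc.
Qed.

Lemma size_mk_monic_disc : size (mk_monic discM) = n.+1.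
Proof. by rewrite mk_monic_disc size_scale ?invr_eq0 ?lead_disc. Qed.

Lemma in_qpoly_poly b (p : nat -> k) : in_qpoly discM (\poly_(j < b) p j) =
  \sum_(j < b) scal (p j) * algT e q0 q1 ^+ j.
Proof.
rewrite poly_def linear_sum; apply: eq_bigr => j _.
by rewrite linearZ /= in_qpolyXn qpolyC_mul.
Qed.

Lemma alg_d_poly l : d l = in_qpoly discM (dual_poly a n l).
Proof.
rewrite in_qpoly_poly; apply: eq_bigr => j _; congr (scal _ * _).
by rewrite disc_coefE //; have := ltn_ord j; lia.
Qed.

Lemma alg_d_seq l : d l = dual_seq (qpolyC discM) a n (algT e q0 q1) l.
Proof.
apply: eq_bigr => j _; congr (scal _ * _).
by rewrite disc_coefE //; have := ltn_ord j; lia.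
Qed.

Lemma algT_root : \sum_(i < n.+1) qpolyC discM (disc`_i) * algT e q0 q1 ^+ i = 0.
Proof.
rewrite -(in_qpoly_poly n.+1 (fun i => disc`_i)).
have -> : \poly_(j < n.+1) disc`_j = lead_coef disc *: discM.
  rewrite scalerA mulfV ?lead_disc // scale1r -size_disc.
  by apply/polyP => i; rewrite coef_poly; case: ltnP => // si; rewrite nth_default.
rewrite linearZ /= (_ : in_qpoly _ _ = 0) ?scaler0 //; apply: val_inj => /=.
rewrite mk_monic_disc Pdiv.RingMonic.rmodpp // -mk_monic_disc; exact: monic_mk_monic.
Qed.

Lemma alg_basis (x : algA) : exists c : nat -> k, x = \sum_(l < n) scal (c l) * d l.
Proof.
have sx : (size (x : {poly k}) <= n)%N by rewrite -ltnS -size_mk_monic_disc size_mk_monic.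
have [c hc] := dual_poly_span (a := a) an_neq0 sx; exists c.
have -> : x = in_qpoly discM (x : {poly k}).
  by apply: val_inj; rewrite /= Pdiv.CommonRing.rmodp_small // size_mk_monic.
rewrite hc linear_sum; apply: eq_bigr => l _.
by rewrite linearZ /= alg_d_poly qpolyC_mul.
Qed.

Lemma alg_free (c : nat -> k) : \sum_(l < n) scal (c l) * d l = 0 ->
  forall l, (l < n)%N -> c l = 0.
Proof.
move=> hc; apply: (dual_poly_free (a := a) an_neq0).
have : in_qpoly discM (\sum_(l < n) c l *: dual_poly a n l) = 0.
  rewrite -[RHS]hc linear_sum; apply: eq_bigr => l _.
  by rewrite linearZ /= alg_d_poly qpolyC_mul.
move/(congr1 val); rewrite /= Pdiv.CommonRing.rmodp_small // size_mk_monic_disc ltnS.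
apply: leq_trans (size_sum _ _ _) _; apply/bigmax_leqP => i _.
exact: leq_trans (size_scale_leq _ _) (size_dual_poly _ _ _).
Qed.

Lemma alg_d_last : d m.*2 = scal (disc`_n).
Proof.
by rewrite alg_d_seq /dual_seq subSnn big_ord_recl big_ord0 addr0 mulr1 addn0.
Qed.

Lemma alg_sqr_add (h : nat -> k) : let s := \sum_(l < n) scal (h l) * d l in
  s ^+ 2 + s = \sum_(p < m.*2) scal (wp m a h p) * d p + scal (wp_const m a h).
Proof.
have hs := dual_seq_wp char2 h a_gt algT_root.
have dE : d =1 dual_seq (qpolyC discM) a n (algT e q0 q1) by exact: alg_d_seq.
have sumE M (g : nat -> k) : \sum_(l < M) scal (g l) * d l =
    \sum_(l < M) qpolyC discM (g l) * dual_seq (qpolyC discM) a n (algT e q0 q1) l.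
  by apply: eq_bigr => l _; rewrite dE.
by rewrite /= (sumE n h) (sumE m.*2 (wp m a h)) hs.
Qed.

(** The d_l with l < 2m are a basis of A modulo the constants, on which the
    Artin-Schreier map is [wp]. *)
Lemma wp_add_scalP (c : nat -> k) :
  reflect (exists h, forall p, (p < m.*2)%N -> wp m a h p = c p)
    ((\sum_(l < n) scal (c l) * d l) \in @wp_add_scal k m E e q0 q1 char2).
Proof.
have scalD x y : scal (x + y) = scal x + scal y by exact: qpolyCD.
have scalB x y : scal (x - y) = scal x - scal y by exact: raddfB.
have scalM x y : scal (x * y) = scal x * scal y by exact: qpolyCM.
apply: (iffP (asboolP _)) => [[s [cst]]|[h hh]].
  have [h ->] := alg_basis s; rewrite alg_sqr_add => hs; exists h => p pm.
  pose g l := if (l < m.*2)%N then c l - wp m a h l else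
      c l - (wp_const m a h + cst) / disc`_n.
  have g0 : \sum_(l < n) scal (g l) * d l = 0.
    rewrite big_ord_recr /= /g ltnn scalB mulrBl alg_d_last -[_ (_ / _) * _]scalM divfK //.
    rewrite scalD.
    under eq_bigr => l _ do rewrite ltn_ord scalB mulrBl.
    rewrite sumrB; move: hs; rewrite big_ord_recr /= alg_d_last => hs.
    by apply/eqP; rewrite addrACA -opprD subr_eq0 hs addrA.
  have := alg_free g0 (leqW pm); rewrite /g pm => /eqP; rewrite subr_eq0 => /eqP ->.
  by [].
pose s := \sum_(l < n) scal (h l) * d l.
exists s, (c m.*2 * disc`_n - wp_const m a h).
rewrite alg_sqr_add scalB big_ord_recr /= alg_d_last -scalM.
rewrite -[RHS]addrA [X in _ = _ + X]addrC subrK; congr (_ + _).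
by apply: eq_bigr => l _; rewrite hh.
Qed.

Lemma r_invariantE (r : (m.*2).-tuple k) :
  r_invariant e q0 q1 r = \sum_(l < n) scal (if (l < m.*2)%N then r`_l else 0) * d l.
Proof.
rewrite big_ord_recr /= ltnn.
have -> : scal 0 = 0 by exact: qpolyC0.
by rewrite mul0r addr0; apply: eq_bigr => l _; rewrite ltn_ord.
Qed.

End Algebra.

(** * Galois theory of a separable closure *)

Section PartialEmbeddings.
Variables (k K : fieldType) (iota : {rmorphism k -> K}).

(** Homomorphisms over k from subalgebras of K to K, as subrings of K * K: the
    union of a chain of such graphs is again one. *)
Definition graph_embedding (G : set (K * K)) : Prop :=
  [/\ forall a, G (iota a, iota a),
      forall x y, G x -> G y -> G (x.1 - y.1, x.2 - y.2),
      forall x y, G x -> G y -> G (x.1 * y.1, x.2 * y.2)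
    & forall b, G (0, b) -> b = 0].

Lemma poly_graph (L : comNzRingType) (j : {rmorphism k -> L}) (f1 f2 : {rmorphism L -> K})
    (z z' : K) : (forall a, f1 (j a) = iota a) -> (forall a, f2 (j a) = iota a) ->
  (forall Q, (map_poly f1 Q).[z] = 0 -> (map_poly f2 Q).[z'] = 0) ->
  graph_embedding (fun p => exists Q, p = ((map_poly f1 Q).[z], (map_poly f2 Q).[z'])).
Proof.
move=> f1j f2j hz; split.
- by move=> a; exists (j a)%:P; rewrite !map_polyC !hornerC /= f1j f2j.
- by move=> _ _ [P ->] [Q ->]; exists (P - Q); rewrite !rmorphB !hornerD !hornerN.
- by move=> _ _ [P ->] [Q ->]; exists (P * Q); rewrite !rmorphM !hornerM.
by move=> b [Q [h ->]]; exact: hz.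
Qed.

Lemma root_generator (L : fieldType) (f : {rmorphism L -> K}) (z : K) (p : {poly L}) :
  p != 0 -> root (map_poly f p) z ->
  exists g : {poly L}, [/\ g != 0, root (map_poly f g) z
    & forall Q, root (map_poly f Q) z -> g %| Q].
Proof.
move=> p0 pz.
pose S N := `[< exists g : {poly L}, [/\ g != 0, root (map_poly f g) z & size g = N] >].
have exS : exists N, S N by exists (size p); apply/asboolP; exists p.
case: (ex_minnP exS) => N /asboolP[g [g0 gz sg]] gmin; exists g; split=> // Q Qz.
have rz : root (map_poly f (Q %% g)) z.
  move: Qz; rewrite {1}(divp_eq Q g) rmorphD rmorphM /= /root hornerD hornerM (rootP gz).
  by rewrite mulr0 add0r.
apply: contraT => r0.
have : S (size (Q %% g)) by apply/asboolP; exists (Q %% g).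
by move/gmin; rewrite -sg leqNgt ltn_modp g0.
Qed.

Section GraphField.
Variable (G : set (K * K)).
Hypothesis Gemb : graph_embedding G.
Hypothesis K_alg : forall x : K, exists2 p : {poly k}, p != 0 & root (map_poly iota p) x.

Lemma alg_nonzero_const (x : K) : x != 0 ->
  exists2 p : {poly k}, p`_0 != 0 & root (map_poly iota p) x.
Proof.
move=> x0; have [p p0 px] := K_alg x.
have [N] := ubnP (size p); elim: N p p0 px => // N IH p p0 px sp.
have [c0|] := eqVneq p`_0 0; last by exists p.
have pE : p = drop_poly 1 p * 'X.
  rewrite -[LHS](poly_take_drop 1) expr1 (_ : take_poly 1 p = 0) ?add0r //.
  by apply/polyP => -[|i]; rewrite coef_take_poly coef0 //= ?c0.
move: (drop_poly 1 p) pE => q pE.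
have q0 : q != 0 by apply: contraNneq p0 => q0; rewrite pE q0 mul0r.
apply: (IH q) => //.
  by move: px; rewrite pE rmorphM /= map_polyX rootM rootX (negPf x0) orbF.
by rewrite -ltnS (leq_trans _ sp) // ltnS pE size_mulX.
Qed.

Lemma graph_horner x (p : {poly k}) : G x -> G ((map_poly iota p).[x.1], (map_poly iota p).[x.2]).
Proof.
case: Gemb => Gc GB GM _ Gx; elim/poly_ind: p => [|p c IH].
  by rewrite rmorph0 !horner0; have := Gc 0; rewrite rmorph0.
rewrite rmorphD rmorphM /= map_polyX map_polyC /= !hornerE.
have G0 : G (0, 0) by have := Gc 0; rewrite rmorph0.
have := GB _ _ (GM _ _ IH Gx) (GB _ _ G0 (Gc c)).
by rewrite /= !sub0r !opprK.
Qed.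

(** As x is algebraic and not zero, its inverse is a polynomial in x with
    coefficients in k; the same polynomial inverts the image of x, which satisfies
    the same equation. *)
Lemma graph_inv x : G x -> x.1 != 0 -> G (x.1^-1, x.2^-1).
Proof.
move=> Gx x0; have [p c0 px] := alg_nonzero_const x0.
have py : root (map_poly iota p) x.2.
  have := graph_horner p Gx; rewrite (rootP px); case: Gemb => _ _ _ G0 /G0 h.
  exact/rootP.
have pE : p = drop_poly 1 p * 'X + (p`_0)%:P.
  rewrite -[LHS](poly_take_drop 1) expr1 addrC; congr (_ + _).
  by apply/polyP => -[|i]; rewrite coef_take_poly coefC.
set q := drop_poly 1 p in pE; pose c := iota p`_0.
have c0' : c != 0 by rewrite fmorph_eq0.
have inv z : root (map_poly iota p) z -> z != 0 -> (map_poly iota (- (p`_0)^-1 *: q)).[z] = z^-1.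
  move=> pz z0; rewrite map_polyZ hornerZ rmorphN fmorphV -/c.
  move/rootP: pz; rewrite pE rmorphD rmorphM /= map_polyX map_polyC /= !hornerE -/c => /eqP.
  rewrite addr_eq0 => /eqP hz.
  apply: (mulIf z0); rewrite mulVf // -mulrA hz mulrNN mulVf //.
have y0 : x.2 != 0.
  apply: contraTneq py => ->; rewrite /root pE rmorphD rmorphM /= map_polyX map_polyC /= !hornerE.
  by rewrite -/c.
by have := graph_horner (- (p`_0)^-1 *: q) Gx; rewrite !inv.
Qed.

Definition graph_pred : {pred K * K} := fun x => `[< G x >].

Fact graph_subring_closed : subring_closed graph_pred.
Proof.
case: Gemb => Gc GB GM _; split.
- by apply/asboolP; have := Gc 1; rewrite rmorph1.
- by move=> x y /asboolP Gx /asboolP Gy; apply/asboolP; exact: GB.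
- by move=> x y /asboolP Gx /asboolP Gy; apply/asboolP; exact: GM.
Qed.

HB.instance Definition _ :=
  GRing.isSubringClosed.Build (K * K)%type graph_pred graph_subring_closed.

Record graph_field := GraphField { graph_val : K * K; _ : graph_val \in graph_pred }.

HB.instance Definition _ := [isSub for graph_val].
HB.instance Definition _ := [Choice of graph_field by <:].
HB.instance Definition _ := [SubChoice_isSubComNzRing of graph_field by <:].

Lemma graph_valP (x : graph_field) : G (val x).
Proof. by apply/asboolP; case: x. Qed.

Definition graph_fieldV (x : graph_field) : graph_field :=
  if pselect ((val x).1 != 0) is left x0 then
    GraphField (asboolT (graph_inv (graph_valP x) x0)) else 0.

Lemma graph_field_neq0 (x : graph_field) : x != 0 -> (val x).1 != 0.
Proof.
apply: contraNN => /eqP x0; apply/eqP/val_inj; case: Gemb => _ _ _ G0.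
have := graph_valP x; case: (val x) x0 => x1 x2 /= -> /G0 ->.
by [].
Qed.

Fact graph_fieldVl (x : graph_field) : x != 0 -> graph_fieldV x * x = 1.
Proof.
move=> /graph_field_neq0 x0; apply: val_inj; rewrite /graph_fieldV; case: pselect => // x0' /=.
have x2 : (val x).2 != 0.
  apply/eqP => x20; have := graph_inv (graph_valP x) x0; rewrite x20 invr0.
  case: Gemb => Gc GB GM G0 h.
  have := GM _ _ h (graph_valP x); rewrite /= mulVf // mul0r => h1.
  have := GB _ _ (Gc 1) h1; rewrite rmorph1 /= subrr subr0 => /G0 /eqP.
  by rewrite oner_eq0.
by congr pair; rewrite mulVf.
Qed.

Fact graph_fieldV0 : graph_fieldV 0 = 0.
Proof. by rewrite /graph_fieldV; case: pselect => // h; exfalso; move: h; rewrite /= eqxx. Qed.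

HB.instance Definition _ :=
  GRing.ComNzRing_isField.Build graph_field graph_fieldVl graph_fieldV0.

Hypothesis K_sep : separable_closure iota.

(** The polynomials over the domain of G that vanish at z are the multiples of one
    of them.  Its image under G divides a separable polynomial over k, so it has a
    root z' in K, and z may be sent to z'. *)
Lemma graph_extend z : exists z' (G' : set (K * K)),
  [/\ graph_embedding G', (G `<=` G')%classic & G' (z, z')].
Proof.
pose f1 : {rmorphism graph_field -> K} := fst \o val.
pose f2 : {rmorphism graph_field -> K} := snd \o val.
have Gc a : (iota a, iota a) \in graph_pred by apply/asboolP; case: Gemb.
pose jf a := GraphField (Gc a).
have jB : zmod_morphism jf.
  by move=> a b; apply: val_inj; rewrite /= rmorphB.
have jM : monoid_morphism jf.
  by split; [|move=> a b]; apply: val_inj; rewrite /= ?rmorph1 ?rmorphM.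
pose j : {rmorphism k -> graph_field} :=
  HB.pack jf (GRing.isZmodMorphism.Build _ _ jf jB) (GRing.isMonoidMorphism.Build _ _ jf jM).
have [p psep pz] := K_sep.1 z.
have p0 := separable_poly_neq0 psep.
have f1j Q : map_poly f1 (map_poly j Q) = map_poly iota Q by rewrite -map_poly_comp.
have f2j Q : map_poly f2 (map_poly j Q) = map_poly iota Q by rewrite -map_poly_comp.
have [|| g [g0 gz gmin]] := @root_generator _ f1 z (map_poly j p).
- by rewrite map_poly_eq0.
- by rewrite f1j.
have gp : map_poly f2 g %| map_poly iota p.
  by rewrite -f2j dvdp_map; apply: gmin; rewrite f1j.
have gsep : separable_poly (map_poly f2 g).
  by apply: dvdp_separable gp _; rewrite separable_map.
have [|z' gz'] := K_sep.2 (map_poly f2 g) _ gsep.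
  rewrite size_map_poly; apply: contraTltn gz => sg.
  have /size_poly1P[c c0 ->] : size g == 1%N by rewrite eqn_leq sg size_poly_gt0.
  by rewrite map_polyC rootC fmorph_eq0.
exists z', (fun p => exists Q, p = ((map_poly f1 Q).[z], (map_poly f2 Q).[z'])); split.
- apply: (@poly_graph _ j) => // Q /rootP/gmin gQ; apply/rootP.
  by apply: root_dvdp gz'; rewrite dvdp_map.
- move=> x Gx; have xG : x \in graph_pred by apply/asboolP.
  by exists (GraphField xG)%:P; rewrite !map_polyC !hornerC /=; case: (x).
- by exists 'X; rewrite !map_polyX !hornerX.
Qed.

End GraphField.



Hypothesis K_sep : separable_closure iota.

Lemma separable_closure_alg (x : K) : exists2 p : {poly k}, p != 0 & root (map_poly iota p) x.
Proof.
by have [p sp px] := K_sep.1 x; exists p => //; exact: separable_poly_neq0 sp.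
Qed.

(** A maximal graph containing G0 is defined everywhere, by [graph_extend]. *)
Lemma embedding_of_graph (G0 : set (K * K)) x x' : graph_embedding G0 -> G0 (x, x') ->
  exists s : {rmorphism K -> K}, (forall a, s (iota a) = iota a) /\ s x = x'.
Proof.
move=> G0emb G0x.
(* The empty set is the union of the empty chain. *)
pose P (G : set (K * K)) := G = set0 \/ (graph_embedding G /\ G (x, x')).
have [F FP Ftot|A [PA Amax]] := @Zorn_bigcup _ P.
  have [[G1 [FG1 [G1emb G1x]]]|none] :=
    pselect (exists G1, F G1 /\ (graph_embedding G1 /\ G1 (x, x'))).
    right; split; last by exists G1.
    have good G u : F G -> G u -> graph_embedding G.
      by move=> /FP[->//|[]].
    have [Gc _ _ _] := G1emb; split.
    - by move=> a; exists G1.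
    - move=> u v [A FA Au] [B FB Bv]; have [AB|BA] := Ftot A B FA FB.
        by exists B => //; have [_ h _ _] := good _ _ FB Bv; apply: h => //; exact: AB.
      by exists A => //; have [_ h _ _] := good _ _ FA Au; apply: h => //; exact: BA.
    - move=> u v [A FA Au] [B FB Bv]; have [AB|BA] := Ftot A B FA FB.
        by exists B => //; have [_ _ h _] := good _ _ FB Bv; apply: h => //; exact: AB.
      by exists A => //; have [_ _ h _] := good _ _ FA Au; apply: h => //; exact: BA.
    - by move=> b [A FA Ab]; have [_ _ _ h] := good _ _ FA Ab; exact: h.
  left; apply/seteqP; split=> // u [G FG Gu].
  have [GE|Ggood] := FP _ FG; first by rewrite GE in Gu.
  by case: none; exists G.
have [A0|[Aemb Ax]] := PA.
  case: (Amax G0); last by right.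
  rewrite A0; split=> [u []|]; by move/(_ _ G0x).
have total z : exists z', A (z, z').
  have [z' [G' [G'emb AG' G'z]]] := graph_extend Aemb separable_closure_alg K_sep z.
  exists z'; apply: contrapT => nAz.
  apply: (Amax G'); last by right; split => //; exact: AG'.
  by split=> // /(_ _ G'z).
have [f hf] := choice total.
have [Ac AB AM A0] := Aemb.
have uniqA z u v : A (z, u) -> A (z, v) -> u = v.
  move=> Au Av; have := AB _ _ Au Av; rewrite /= subrr => /A0 /eqP.
  by rewrite subr_eq0 => /eqP.
have fB : zmod_morphism f by move=> u v; apply: uniqA (hf _) (AB _ _ (hf u) (hf v)).
have fM : monoid_morphism f.
  split; last by move=> u v; apply: uniqA (hf _) (AM _ _ (hf u) (hf v)).
  by apply: uniqA (hf _) _; have := Ac 1; rewrite rmorph1.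
pose s : {rmorphism K -> K} :=
  HB.pack f (GRing.isZmodMorphism.Build _ _ f fB) (GRing.isMonoidMorphism.Build _ _ f fM).
exists s; split=> [a|]; first exact: uniqA (hf _) (Ac a).
exact: uniqA (hf _) Ax.
Qed.

(** The iterates of s at z are roots of a polynomial over k, so two of them agree;
    as s is injective, z itself is an iterate of its image. *)
Lemma embedding_bijective (s : {rmorphism K -> K}) :
  (forall a, s (iota a) = iota a) -> bijective s.
Proof.
move=> sfix; have sinj : injective s := fmorph_inj s.
suff ssurj z : exists y, s y = z.
  by have [g hg] := choice ssurj; exists g => // x; apply: sinj; rewrite hg.
have [p p0 pz] := separable_closure_alg z.
have rootS y : root (map_poly iota p) y -> root (map_poly iota p) (s y).
  have {2}-> : map_poly iota p = map_poly s (map_poly iota p).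
    by rewrite -map_poly_comp; apply: eq_map_poly => a; rewrite /= sfix.
  by move=> py; rewrite fmorph_root.
pose n := size p.
have nu : ~~ uniq (traject s z n.+1).
  apply/negP => u; have := @max_poly_roots _ (map_poly iota p) (traject s z n.+1).
  rewrite map_poly_eq0 p0 size_map_poly size_traject ltnNge leqnSn => /(_ isT) h.
  suff : all (root (map_poly iota p)) (traject s z n.+1) by move/h => /(_ u).
  apply/allP => y /trajectP[i _ ->]; elim: i => //= i IH; exact: rootS.
move: nu; rewrite looping_uniq negbK => /trajectP[i ilt].
have iter_inj : injective (iter i s) by elim: (i) => // i' IH u v /= /sinj/IH.
rewrite -(subnK (ltnW ilt)) addnC iterD => /iter_inj.
rewrite -[(n - i)%N]prednK ?subn_gt0 // iterS => hz.
by exists (iter (n - i).-1 s z).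
Qed.

(** An element outside k has a conjugate x' <> x in K, since its minimal
    polynomial is separable, and x |-> x' extends to K. *)
Lemma gal_fixed_field (x : K) : (forall s : gal iota, s x = x) -> exists a, x = iota a.
Proof.
move=> hx; have [p psep px] := K_sep.1 x.
have [g [g0 gx gmin]] := root_generator (separable_poly_neq0 psep) px.
have gsep : separable_poly (map_poly iota g).
  rewrite separable_map; exact: dvdp_separable (gmin _ px) psep.
have [q qE] := factor_theorem _ _ gx.
have sgq : size g = (size q).+1.
  have q0 : q != 0 by apply: contraNneq g0 => q0; rewrite -(map_poly_eq0 iota) qE q0 mul0r.
  by rewrite -(size_map_poly iota) qE size_mul ?polyXsubC_eq0 // size_XsubC addn2.
have [q1|q1] := leqP (size q) 1.
  have sg : size g = 2%N.
    rewrite sgq; congr _.+1; apply/eqP; rewrite eqn_leq q1 size_poly_gt0.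
    by apply: contraNneq g0 => q0; rewrite -(map_poly_eq0 iota) qE q0 mul0r.
  have g1 : iota g`_1 != 0.
    by rewrite fmorph_eq0 -[1%N]/(2%N.-1) -sg -/(lead_coef g) lead_coef_eq0.
  exists (- (g`_0 / g`_1)); rewrite rmorphN fmorph_div.
  move/rootP: gx; rewrite horner_coef size_map_poly sg !big_ord_recl big_ord0 !coef_map /=.
  rewrite mulr1 addr0 expr1 => /eqP; rewrite addr_eq0 => /eqP ->.
  by rewrite mulNr opprK mulrC mulKf.
move: gsep; rewrite qE separable_root => /andP[qsep nqx].
have [x' qx'] := K_sep.2 q q1 qsep.
have gx' : root (map_poly iota g) x' by rewrite qE rootM qx'.
have [||||s [sfix sx]] :=
  @embedding_of_graph _ x x' (@poly_graph _ idfun iota iota x x' _ _ _).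
- by [].
- by [].
- move=> Q /rootP/gmin gQ; apply/rootP; apply: root_dvdp gx'; by rewrite dvdp_map.
- by exists 'X; rewrite !map_polyX !hornerX.
have := hx (Gal (embedding_bijective sfix) sfix); rewrite /= sx => xx'.
by rewrite -xx' qx' in nqx.
Qed.

End PartialEmbeddings.

Section AdditiveHilbert90.
Variables (k K : fieldType) (iota : {rmorphism k -> K}).
Hypothesis K_sep : separable_closure iota.

Local Notation gal := (gal iota).

Lemma gal_orbit_finite (x : K) : exists rs : seq K, forall s : gal, s x \in rs.
Proof.
have [p psep px] := K_sep.1 x.
have p0 : map_poly iota p != 0 by rewrite map_poly_eq0 (separable_poly_neq0 psep).
have [rs [urs srs ars]] : exists rs,
    [/\ uniq rs, size rs = (size (map_poly iota p)).-1 & all (root (map_poly iota p)) rs].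
  by apply: separable_split; [exact: K_sep.2 | rewrite separable_map].
exists rs => s; have sx : root (map_poly iota p) (s x).
  have -> : map_poly iota p = map_poly s (map_poly iota p).
    by rewrite -map_poly_comp; apply: eq_map_poly => a; rewrite /= gal_fix.
  by rewrite fmorph_root.
apply: contraT => nsx; have := @max_poly_roots _ _ (s x :: rs) p0.
rewrite /= sx ars nsx urs srs => /(_ isT isT).
by rewrite prednK ?size_poly_gt0 // ltnn.
Qed.

Lemma gal_restrictions_finite (S : seq K) :
  exists LL : seq (seq K), forall s : gal, [seq s x | x <- S] \in LL.
Proof.
elim: S => [|x S [LL hLL]]; first by exists [:: [::]].
have [rs hrs] := gal_orbit_finite x.
exists [seq y :: l | y <- rs, l <- LL] => s.
by apply/allpairsP; exists (s x, [seq s y | y <- S]); split=> /=; rewrite ?hrs ?hLL.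
Qed.

Definition gal1 : gal := @Gal _ _ iota idfun (inv_bij (fun=> erefl)) (fun=> erefl).

Lemma gal_inverse (s : gal) : exists t : gal, forall x, s (t x) = x.
Proof.
have [g gK Kg] := gal_bij s.
have gB : zmod_morphism g by move=> x y; apply: (can_inj gK); rewrite rmorphB !Kg.
have gM : monoid_morphism g.
  by split=> [|x y]; apply: (can_inj gK); rewrite ?rmorphM ?rmorph1 !Kg.
pose t : {rmorphism K -> K} :=
  HB.pack g (GRing.isZmodMorphism.Build _ _ g gB) (GRing.isMonoidMorphism.Build _ _ g gM).
have tfix a : t (iota a) = iota a by apply: (can_inj gK); rewrite Kg gal_fix.
by exists (Gal (Bijective Kg gK : bijective t) tfix) => x; exact: Kg.
Qed.

Section Cocycle.
Variable c : gal -> K.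
Hypothesis c_cocycle : forall s t, c (gal_comp s t) = c s + s (c t).
Variable S : seq K.
Hypothesis c_ext : forall s t : gal, (forall x, s x = t x) -> c s = c t.
Hypothesis c_loc : forall t : gal, (forall x, x \in S -> t x = x) -> c t = 0.

Let restr (s : gal) := [seq s x | x <- S].

Lemma restr_eq (s t : gal) : restr s = restr t -> {in S, s =1 t}.
Proof. by move/eq_in_map. Qed.

Lemma cocycle_restr (s t : gal) : restr s = restr t -> c s = c t.
Proof.
move=> /restr_eq st; have [s' ss'] := gal_inverse s.
have sinj : injective s := fmorph_inj s.
have u0 : c (gal_comp s' t) = 0.
  by apply: c_loc => x xS; apply: sinj; rewrite /= ss' st.
have := c_cocycle s (gal_comp s' t); rewrite u0 rmorph0 addr0 => <-.
by apply: c_ext => x; rewrite /= ss'.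
Qed.

Let D (theta : K) := forall s t : gal, restr s = restr t -> s theta = t theta.

(** Independence of characters.  The characters agree on the elements theta that
    separate only restrictions to S, which is why theta ranges over D. *)
Lemma dedekind (rep : seq K -> gal) (R : seq (seq K)) (w : seq K -> K) :
  uniq R -> {in R, forall l, restr (rep l) = l} ->
  (forall theta, D theta -> \sum_(l <- R) w l * rep l theta = 0) -> {in R, forall l, w l = 0}.
Proof.
elim: R w => [//|l0 R IH] w /= /andP[nl0 uR] hrep hw.
have w0 : {in R, forall l, w l = 0}.
  move=> l1 l1R.
  have [x [xS nx]] : exists x, x \in S /\ rep l0 x != rep l1 x.
    apply: contrapT => h; have E : restr (rep l0) = restr (rep l1).
      apply/eq_in_map => x xS; apply/eqP/negPn/negP => nx; apply: h; by exists x.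
    move: E; rewrite !hrep ?mem_head ?inE ?l1R ?orbT // => E.
    by rewrite E l1R in nl0.
  have := IH (fun l => w l * (rep l x - rep l0 x)) uR.
  have hR : {in R, forall l, restr (rep l) = l}.
    by move=> l lR; apply: hrep; rewrite inE lR orbT.
  move=> /(_ hR) h.
  suff /eqP : w l1 * (rep l1 x - rep l0 x) = 0.
    by rewrite mulf_eq0 subr_eq0 [_ == rep l0 x]eq_sym (negPf nx) orbF => /eqP.
  apply: (h _ l1 l1R) => theta Dt.
  have Dxt : D (x * theta).
    by move=> s t st; rewrite !rmorphM (Dt _ _ st) (restr_eq st).
  have := hw _ Dxt; rewrite big_cons => h1.
  have := hw _ Dt; rewrite big_cons => h2.
  have : \sum_(l <- R) w l * rep l (x * theta) - rep l0 x * \sum_(l <- R) w l * rep l theta = 0.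
    transitivity ((w l0 * rep l0 (x * theta) + \sum_(l <- R) w l * rep l (x * theta)) -
      rep l0 x * (w l0 * rep l0 theta + \sum_(l <- R) w l * rep l theta)).
      by rewrite rmorphM; ring.
    by rewrite h1 h2 mulr0 subr0.
  rewrite mulr_sumr -sumrB => h3; apply: etrans h3; apply: eq_bigr => l _.
  by rewrite rmorphM; ring.
move=> l; rewrite inE => /orP[/eqP->|]; last exact: w0.
have D1 : D 1 by move=> s t _; rewrite !rmorph1.
have := hw _ D1; rewrite big_cons rmorph1 mulr1 big_seq big1 ?addr0 // => l' l'R.
by rewrite w0 ?mul0r.
Qed.

(** The cocycle depends only on the restriction of s to S, which takes finitely
    many values.  Choose theta such that the sum T of its images under these is not
    zero; the average of the values of the cocycle weighted by the images of theta,
    divided by T, trivializes it. *)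
Lemma cocycle_coboundary : exists alpha : K, forall s, c s = s alpha - alpha.
Proof.
have [LL hLL] := gal_restrictions_finite S.
have exrep l : exists t : gal, (exists s, restr s = l) -> restr t = l.
  have [[s hs]|h] := pselect (exists s, restr s = l); first by exists s.
  by exists gal1 => /h.
have [rep hrep] := choice exrep.
pose R := [seq l <- undup LL | `[< exists s, restr s = l >]].
have uR : uniq R by rewrite filter_uniq ?undup_uniq.
have memR s : restr s \in R.
  by rewrite mem_filter mem_undup hLL andbT; apply/asboolP; exists s.
have repR : {in R, forall l, restr (rep l) = l}.
  by move=> l; rewrite mem_filter => /andP[/asboolP h _]; exact: hrep.
have [theta [Dt Tn0]] : exists theta, D theta /\ \sum_(l <- R) rep l theta != 0.
  apply: contrapT => h.
  have := dedekind (rep := rep) (w := fun=> 1) uR repR _ (memR gal1).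
  have hT theta : D theta -> \sum_(l <- R) 1 * rep l theta = 0.
    move=> Dt; apply/eqP/negPn/negP => hn; apply: h; exists theta; split => //.
    by move: hn; under eq_bigr => l _ do rewrite mul1r.
  by move=> /(_ hT)/eqP; rewrite oner_eq0.
pose T := \sum_(l <- R) rep l theta.
pose a := \sum_(l <- R) rep l theta * c (rep l).
(* Composition with s permutes the restrictions. *)
have permR (s : gal) : perm_eq [seq [seq s x | x <- l] | l <- R] R.
  have uM : uniq [seq [seq s x | x <- l] | l <- R].
    by rewrite map_inj_uniq //; apply: inj_map; exact: fmorph_inj.
  apply: uniq_perm => //; have [] := uniq_min_size uM (s2 := R); rewrite ?size_map //.
  move=> _ /mapP[l lR ->]; rewrite -(repR _ lR) -map_comp.
  exact: (memR (gal_comp s (rep l))).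
have srep (s : gal) l : l \in R -> restr (gal_comp s (rep l)) = restr (rep [seq s x | x <- l]).
  move=> lR; have E : restr (gal_comp s (rep l)) = [seq s x | x <- l].
    by rewrite -{2}(repR _ lR) -map_comp.
  by rewrite E [RHS]hrep //; exists (gal_comp s (rep l)).
have sT (s : gal) : s T = T.
  rewrite /T rmorph_sum -[in RHS](perm_big _ (permR s)) big_map big_seq [RHS]big_seq.
  by apply: eq_bigr => l lR; exact: (Dt _ _ (srep s l lR)).
have sa (s : gal) : s a = a - c s * T.
  rewrite -[in RHS](sT s) /a /T !rmorph_sum.
  rewrite -[in RHS](perm_big _ (permR s)) big_map mulr_sumr -sumrB.
  rewrite big_seq [RHS]big_seq; apply: eq_bigr => l lR.
  rewrite -(Dt _ _ (srep s l lR)) -(cocycle_restr (srep s l lR)) c_cocycle rmorphM /=; ring.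
by exists (- (a / T)) => s; rewrite rmorphN fmorph_div sT sa mulrBl mulfK //; ring.
Qed.

End Cocycle.
End AdditiveHilbert90.

(** * Cocycles attached to elements of A *)

Lemma quot_piP (V : zmodType) (I : zmodClosed V) (x y : V) :
  \pi_{ideal_quot I} x = \pi_{ideal_quot I} y <-> x - y \in I.
Proof. by rewrite Quotient.idealrBE; split => [->|/eqP]. Qed.

Section CocycleOfCoordinates.
Variables (k : fieldType) (char2 : 2%N \in [pchar k]) (m : nat) (m_gt0 : (0 < m)%N).
Local Notation n := m.*2.+1.
Variables (E : vectType k) (e : n.-tuple E) (q0 q1 : E -> k).
Hypotheses (q0_quad : quadratic_form q0) (q1_quad : quadratic_form q1).
Hypothesis q_reg : regular_pair e q0 q1.
Hypothesis an_neq0 : (disc_poly e q0 q1)`_n != 0.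
Variables (K : fieldType) (iota : {rmorphism k -> K}).
Hypothesis K_sep : separable_closure iota.

Local Notation disc := (disc_poly e q0 q1).
Local Notation a := (fun i => disc`_i).
Local Notation aK := (fun i => iota disc`_i).
Local Notation aut := (aut iota e q0 q1).
Local Notation shearK := (shear e q0 q1 iota).

Let charK : 2%N \in [pchar K] := rmorph_char2 char2 iota.
Let addKK (x : K) : x + x = 0 := addrr_pchar2 charK x.
Let oppK (x : K) : - x = x := oppr_pchar2 charK x.

Lemma aut_comm : aut_commutative iota e q0 q1.
Proof.
move=> [g gP] [h hP]; apply: val_inj => /=.
have [M ->] := aut_shear char2 q0_quad q1_quad q_reg an_neq0 gP.
have [N ->] := aut_shear char2 q0_quad q1_quad q_reg an_neq0 hP.
by rewrite !shearD // addrC.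
Qed.

Local Notation AutZ := (autZ aut_comm).

Definition is_kernel (h : nat -> K) := forall p, (p < m.*2)%N -> wp m aK h p = 0.

(** Outside the kernel of [wp] the value is the neutral element. *)
Definition aut_of (h : nat -> K) : AutZ :=
  insubd (aut1 iota e q0 q1) (shearK (hankel m h)).

Lemma aut_ofE h : is_kernel h -> aut_mx (aut_of h) = shearK (hankel m h).
Proof.
move=> hh; rewrite /aut_of -[aut_mx _]/(val _) val_insubd.
by rewrite (hankel_preserves char2 q0_quad q1_quad).
Qed.

Lemma aut_of_surj (g : AutZ) : exists2 h, is_kernel h & g = aut_of h.
Proof.
have [h gh hh] := aut_hankel char2 q0_quad q1_quad q_reg an_neq0 m_gt0 (valP (g : aut)).
by exists h => //; apply: val_inj; rewrite [RHS](aut_ofE hh) -gh.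
Qed.

Lemma aut_of_inj h h' : is_kernel h -> is_kernel h' -> aut_of h = aut_of h' ->
  forall p, (p < m.*2)%N -> h p = h' p.
Proof.
move=> hh hh' /(congr1 (fun g : AutZ => aut_mx g)); rewrite !aut_ofE // => heq p pm.
apply: (hankel_inj m_gt0 pm).
exact: (shear_inj char2 q0_quad q1_quad q_reg an_neq0 heq).
Qed.

Lemma eq_aut_of h h' : (forall p, (p < m.*2)%N -> h p = h' p) -> aut_of h = aut_of h'.
Proof.
move=> hh; rewrite /aut_of; congr (insubd _ (shearK _)); apply/matrixP => i j; rewrite !mxE.
by apply: hh; rewrite -addnn -addnS leq_add // -ltnS.
Qed.

Lemma wpB h h' p : wp m aK (fun i => h i - h' i) p = wp m aK h p - wp m aK h' p.
Proof.
have -> : (fun i => h i - h' i) = (fun i => h i + h' i) by apply: funext => i; rewrite oppK.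
by rewrite wpD // oppK.
Qed.

Lemma is_kernelD h h' : is_kernel h -> is_kernel h' -> is_kernel (fun i => h i + h' i).
Proof. by move=> hh hh' p pm; rewrite wpD // hh ?hh' ?addr0. Qed.

Lemma aut_ofD h h' : is_kernel h -> is_kernel h' ->
  aut_of (fun i => h i + h' i) = aut_of h + aut_of h'.
Proof.
move=> hh hh'; apply: val_inj; rewrite [LHS](aut_ofE (is_kernelD hh hh')).
rewrite -[RHS]/(aut_mx (aut_of h) *m aut_mx (aut_of h')) !aut_ofE // shearD //.
by congr shearK; apply/matrixP => i j; rewrite !mxE.
Qed.

Lemma wp_gal (s : gal iota) h p : wp m aK (fun i => s (h i)) p = s (wp m aK h p).
Proof.
rewrite /wp rmorphD rmorph_sum; congr (_ + _); apply: eq_bigr => l _.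
by rewrite rmorphM rmorphXn; case: ifP; rewrite ?gal_fix ?rmorph0.
Qed.

Lemma wp_iota (c : nat -> k) p : wp m aK (fun i => iota (c i)) p = iota (wp m a c p).
Proof.
rewrite /wp rmorphD rmorph_sum; congr (_ + _); apply: eq_bigr => l _.
by rewrite rmorphM rmorphXn; case: ifP; rewrite ?rmorph0.
Qed.

Lemma shear_gal (s : gal iota) M : map_mx s (shearK M) = shearK (map_mx s M).
Proof.
have fixmx p p' (A : 'M[k]_(p, p')) : map_mx s (map_mx iota A) = map_mx iota A.
  by apply/matrixP => i j; rewrite !mxE gal_fix.
by rewrite /shear map_mxD map_mx1 !map_mxM !fixmx.
Qed.

Lemma is_kernel_gal (s : gal iota) h : is_kernel h -> is_kernel (fun i => s (h i)).
Proof. by move=> hh p pm; rewrite wp_gal hh // rmorph0. Qed.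

Lemma aut_of_gal (s : gal iota) h : is_kernel h ->
  autZ_gal s (aut_of h) = aut_of (fun i => s (h i)).
Proof.
move=> hh; apply: val_inj; rewrite [RHS](aut_ofE (is_kernel_gal s hh)).
rewrite -[LHS]/(map_mx s (aut_mx (aut_of h))) aut_ofE // shear_gal; congr shearK.
by apply/matrixP => i j; rewrite !mxE.
Qed.

Lemma aut_ofB h h' : is_kernel h -> is_kernel h' ->
  aut_of (fun i => h i - h' i) = aut_of h - aut_of h'.
Proof.
move=> hh hh'; apply: (addIr (aut_of h')); rewrite subrK -aut_ofD //.
  by apply: eq_aut_of => p _; rewrite subrK.
by move=> p pm; rewrite wpB hh ?hh' ?subr0.
Qed.

Definition over (c : nat -> k) (h : nat -> K) :=
  forall p, (p < m.*2)%N -> wp m aK h p = iota (c p).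

Lemma over_exists c : exists h, over c h.
Proof.
have Kc : separably_closed K := K_sep.2.
have sz : size (map_poly iota disc) = n.+1.
  by rewrite size_map_poly (disc_size char2 q0_quad q1_quad an_neq0).
have sep : separable_poly (map_poly iota disc).
  by rewrite separable_map; apply: disc_separable.
have [h hh] := wp_onto charK Kc (fun i => iota (c i)) sz sep.
exists h => p pm; rewrite -hh // /wp; congr (_ + _); apply: eq_bigr => l _.
by rewrite !coef_map.
Qed.

Definition twist (s : gal iota) (h : nat -> K) : nat -> K := fun i => s (h i) - h i.

Lemma over_sub c h h' : over c h -> over c h' -> is_kernel (fun i => h i - h' i).
Proof.
by move=> hh hh' p pm; rewrite wpB hh // hh' // subrr.
Qed.

Lemma over_gal c (s : gal iota) h : over c h -> over c (fun i => s (h i)).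
Proof. by move=> hh p pm; rewrite wp_gal hh // gal_fix. Qed.

Lemma twist_kernel c (s : gal iota) h : over c h -> is_kernel (twist s h).
Proof. by move=> hh; apply: over_sub (over_gal s hh) hh. Qed.

Local Notation act := (fun s : gal iota => autZ_gal s : {additive AutZ -> AutZ}).

Lemma twist_cocycle c h : over c h -> (fun s => aut_of (twist s h)) \in is_cocycle act.
Proof.
move=> hh; apply/asboolP; split=> [s t|s].
  transitivity (aut_of (twist s h) + aut_of (fun i => s (twist t h i))).
    rewrite -aut_ofD; last 2 first.
    - exact: twist_kernel hh.
    - exact/is_kernel_gal/(twist_kernel t hh).
    by apply: eq_aut_of => p _; rewrite /twist /= rmorphB; ring.
  by rewrite -(aut_of_gal s (twist_kernel t hh)).
exists [seq h i | i <- seq.iota 0 m.*2] => t ht; apply: eq_aut_of => p pm.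
rewrite /twist ht //; apply: map_f; by rewrite mem_iota.
Qed.


(** The connecting map of 0 -> Aut -> A_K / K -> A_K / K -> 0. *)
Definition twist_class_of (c : nat -> k) (z : cocycle act) : Prop :=
  exists2 h, over c h & forall s, z s = aut_of (twist s h).

Lemma twist_class_exists c : exists z, twist_class_of c z.
Proof.
have [h hh] := over_exists c.
by exists (Cocycle (twist_cocycle hh)), h.
Qed.

(** In coordinates the cocycle is a family of additive cocycles, whose
    trivializations alpha have coordinates in K.  Their image under [wp] is
    Galois-invariant, hence comes from k. *)
Lemma twist_class_surj (z : cocycle act) : exists c, twist_class_of c z.
Proof.
have /asboolP[zM zloc] := valP z.
have exH s : exists h, is_kernel h /\ z s = aut_of h.
  by have [h hh hz] := aut_of_surj (z s); exists h.
have [H hH] := choice exH.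
have Hext s t : z s = z t -> forall p, (p < m.*2)%N -> H s p = H t p.
  move=> zst; have [Hs zs] := hH s; have [Ht zt] := hH t.
  by apply: aut_of_inj => //; rewrite -zs -zt.
have HM s t p : (p < m.*2)%N -> H (gal_comp s t) p = H s p + s (H t p).
  move=> pm; have [Hs zs] := hH s; have [Ht zt] := hH t; have [Hst zst] := hH (gal_comp s t).
  have Hst' : is_kernel (fun i => H s i + s (H t i)).
    exact: is_kernelD Hs (is_kernel_gal s Ht).
  apply: (aut_of_inj Hst Hst') => //; rewrite -zst -[LHS]/(val z (gal_comp s t)) zM.
  rewrite aut_ofD //; last exact: is_kernel_gal.
  by rewrite -aut_of_gal // -zs -zt.
have zext (s t : gal iota) : (forall x, s x = t x) -> z s = z t.
  by move=> st; have [T hT] := zloc t; apply: hT => x _.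
have [S hS] := zloc (gal1 iota).
have H1 p : (p < m.*2)%N -> H (gal1 iota) p = 0.
  move=> pm; have := HM (gal1 iota) (gal1 iota) p pm.
  rewrite (Hext (gal_comp (gal1 iota) (gal1 iota)) (gal1 iota)) //; last exact: zext.
  rewrite -{1}[H _ p]addr0 => /addrI h; exact: esym h.
have exalpha p : exists alpha, (p < m.*2)%N -> forall s : gal iota, H s p = s alpha - alpha.
  have [pm|_] := boolP (p < m.*2)%N; last by exists 0.
  have [|s t /zext st|t /hS zt|alpha ha] :=
    @cocycle_coboundary _ _ _ K_sep (fun s => H s p) _ S.
  - by move=> s t; exact: HM.
  - exact: Hext.
  - by rewrite (Hext t (gal1 iota)) // H1.
  by exists alpha.
have [alpha ha] := choice exalpha.
have exc p : exists c, (p < m.*2)%N -> wp m aK alpha p = iota c.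
  have [pm|_] := boolP (p < m.*2)%N; last by exists 0.
  have [s|c hc] := gal_fixed_field K_sep (x := wp m aK alpha p); last by exists c.
  apply/eqP; rewrite -subr_eq0 -wp_gal -wpB.
  rewrite (@eq_wp _ _ aK _ (H s)) ?(hH s).1 // => i im.
  by rewrite ha.
have [c hc] := choice exc.
exists c, alpha => // s; have [_ ->] := hH s; apply: eq_aut_of => p pm.
exact: ha.
Qed.

(** The cocycles of h and h' differ by the coboundary of beta in the kernel of [wp]
    exactly when h - h' - beta is Galois-invariant, hence defined over k. *)
Lemma twist_class_eq c c' z z' : twist_class_of c z -> twist_class_of c' z' ->
  H1class z = H1class z' <->
  exists g : nat -> k, forall p, (p < m.*2)%N -> wp m a g p = c p - c' p.
Proof.
move=> [h hh hz] [h' hh' hz'].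
rewrite /H1class quot_piP; split => [/asboolP[b hb]|[g hg]].
  have [beta hbeta bE] := aut_of_surj b.
  pose u i := h i - h' i - beta i.
  have uK p : exists g, (p < m.*2)%N -> u p = iota g.
    have [pm|_] := boolP (p < m.*2)%N; last by exists 0.
    have [s|g hg] := gal_fixed_field K_sep (x := u p); last by exists g.
    have k1 : is_kernel (fun i => twist s h i - twist s h' i).
      by move=> j jm; rewrite wpB (twist_kernel s hh) // (twist_kernel s hh') // subrr.
    have k2 : is_kernel (fun i => s (beta i) - beta i).
      by move=> j jm; rewrite wpB wp_gal hbeta // rmorph0 subrr.
    have := hb s; rewrite -[LHS]/(z s - z' s) hz hz' bE.
    rewrite -[X in X = _](aut_ofB (twist_kernel s hh) (twist_kernel s hh')).
    rewrite -[X in _ = X - _]/(autZ_gal s (aut_of beta)) aut_of_gal //.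
    rewrite -[X in _ = X](aut_ofB (is_kernel_gal s hbeta) hbeta).
    move/(aut_of_inj k1 k2) => /(_ p pm); rewrite /u /twist !rmorphB => hp.
    apply/eqP; rewrite -subr_eq0; apply/eqP.
    transitivity (s (h p) - h p - (s (h' p) - h' p) - (s (beta p) - beta p)); first by ring.
    by rewrite hp subrr.
  have [g hg] := choice uK; exists g => p pm.
  apply: (fmorph_inj iota); rewrite -wp_iota rmorphB -hh // -hh' // -wpB.
  rewrite (@eq_wp _ _ aK _ u) //; last by move=> i im; rewrite hg.
  by rewrite /u [LHS]wpB hbeta // subr0.
apply/asboolP; pose beta i := h i - h' i - iota (g i).
have hbeta : is_kernel beta.
  by move=> p pm; rewrite !wpB hh // hh' // wp_iota hg // rmorphB subrr.
exists (aut_of beta) => s.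
rewrite -[LHS]/(z s - z' s) hz hz' -(aut_ofB (twist_kernel s hh) (twist_kernel s hh')).
rewrite -[X in _ = X - _]/(autZ_gal s (aut_of beta)) aut_of_gal //.
rewrite -(aut_ofB (is_kernel_gal s hbeta) hbeta); apply: eq_aut_of => p pm.
by rewrite /twist /beta !rmorphB gal_fix; ring.
Qed.

Lemma twist_classD c c' z z' : twist_class_of c z -> twist_class_of c' z' ->
  twist_class_of (fun i => c i + c' i) (z + z').
Proof.
move=> [h hh hz] [h' hh' hz']; exists (fun i => h i + h' i).
  by move=> p pm; rewrite wpD // hh // hh' // rmorphD.
move=> s; rewrite -[LHS]/(z s + z' s) hz hz'.
rewrite -(aut_ofD (twist_kernel s hh) (twist_kernel s hh')).
by apply: eq_aut_of => p pm; rewrite /twist rmorphD; ring.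
Qed.

End CocycleOfCoordinates.

(** * The isomorphism *)

Section Isomorphism.
Variables (k : fieldType) (char2 : 2%N \in [pchar k]) (m : nat) (m_gt0 : (0 < m)%N).
Local Notation n := m.*2.+1.
Variables (E : vectType k) (e : n.-tuple E) (q0 q1 : E -> k).
Hypotheses (q0_quad : quadratic_form q0) (q1_quad : quadratic_form q1).
Hypothesis q_reg : regular_pair e q0 q1.
Hypothesis an_neq0 : (disc_poly e q0 q1)`_n != 0.
Variables (K : fieldType) (iota : {rmorphism k -> K}).
Hypothesis K_sep : separable_closure iota.

Local Notation disc := (disc_poly e q0 q1).
Local Notation a := (fun i => disc`_i).
Local Notation scal := (alg_scal e q0 q1).
Local Notation d := (alg_d e q0 q1).
Local Notation autC := (aut_comm char2 q0_quad q1_quad q_reg an_neq0 (iota := iota)).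
Local Notation Aquot := (algA_quot e q0 q1 char2).
Local Notation act := (fun s : gal iota => autZ_gal s : {additive autZ autC -> autZ autC}).

Definition alg_of (c : nat -> k) : {poly %/ disc_monic e q0 q1} :=
  \sum_(l < n) scal (c l) * d l.

Lemma alg_ofB c c' : alg_of c - alg_of c' = alg_of (fun i => c i - c' i).
Proof.
rewrite /alg_of -sumrB; apply: eq_bigr => l _.
by rewrite -mulrBl; congr (_ * _); symmetry; exact: raddfB.
Qed.

Lemma alg_ofD c c' : alg_of c + alg_of c' = alg_of (fun i => c i + c' i).
Proof.
rewrite /alg_of -big_split; apply: eq_bigr => l _ /=.
by rewrite -mulrDl; congr (_ * _); symmetry; exact: raddfD.
Qed.

Lemma alg_class_eq c c' : algA_class char2 (alg_of c) = algA_class char2 (alg_of c') <->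
  exists g : nat -> k, forall p, (p < m.*2)%N -> wp m a g p = c p - c' p.
Proof.
rewrite /algA_class quot_piP alg_ofB; split => [/wp_add_scalP|h]; first exact.
exact/wp_add_scalP.
Qed.

Lemma alg_class_surj (x : Aquot) : exists c, x = algA_class char2 (alg_of c).
Proof.
have [c hc] := alg_basis char2 q0_quad q1_quad an_neq0 (repr x).
by exists c; rewrite /algA_class /alg_of -hc reprK.
Qed.


(** The graph of the isomorphism: a class in A determines h only up to the
    choices that [twist_class_eq] and [alg_class_eq] show to be harmless. *)
Definition corresponds (x : Aquot) (y : H1Aut autC) : Prop :=
  exists c (z : cocycle act),
    [/\ x = algA_class char2 (alg_of c), twist_class_of c z & y = H1class z].

Lemma corresponds_total x : exists y, corresponds x y.
Proof.
have [c xc] := alg_class_surj x.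
have [z hz] := twist_class_exists char2 q0_quad q1_quad q_reg an_neq0 K_sep c.
by exists (H1class z), c, z.
Qed.

Lemma corresponds_surj y : exists x, corresponds x y.
Proof.
have [c hc] := twist_class_surj m_gt0 K_sep (repr y).
exists (algA_class char2 (alg_of c)), c, (repr y); split=> //.
by rewrite /H1class reprK.
Qed.

Lemma corresponds_iff x x' y y' : corresponds x y -> corresponds x' y' -> x = x' <-> y = y'.
Proof.
move=> [c [z [-> hz ->]]] [c' [z' [-> hz' ->]]].
have := twist_class_eq m_gt0 K_sep hz hz'; have := alg_class_eq c c'.
by move=> h1 h2; split => [/h1/h2|/h2/h1].
Qed.

Lemma correspondsD x x' y y' : corresponds x y -> corresponds x' y' ->
  corresponds (x + x') (y + y').
Proof.
move=> [c [z [-> hz ->]]] [c' [z' [-> hz' ->]]].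
exists (fun i => c i + c' i), (z + z'); split.
- rewrite -alg_ofD; symmetry; exact: Quotient.pi_add.
- exact: twist_classD.
- symmetry; exact: Quotient.pi_add.
Qed.

Lemma iso_exists : exists phi : {additive Aquot -> H1Aut autC},
  bijective phi /\ forall x, corresponds x (phi x).
Proof.
have [f hf] := choice corresponds_total.
have [g hg] := choice corresponds_surj.
have fD x x' : f (x + x') = f x + f x'.
  by apply/(corresponds_iff (hf _) (correspondsD (hf x) (hf x'))).
have f0 : f 0 = 0 by apply: (addrI (f 0)); rewrite -fD !addr0.
pose phi : {additive Aquot -> H1Aut autC} :=
  HB.pack f (GRing.isNmodMorphism.Build _ _ f (conj f0 fD)).
exists phi; split=> //; exists g => [x|y].
  by apply/(corresponds_iff (hg _) (hf _)).
by apply/(corresponds_iff (hf _) (hg _)).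
Qed.

Lemma H1class_corresponds c (y : H1Aut autC) (z : cocycle act) :
  corresponds (algA_class char2 (alg_of c)) y -> H1class z = y <-> twist_class_of c z.
Proof.
move=> cy; split=> [zy|hz]; last first.
  have zc : corresponds (algA_class char2 (alg_of c)) (H1class z) by exists c, z.
  by apply/(corresponds_iff zc cy).
have [c' hc'] := twist_class_surj m_gt0 K_sep z.
have zc : corresponds (algA_class char2 (alg_of c')) (H1class z) by exists c', z.
have /alg_class_eq[g hg] : algA_class char2 (alg_of c') = algA_class char2 (alg_of c).
  by apply/(corresponds_iff zc cy).
have [h hh hz] := hc'; exists (fun i => h i - iota (g i)) => [p pm|s].
  by rewrite wpB // hh // wp_iota hg // -rmorphB; congr (iota _); ring.
rewrite hz; apply: eq_aut_of => p pm.
by rewrite /twist rmorphB gal_fix; ring.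
Qed.

End Isomorphism.

(** * Generators *)

(** When A1 is invertible this is an eigenvector of A0 A1^-1, over an extension
    containing a root of its characteristic polynomial. *)
Lemma pencil_eigenvector (F : fieldType) u u' (A0 A1 : 'M[F]_(u, u')) : u = u' -> (0 < u)%N ->
  exists (L : fieldType) (j : {rmorphism F -> L}) (z : 'rV[L]_u) (s0 s1 : L),
    [/\ z != 0, (s0 != 0) || (s1 != 0) & z *m (s0 *: map_mx j A0 + s1 *: map_mx j A1) = 0].
Proof.
move=> eu; case: _ / eu A0 A1 => A0 A1 u0.
have [A1u|A1n] := boolP (A1 \in unitmx); last first.
  have /rowV0Pn[z zk z0] : kermx A1 != 0 by rewrite kermx_eq0 row_free_unit.
  exists F, idfun, z, 0, 1; split; rewrite ?oner_eq0 ?orbT //.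
  have -> : map_mx idfun A1 = A1 by apply/matrixP => i j; rewrite mxE.
  by rewrite scale0r add0r scale1r; apply/sub_kermxP.
have [|L [j [x jx]]] := @ext_root F (char_poly (A0 *m invmx A1)).
  by rewrite size_char_poly; case: (u) u0.
rewrite map_char_poly -eigenvalue_root_char in jx.
have [z zx z0] := eigenvalueP jx.
exists L, j, z, 1, (- x); split; rewrite ?oner_eq0 //.
rewrite scale1r mulmxDr -scalemxAr scaleNr scalemxAl -zx map_mxM -!mulmxA -map_mxM.
by rewrite mulVmx // map_mx1 mulmx1 subrr.
Qed.

Lemma mulmx1C_eq (R : comUnitRingType) p p' (A : 'M[R]_(p, p')) (C : 'M[R]_(p', p)) :
  p = p' -> A *m C = 1%:M -> C *m A = 1%:M.
Proof. by move=> pp; case: _ / pp A C => A C; exact: mulmx1C. Qed.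

Section Generators.
Variables (k : fieldType) (char2 : 2%N \in [pchar k]) (m : nat) (m_gt0 : (0 < m)%N).
Local Notation n := m.*2.+1.
Variables (E : vectType k) (e : n.-tuple E) (q0 q1 : E -> k).
Hypotheses (q0_quad : quadratic_form q0) (q1_quad : quadratic_form q1).
Hypothesis q_reg : regular_pair e q0 q1.
Hypothesis an_neq0 : (disc_poly e q0 q1)`_n != 0.
Variables (K : fieldType) (iota : {rmorphism k -> K}).

Local Notation disc := (disc_poly e q0 q1).
Local Notation aK := (fun i => iota disc`_i).
Local Notation B0 := (gram e q0).
Local Notation B1 := (gram e q1).
Local Notation B0K := (map_mx iota B0).
Local Notation B1K := (map_mx iota B1).
Local Notation OmK := (map_mx iota (kernel_mx e q0 q1)).
Local Notation YK := (map_mx iota (dual_mx e q0 q1)).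
Local Notation shearK := (shear e q0 q1 iota).
Local Notation generator := (generator iota e q0 q1).

Let charK : 2%N \in [pchar K] := rmorph_char2 char2 iota.
Let addKK (x : K) : x + x = 0 := addrr_pchar2 charK x.

Lemma isotropic_polar p (W : 'M[K]_(p, n)) q : quadratic_form q ->
  (forall v : 'rV_n, (v <= W)%MS -> base_change iota e q v = 0) ->
  W *m map_mx iota (gram e q) *m W^T = 0.
Proof.
move=> qq hW; apply/matrixP => i j; rewrite -row_mul_tr row_mul -base_change_polar //.
by rewrite /polar !hW ?row_sub ?addmx_sub ?row_sub // !subr0 mxE.
Qed.

(** The linear forms b(omega_i, _) vanish on all the omega_l, so they are
    combinations of the y_j. *)
Lemma kernel_gram_dual q : quadratic_form q ->
  kernel_mx e q0 q1 *m gram e q *m (kernel_mx e q0 q1)^T = 0 ->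
  exists S, OmK *m map_mx iota (gram e q) = S *m YK^T.
Proof.
move=> qq h; have : OmK *m (OmK *m map_mx iota (gram e q))^T = 0.
  rewrite trmx_mul !map_trmx gram_sym -!map_mxM mulmxA h.
  by rewrite map_mx0.
case/(kernel_dualP char2 q0_quad q1_quad q_reg an_neq0) => M hM; exists M^T.
by apply: trmx_inj; rewrite hM trmx_mul !trmxK.
Qed.

(** Let U be the subspace of W on which the y_j vanish and u its dimension.  For
    w in U, the forms b_0(w, _) and b_1(w, _) are combinations of the y_j that vanish
    on W, and such combinations form a space of dimension u.  So b_0 and b_1 give two
    maps between spaces of dimension u; if u > 0, some b_0 s_0 + b_1 s_1 kills a
    nonzero w over an extension, and w is a point of X singular on a member of the
    pencil. *)
Lemma generator_dual_unit (W : 'M[K]_(m, n)) : generator W -> W *m YK \in unitmx.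
Proof.
move=> [Wfree Wiso]; set C := W *m YK.
have WB0 := isotropic_polar q0_quad (fun v hv => (Wiso v hv).1).
have WB1 := isotropic_polar q1_quad (fun v hv => (Wiso v hv).2).
rewrite -row_free_unit -kermx_eq0; apply/negPn/negP => N0.
have rk0 : (0 < \rank (kermx C))%N by rewrite lt0n mxrank_eq0.
have rkE : \rank (kermx C) = \rank (kermx C^T) by rewrite !mxrank_ker mxrank_tr.
set U := row_base (kermx C).
have UC : U *m C = 0 by apply/sub_kermxP; rewrite eq_row_base.
have [Z hZ] : exists Z, U *m W = Z *m OmK.
  by apply: (dual_kernelP char2 q0_quad q1_quad q_reg an_neq0); rewrite -mulmxA.
have key q : quadratic_form q ->
    kernel_mx e q0 q1 *m gram e q *m (kernel_mx e q0 q1)^T = 0 ->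
    W *m map_mx iota (gram e q) *m W^T = 0 ->
    exists A, U *m W *m map_mx iota (gram e q) = A *m (row_base (kermx C^T) *m YK^T).
  move=> qq hO hW; have [S hS] := kernel_gram_dual qq hO.
  have : (Z *m S <= row_base (kermx C^T))%MS.
    rewrite eq_row_base; apply/sub_kermxP.
    rewrite /C trmx_mul mulmxA -(mulmxA Z) -hS mulmxA -hZ.
    by rewrite -(mulmxA U) -(mulmxA U) hW mulmx0.
  by case/submxP => A hA; exists A; rewrite hZ -mulmxA hS [LHS]mulmxA hA -mulmxA.
have [A0 hA0] := key _ q0_quad (kernel_mx_isotropic0 char2 e q0_quad q1_quad) WB0.
have [A1 hA1] := key _ q1_quad (kernel_mx_isotropic1 char2 e q0_quad q1_quad) WB1.
have [L [j [z [s0 [s1 [z0 s01 hz]]]]]] := pencil_eigenvector A0 A1 rkE rk0.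
pose w := z *m map_mx j (U *m W).
have jE q : map_mx (j \o iota) (gram e q) = map_mx j (map_mx iota (gram e q)).
  by apply/matrixP => a b; rewrite !mxE.
have w0 : w != 0.
  have Ufree : row_free U := row_base_free _.
  rewrite /w mulmx_free_eq0 // /row_free mxrank_map.
  by rewrite mxrankMfree.
have wiso q : quadratic_form q ->
    (forall v : 'rV_n, (v <= W)%MS -> base_change iota e q v = 0) ->
    base_change (j \o iota) e q w = 0.
  move=> qq hW; rewrite /w map_mxM mulmxA base_change_isotropic //; last first.
    by rewrite jE map_trmx -!map_mxM isotropic_polar // map_mx0.
  rewrite big1 // => i _; rewrite -map_row.
  rewrite (base_change_map (i1 := iota) (i2 := j \o iota) (j := j) _ _ _ (fun=> erefl)).
  by rewrite hW ?row_sub // rmorph0 mulr0.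
have w00 := wiso _ q0_quad (fun v hv => (Wiso v hv).1).
have w01 := wiso _ q1_quad (fun v hv => (Wiso v hv).2).
have [|s00 s10] := @regular_gradients _ char2 _ _ _ _ _ q0_quad q1_quad q_reg
  _ (j \o iota) w s0 s1 w0 w00 w01.
  set X := row_base _ *m _ in hA0 hA1.
  have hw (G : 'M[K]_n) A : U *m W *m G = A *m X ->
      w *m map_mx j G = z *m map_mx j A *m map_mx j X.
    by move=> hA; rewrite /w -mulmxA -map_mxM hA map_mxM mulmxA.
  rewrite !jE mulmxDr -!scalemxAr (hw _ _ hA0) (hw _ _ hA1) !scalemxAl -mulmxDl.
  by rewrite -!scalemxAl !scalemxAr -mulmxDr hz mul0mx.
by move: s01; rewrite s00 s10 eqxx.
Qed.

Section NormalForm.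
(** The rows of eta are the vectors dual to the y_j of a normal form: on their span
    the x_i vanish, q_0 and q_1 are diagonal, and the y_j are coordinates. *)
Variables (eta : 'M[k]_(m, n)) (r : nat -> k).
Hypothesis eta_dual : eta *m dual_mx e q0 q1 = 1%:M.
Hypothesis eta_iso0 : eta *m B0 *m eta^T = 0.
Hypothesis eta_iso1 : eta *m B1 *m eta^T = 0.
Hypothesis eta_q0 : forall j : 'I_m,
  base_change (idfun : {rmorphism k -> k}) e q0 (row j eta) = r j.*2.+1.
Hypothesis eta_q1 : forall j : 'I_m,
  base_change (idfun : {rmorphism k -> k}) e q1 (row j eta) = r j.*2.
Local Notation etaK := (map_mx iota eta).

Lemma eta_dualK : etaK *m YK = 1%:M.
Proof. by rewrite -map_mxM eta_dual map_mx1. Qed.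

Lemma base_change_eta0 (c : 'rV[K]_m) :
  base_change iota e q0 (c *m etaK) = \sum_(j < m) c 0 j ^+ 2 * iota (r j.*2.+1).
Proof.
rewrite base_change_isotropic //; last by rewrite map_trmx -!map_mxM eta_iso0 map_mx0.
apply: eq_bigr => j _; congr (_ * _).
by rewrite -map_row (base_change_map (i1 := idfun) _ _ _ (fun=> erefl)) eta_q0.
Qed.

Lemma base_change_eta1 (c : 'rV[K]_m) :
  base_change iota e q1 (c *m etaK) = \sum_(j < m) c 0 j ^+ 2 * iota (r j.*2).
Proof.
rewrite base_change_isotropic //; last by rewrite map_trmx -!map_mxM eta_iso1 map_mx0.
apply: eq_bigr => j _; congr (_ * _).
by rewrite -map_row (base_change_map (i1 := idfun) _ _ _ (fun=> erefl)) eta_q1.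
Qed.

Lemma eta_shear M : etaK *m shearK M = etaK + M *m OmK.
Proof. by rewrite /shear mulmxDr mulmx1 !mulmxA eta_dualK mul1mx. Qed.

Lemma eta_shear_dual M : etaK *m shearK M *m YK = 1%:M.
Proof. by rewrite -mulmxA shear_dual // eta_dualK. Qed.

Let a_gt i : (n < i)%N -> aK i = 0.
Proof. by move=> ni; rewrite /= disc_gt // rmorph0. Qed.

Lemma hankel_generator h : over e q0 q1 iota r h -> generator (etaK *m shearK (hankel m h)).
Proof.
move=> hh; split.
  by apply/row_freeP; exists YK; exact: eta_shear_dual.
move=> v /submxP[c ->]; rewrite mulmxA base_change_shear0 // base_change_shear1 //.
rewrite base_change_eta0 base_change_eta1 -mulmxA eta_dualK mulmx1.
rewrite form0_hankel // form1_hankel // -!big_split !big1 // => j _ /=.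
  by rewrite hh ?addKK //; have := ltn_ord j; lia.
by rewrite hh ?addKK //; have := ltn_ord j; lia.
Qed.

(** By [generator_dual_unit], W is the graph of a map from the span of eta to the
    span of the omega_i.  That q_0 and q_1 vanish on it is the hypothesis of
    [hankelP]. *)
Lemma generator_hankel (W : 'M[K]_(m, n)) : generator W ->
  exists C h, [/\ C \in unitmx, over e q0 q1 iota r h & W = C *m (etaK *m shearK (hankel m h))].
Proof.
move=> gW; have CU := generator_dual_unit gW; case: gW => Wfree Wiso.
have [C CE] : exists C, C = W *m YK by exists (W *m YK).
rewrite -CE in CU; exists C.
have [Z hZ] : exists Z, W - C *m etaK = Z *m OmK.
  apply: (dual_kernelP char2 q0_quad q1_quad q_reg an_neq0).
  by rewrite mulmxBl -CE -(mulmxA C) eta_dualK mulmx1 subrr.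
pose M := invmx C *m Z.
have WM : W = C *m (etaK *m shearK M).
  by rewrite eta_shear mulmxDr mulmxA mulKVmx // -hZ addrC subrK.
have Wc (c : 'rV_m) : (c *m etaK *m shearK M <= W)%MS.
  have -> : c *m etaK *m shearK M = c *m invmx C *m W.
    by rewrite [in RHS]WM [RHS]mulmxA mulmxKV // mulmxA.
  exact: submxMl.
have cY (c : 'rV[K]_m) : c *m etaK *m YK = c by rewrite -mulmxA eta_dualK mulmx1.
have [||h Mh hh] := @hankelP _ charK m _ a_gt M (fun i => iota (r i)).
- move=> c; have [+ _] := Wiso _ (Wc c); rewrite base_change_shear0 // base_change_eta0 cY.
  by move/eqP; rewrite addrC addr_eq0 (oppr_pchar2 charK) => /eqP.
- move=> c; have [_] := Wiso _ (Wc c); rewrite base_change_shear1 // base_change_eta1 cY.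
  by move/eqP; rewrite addrC addr_eq0 (oppr_pchar2 charK) => /eqP.
by exists h; split=> //; rewrite -Mh.
Qed.

Hypothesis K_sep : separable_closure iota.
Local Notation autC := (aut_comm char2 q0_quad q1_quad q_reg an_neq0 (iota := iota)).
Local Notation act := (fun s : gal iota => autZ_gal s : {additive autZ autC -> autZ autC}).

Lemma map_eta_shear (s : gal iota) h :
  map_mx s (etaK *m shearK (hankel m h)) = etaK *m shearK (hankel m (fun i => s (h i))).
Proof.
rewrite map_mxM shear_gal; congr (_ *m shearK _); apply/matrixP => i j; rewrite !mxE //.
by rewrite gal_fix.
Qed.

Lemma eta_shear_mul h h' : etaK *m shearK (hankel m h) *m shearK (hankel m h') =
  etaK *m shearK (hankel m (fun i => h i + h' i)).
Proof.
rewrite -mulmxA shearD //; congr (_ *m shearK _).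
by apply/matrixP => i j; rewrite !mxE.
Qed.

Lemma eta_shear_inj M N : (etaK *m shearK M <= etaK *m shearK N)%MS -> M = N.
Proof.
case/submxP => D hD.
have D1 : D = 1%:M.
  have := congr1 (mulmx^~ YK) hD; rewrite /= -[D *m _ *m _]mulmxA !eta_shear_dual mulmx1.
  by move<-.
move: hD; rewrite D1 mul1mx !eta_shear => /addrI.
have /row_freeP[T hT] := kernel_mx_freeF char2 q0_quad q1_quad q_reg an_neq0 iota.
by move/(congr1 (mulmx^~ T)); rewrite /= -!mulmxA hT !mulmx1.
Qed.

(** The Galois group acts on the generator of parameter h by acting on h, and the
    isometry of parameter g translates h by g. *)
Lemma twist_class_generators (z : cocycle act) : twist_class_of r z <->
  exists2 W, generator W & forall s : gal iota, (map_mx s W == W *m aut_mx (z s))%MS.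
Proof.
split=> [[h hh hz]|[W gW hW]].
  exists (etaK *m shearK (hankel m h)); first exact: hankel_generator.
  move=> s; rewrite map_eta_shear hz aut_ofE; last exact: twist_kernel hh.
  rewrite eta_shear_mul; apply/eqmxP.
  suff -> : hankel m (fun i => h i + twist s h i) = hankel m (fun i => s (h i)) by [].
  by apply/matrixP => i j; rewrite !mxE /twist addrC subrK.
have [C [h [CU hh WE]]] := generator_hankel gW.
exists h => // s; have [g hg zs] := aut_of_surj m_gt0 (z s).
rewrite zs; have := hW s; rewrite zs aut_ofE // WE map_mxM map_eta_shear.
rewrite -(mulmxA C) eta_shear_mul => /andP[le _].
have : hankel m (fun i => s (h i)) = hankel m (fun i => h i + g i).
  apply: eta_shear_inj.
  have CsU : map_mx s C \in unitmx by rewrite map_unitmx.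
  rewrite -[X in (X <= _)%MS](mulKmx CsU).
  exact: submx_trans (submxMl _ _) (submx_trans le (submxMl _ _)).
move=> heq'; apply: eq_aut_of => p pm.
by rewrite /twist (hankel_inj m_gt0 pm heq') addrAC subrr add0r.
Qed.

End NormalForm.
End Generators.

(** * Normal forms *)

Lemma span_map_comb (k : fieldType) (V : vectType k) (I : eqType) (f : I -> V) (s : seq I) v :
  uniq s -> v \in <<[seq f i | i <- s]>>%VS -> exists c : I -> k, v = \sum_(i <- s) c i *: f i.
Proof.
elim: s v => [|i s IH] v /=.
  by rewrite span_nil memv0 => _ /eqP->; exists (fun=> 0); rewrite big_nil.
case/andP=> nis us; rewrite span_cons => /memv_addP[v1 /vlineP[b ->] [v2 /(IH _ us)[c ->] ->]].
exists (fun j => if j == i then b else c j); rewrite big_cons eqxx; congr (_ + _).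
by apply: eq_big_seq => j js; case: eqP js nis => // -> ->.
Qed.

Section Coordinates.
Variables (k : fieldType) (char2 : 2%N \in [pchar k]) (n : nat).
Variables (E : vectType k) (e : n.-tuple E).
Hypothesis e_basis : basis_of fullv e.

Definition vec (v : 'rV[k]_n) : E := \sum_i v 0 i *: e`_i.

Lemma vecD v w : vec (v + w) = vec v + vec w.
Proof. by rewrite /vec -big_split; apply: eq_bigr => i _; rewrite mxE scalerDl. Qed.

Lemma vecZ c v : vec (c *: v) = c *: vec v.
Proof. by rewrite /vec scaler_sumr; apply: eq_bigr => i _; rewrite mxE scalerA. Qed.

Lemma vec_delta i : vec (delta_mx 0 i) = e`_i.
Proof.
rewrite /vec (bigD1 i) //= mxE !eqxx scale1r big1 ?addr0 // => j nj.
by rewrite mxE eqxx (negPf nj) scale0r.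
Qed.

Lemma vec0 : vec 0 = 0.
Proof. by rewrite /vec big1 // => i _; rewrite mxE scale0r. Qed.

Lemma hom_vec (f : 'Hom(E, k^o)) v : f (vec v) = \sum_i v 0 i * f e`_i.
Proof. by rewrite linear_sum; apply: eq_bigr => i _; rewrite linearZ. Qed.

Lemma polar_vec (q : E -> k) v w : quadratic_form q ->
  polar q (vec v) (vec w) = (v *m gram e q *m w^T) 0 0.
Proof.
move=> [qZ ql qr].
have q0 : q 0 = 0 by rewrite -(scale0r 0) qZ expr0n mul0r.
have p0l x : polar q 0 x = 0 by rewrite /polar add0r q0 subr0 subrr.
have p0r x : polar q x 0 = 0 by rewrite /polar addr0 q0 subr0 subrr.
have -> : polar q (vec v) (vec w) = \sum_i v 0 i * polar q e`_i (vec w).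
  move: (vec w) => W; rewrite /vec; elim/big_rec2: _ => [|i x y _ IH].
    exact: p0l.
  by rewrite ql IH.
rewrite -mulmxA mxE; apply: eq_bigr => i _; congr (_ * _); rewrite mxE.
rewrite /vec; elim/big_rec2: _ => [|j x y _ IH]; first exact: p0r.
by rewrite qr IH [w^T _ _]mxE [gram _ _ _ _]mxE mulrC.
Qed.

Lemma quadratic_vec (q : E -> k) v : quadratic_form q ->
  q (vec v) = base_change (idfun : {rmorphism k -> k}) e q v.
Proof.
move=> qq; have [qZ _ _] := qq.
have bc_delta i : base_change (idfun : {rmorphism k -> k}) e q (delta_mx 0 i) = q e`_i.
  rewrite /base_change (bigD1 i) //= mxE !eqxx expr1n mulr1 big1 ?addr0 => [|j nj].
    rewrite big1 ?addr0 // => j _; rewrite big1 // => l jl; rewrite !mxE !eqxx /=.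
    have [ji|] := eqVneq j i; last by rewrite mulr0 mul0r.
    by have [li|] := eqVneq l i; rewrite ?mulr0 //; rewrite ji li ltnn in jl.
  by rewrite mxE (negPf nj) andbF expr0n mulr0.
have vE : v = \sum_(i <- index_enum 'I_n) v 0 i *: delta_mx 0 i.
  by rewrite [LHS]row_sum_delta.
rewrite vE; elim: (index_enum _) => [|i s IH].
  by rewrite big_nil vec0 base_change0 // quadratic0.
rewrite big_cons base_changeD // base_changeZ -IH bc_delta vecD.
have pE x y : q (x + y) = q x + q y + polar q x y by rewrite /polar; ring.
rewrite pE vecZ vec_delta qZ; congr (_ + _).
by rewrite map_mx_id // -polar_vec // vecZ vec_delta.
Qed.

End Coordinates.

Section NormalFormCoordinates.
Variables (k : fieldType) (char2 : 2%N \in [pchar k]) (m : nat).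
Local Notation n := m.*2.+1.
Variables (E : vectType k) (e : n.-tuple E) (q0 q1 : E -> k).
Hypothesis e_basis : basis_of fullv e.
Hypotheses (q0_quad : quadratic_form q0) (q1_quad : quadratic_form q1).
Hypothesis q_reg : regular_pair e q0 q1.
Hypothesis an_neq0 : (disc_poly e q0 q1)`_n != 0.
Variables (x : 'I_m.+1 -> 'Hom(E, k^o)) (y : 'I_m -> 'Hom(E, k^o)) (r : (m.*2).-tuple k).
Hypothesis nf : normal_form e q0 q1 x y r.

Local Notation disc := (disc_poly e q0 q1).
Local Notation B0 := (gram e q0).
Local Notation B1 := (gram e q1).
Local Notation bc q := (base_change (idfun : {rmorphism k -> k}) e q).
Local Notation om := (kernel_coef e q0 q1).

Let X : 'M[k]_(n, m.+1) := \matrix_(b, i) x i e`_b.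
Let Y : 'M[k]_(n, m) := \matrix_(b, i) y i e`_b.
Let addkk (z : k) : z + z = 0 := addrr_pchar2 char2 z.

Lemma x_vec v i : x i (vec e v) = (v *m X) 0 i.
Proof. by rewrite hom_vec mxE; apply: eq_bigr => j _; rewrite mxE. Qed.

Lemma y_vec v i : y i (vec e v) = (v *m Y) 0 i.
Proof. by rewrite hom_vec mxE; apply: eq_bigr => j _; rewrite mxE. Qed.

(** The coordinate functions of the basis e are combinations of the x_i and y_j;
    this gives a right inverse, and the matrix is square. *)
Lemma nf_left_inverse : exists C : 'M[k]_(m.+1 + m, n), C *m row_mx X Y = 1%:M.
Proof.
have [bas _ _] := nf.
have ex b : exists C : 'cV[k]_(m.+1 + m), row_mx X Y *m C = delta_mx b 0.
  have : linfun (coord e b : E -> k^o) \in fullv by exact: memvf.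
  rewrite -(span_basis bas) span_cat => /memv_addP[f1 hf1 [f2 hf2 fE]].
  have [c1 E1] := span_map_comb (enum_uniq _) hf1.
  have [c2 E2] := span_map_comb (enum_uniq _) hf2.
  exists (col_mx (\col_i c1 i) (\col_i c2 i)).
  rewrite mul_row_col; apply/colP => l; rewrite !mxE eqxx andbT.
  have -> : ((l == b)%:R : k) = linfun (coord e b : E -> k^o) e`_l.
    by rewrite lfunE /= coord_free // (basis_free e_basis).
  rewrite fE add_lfunE E1 E2 !big_enum /= !sum_lfunE; congr (_ + _); apply: eq_bigr => i _.
    by rewrite !mxE scale_lfunE mulrC.
  by rewrite !mxE scale_lfunE mulrC.
have [C hC] := choice ex.
exists (\matrix_(i, b) C b i 0).
apply: mulmx1C_eq; first by rewrite addSn addnn.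
apply/matrixP => i b; have /colP/(_ i) := hC b.
rewrite !mxE andbT => <-; apply: eq_bigr => l _; by rewrite !mxE.
Qed.

Lemma nf_q0 v : bc q0 v = \sum_(i < m.+1) disc`_(i.*2) * (v *m X) 0 i ^+ 2
   + \sum_(i < m) (v *m X) 0 (lift ord0 i) * (v *m Y) 0 i
   + \sum_(i < m) r`_(i.*2.+1) * (v *m Y) 0 i ^+ 2.
Proof.
have [_ h _] := nf; rewrite -quadratic_vec // h; congr (_ + _ + _); apply: eq_bigr => i _.
- by rewrite x_vec disc_coefE //; have := ltn_ord i; lia.
- by rewrite x_vec y_vec.
- by rewrite y_vec.
Qed.

Lemma nf_q1 v : bc q1 v = \sum_(i < m.+1) disc`_(i.*2.+1) * (v *m X) 0 i ^+ 2
   + \sum_(i < m) (v *m X) 0 (widen_ord (leqnSn m) i) * (v *m Y) 0 i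
   + \sum_(i < m) r`_(i.*2) * (v *m Y) 0 i ^+ 2.
Proof.
have [_ _ h] := nf; rewrite -quadratic_vec // h; congr (_ + _ + _); apply: eq_bigr => i _.
- by rewrite x_vec disc_coefE //; have := ltn_ord i; lia.
- by rewrite x_vec y_vec.
- by rewrite y_vec.
Qed.

Lemma sqr_form_add p (b : 'I_p -> k) (u v : 'rV[k]_p) :
  \sum_i b i * (u + v) 0 i ^+ 2 = \sum_i b i * u 0 i ^+ 2 + \sum_i b i * v 0 i ^+ 2.
Proof.
rewrite -big_split; apply: eq_bigr => i _ /=.
by rewrite mxE sqrrD mulr2n addkk addr0 mulrDr.
Qed.

Lemma gram_form q (v w : 'rV[k]_n) : quadratic_form q ->
  (v *m gram e q *m w^T) 0 0 = bc q (v + w) - bc q v - bc q w.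
Proof. by move=> qq; rewrite base_changeD // map_mx_id //; ring. Qed.

Lemma nf_pair0 (v w : 'rV[k]_n) : w *m Y = 0 ->
  (v *m B0 *m w^T) 0 0 = \sum_(i < m) (w *m X) 0 (lift ord0 i) * (v *m Y) 0 i.
Proof.
move=> wY; rewrite gram_form // !nf_q0 !mulmxDl wY addr0 sqr_form_add.
rewrite [X in _ - _ - (_ + X + _)]big1 => [|i _]; last by rewrite [X in _ * X]mxE mulr0.
rewrite [X in _ - _ - (_ + _ + X)]big1 => [|i _]; last by rewrite mxE expr0n mulr0.
have -> : \sum_(i < m) (v *m X + w *m X) 0 (lift ord0 i) * (v *m Y) 0 i =
   \sum_(i < m) (v *m X) 0 (lift ord0 i) * (v *m Y) 0 i
   + \sum_(i < m) (w *m X) 0 (lift ord0 i) * (v *m Y) 0 i.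
  by rewrite -big_split; apply: eq_bigr => i _ /=; rewrite mxE mulrDl.
ring.
Qed.

Lemma nf_pair1 (v w : 'rV[k]_n) : w *m Y = 0 ->
  (v *m B1 *m w^T) 0 0 = \sum_(i < m) (w *m X) 0 (widen_ord (leqnSn m) i) * (v *m Y) 0 i.
Proof.
move=> wY; rewrite gram_form // !nf_q1 !mulmxDl wY addr0 sqr_form_add.
rewrite [X in _ - _ - (_ + X + _)]big1 => [|i _]; last by rewrite [X in _ * X]mxE mulr0.
rewrite [X in _ - _ - (_ + _ + X)]big1 => [|i _]; last by rewrite mxE expr0n mulr0.
have -> : \sum_(i < m) (v *m X + w *m X) 0 (widen_ord (leqnSn m) i) * (v *m Y) 0 i =
   \sum_(i < m) (v *m X) 0 (widen_ord (leqnSn m) i) * (v *m Y) 0 i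
   + \sum_(i < m) (w *m X) 0 (widen_ord (leqnSn m) i) * (v *m Y) 0 i.
  by rewrite -big_split; apply: eq_bigr => i _ /=; rewrite mxE mulrDl.
ring.
Qed.

Lemma mx_form_eq (A A' : 'rV[k]_n) :
  (forall v : 'rV_n, (v *m A^T) 0 0 = (v *m A'^T) 0 0) -> A = A'.
Proof.
move=> h; apply/rowP => i; have := h (delta_mx 0 i); rewrite -!rowE !mxE.
by [].
Qed.

Lemma gram_dot q (v w : 'rV[k]_n) : (v *m (w *m gram e q)^T) 0 0 = (v *m gram e q *m w^T) 0 0.
Proof. by rewrite trmx_mul gram_sym mulmxA. Qed.

(** The vectors eps_i and eta_j form the basis dual to (x, y).  The normal form
    shows that sum_i t ^ i eps_i is a kernel vector of the pencil with
    q_1(eps_m) = a_n, so that eps_i = omega_i by [kernel_seq_unique]. *)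
Lemma nf_eta : exists eta : 'M[k]_(m, n),
  [/\ eta *m dual_mx e q0 q1 = 1%:M, eta *m B0 *m eta^T = 0, eta *m B1 *m eta^T = 0,
      forall j : 'I_m, bc q0 (row j eta) = r`_(j.*2.+1)
    & forall j : 'I_m, bc q1 (row j eta) = r`_(j.*2)].
Proof.
have [C hC] := nf_left_inverse.
pose eps := usubmx C; pose eta := dsubmx C.
have [[eX eY] [hX hY]] : (eps *m X = 1%:M /\ eps *m Y = 0) /\ (eta *m X = 0 /\ eta *m Y = 1%:M).
  move: hC; rewrite -[C]vsubmxK -/eps -/eta mul_col_row scalar_mx_block.
  by case/eq_block_mx => -> -> -> ->.
pose u i := if insub i is Some j then row j eps else 0.
have uY i : u i *m Y = 0.
  by rewrite /u; case: insub => [j|]; rewrite ?mul0mx // -row_mul eY row0.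
have uX i (j : 'I_m.+1) : (u i *m X) 0 j = (i == j)%:R.
  rewrite /u; case: insubP => [j' _ <-|]; first by rewrite -row_mul eX !mxE.
  rewrite mul0mx mxE; case: eqP => // -> ; by rewrite ltn_ord.
have p0 (v : 'rV[k]_n) i : (v *m B0 *m (u i)^T) 0 0 = \sum_(l < m) (i == l.+1)%:R * (v *m Y) 0 l.
  by rewrite nf_pair0 //; apply: eq_bigr => l _; rewrite uX lift0.
have p1 (v : 'rV[k]_n) i : (v *m B1 *m (u i)^T) 0 0 = \sum_(l < m) (i == l)%:R * (v *m Y) 0 l.
  by rewrite nf_pair1 //; apply: eq_bigr => l _; rewrite uX.
have [||i mi|lam hlam] :=
  kernel_seq_unique char2 q0_quad q1_quad q_reg an_neq0 (iota := idfun) (u := u).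
- apply: mx_form_eq => v; rewrite map_mx_id // gram_dot p0 trmx0 mulmx0 mxE big1 // => l _.
  by rewrite mul0r.
- by move=> i; apply: mx_form_eq => v; rewrite !map_mx_id // !gram_dot p0 p1.
- by rewrite /u insubF // ltnNge -ltnS ltnS mi.
have {}hlam i : u i = lam *: om i by rewrite hlam map_mx_id.
have lam1 : lam = 1.
  have : bc q1 (u m) = disc`_n.
    rewrite nf_q1 uY (bigD1 ord_max) //= uX eqxx expr1n mulr1 big1 => [|i ni]; last first.
      by rewrite uX; case: eqP => [mi|]; rewrite ?expr0n ?mulr0 //; case/eqP: ni; apply: val_inj.
    rewrite !big1 ?addr0 // => i _; first by rewrite mxE expr0n mulr0.
    by rewrite [in X in _ * X]mxE mulr0.
  rewrite hlam base_changeZ -disc_odd // => /eqP.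
  rewrite -subr_eq0 -[X in _ - X]mul1r -mulrBl mulf_eq0 (negPf an_neq0) orbF.
  rewrite (oppr_pchar2 char2) -[X in _ + X](expr1n _ 2).
  have -> : lam ^+ 2 + 1 ^+ 2 = (lam + 1) ^+ 2 by rewrite sqrrD mulr2n addkk addr0.
  by rewrite sqrf_eq0 addr_eq0 (oppr_pchar2 char2) => /eqP.
have dualY : dual_mx e q0 q1 = Y.
  apply/matrixP => b i; rewrite !mxE.
  have -> : om i = u i by rewrite hlam lam1 scale1r.
  have := p1 (delta_mx 0 b) i; rewrite -gram_dot -!rowE !mxE => ->.
  rewrite (bigD1 i) //= eqxx mul1r big1 ?addr0 ?mxE // => l nl.
  by rewrite eq_sym -[_ == _ :> nat]/(l == i) (negPf nl) mul0r.
have row_etaX j : row j eta *m X = 0 by rewrite -row_mul hX row0.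
have q0eta (w : 'rV[k]_n) : w *m X = 0 -> bc q0 w = \sum_(i < m) r`_(i.*2.+1) * (w *m Y) 0 i ^+ 2.
  move=> wX; rewrite nf_q0 wX big1 ?add0r => [|i _]; last by rewrite mxE expr0n mulr0.
  by rewrite big1 ?add0r // => i _; rewrite [X in X * _]mxE mul0r.
have q1eta (w : 'rV[k]_n) : w *m X = 0 -> bc q1 w = \sum_(i < m) r`_(i.*2) * (w *m Y) 0 i ^+ 2.
  move=> wX; rewrite nf_q1 wX big1 ?add0r => [|i _]; last by rewrite mxE expr0n mulr0.
  by rewrite big1 ?add0r // => i _; rewrite [X in X * _]mxE mul0r.
have sumd (b : 'I_m -> k) j : \sum_(i < m) b i * (row j eta *m Y) 0 i ^+ 2 = b j.
  rewrite -row_mul hY (bigD1 j) //= !mxE eqxx expr1n mulr1 big1 ?addr0 // => i ni.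
  by rewrite !mxE eq_sym (negPf ni) expr0n mulr0.
exists eta; split.
- by rewrite dualY.
- apply/matrixP => i j; rewrite -row_mul_tr row_mul gram_form //.
  rewrite !q0eta ?mulmxDl ?row_etaX ?addr0 //.
  by rewrite sqr_form_add mxE; ring.
- apply/matrixP => i j; rewrite -row_mul_tr row_mul gram_form //.
  rewrite !q1eta ?mulmxDl ?row_etaX ?addr0 //.
  by rewrite sqr_form_add mxE; ring.
- by move=> j; rewrite q0eta // (sumd (fun i => r`_(i.*2.+1))).
- by move=> j; rewrite q1eta // (sumd (fun i => r`_(i.*2))).
Qed.

End NormalFormCoordinates.

Theorem theorem1p5 (k : fieldType) (char2 : 2%N \in [pchar k])
    (m : nat) (m_gt0 : (0 < m)%N)
    (E : vectType k) (e : (m.*2.+1).-tuple E) (e_basis : basis_of fullv e)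
    (q0 q1 : E -> k) (q0_quad : quadratic_form q0) (q1_quad : quadratic_form q1)
    (q_reg : regular_pair e q0 q1)
    (an_neq0 : disc_coef e q0 q1 m.*2.+1 != 0)
    (K : fieldType) (iota : {rmorphism k -> K}) (K_sep : separable_closure iota) :
  exists (autC : aut_commutative iota e q0 q1)
         (phi : {additive algA_quot e q0 q1 char2 -> H1Aut autC}),
    bijective phi /\
    forall (x : 'I_m.+1 -> 'Hom(E, k^o)) (y : 'I_m -> 'Hom(E, k^o))
           (r : (m.*2).-tuple k),
      normal_form e q0 q1 x y r ->
      generators_torsor_class (phi (algA_class char2 (r_invariant e q0 q1 r))).
Proof.
have an : (disc_poly e q0 q1)`_(m.*2.+1) != 0 by rewrite -disc_coefE.
have [phi [phi_bij phiP]] := iso_exists (iota := iota) char2 m_gt0 q0_quad q1_quad q_reg an K_sep.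
exists (aut_comm char2 q0_quad q1_quad q_reg an (iota := iota)), phi; split=> // x y r nf z.
have [eta [h1 h2 h3 h4 h5]] := nf_eta char2 e_basis q0_quad q1_quad q_reg an nf.
pose c l := if (l < m.*2)%N then r`_l else 0.
have -> : r_invariant e q0 q1 r = alg_of e q0 q1 c by exact: r_invariantE.
rewrite (H1class_corresponds m_gt0 K_sep z (phiP _)).
apply: (twist_class_generators m_gt0 h1 h2 h3 _ _ z) => j.
  by rewrite h4 /c ifT //; have := ltn_ord j; lia.
by rewrite h5 /c ifT //; have := ltn_ord j; lia.
Qed.
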